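(* Let $a,b\in\mathbb{R}^+\cup\{\infty\}$, $n\ge1$, $\Lambda:=(-a,b)\times\mathbb{R}^n\times\mathbb{R}$, and let $(t_\varepsilon)_\varepsilon$, $(s_\varepsilon)_\varepsilon$, $s$ satisfy the following hypotheses: (1) $t_\varepsilon(U,X,V)=(U,\,x_\varepsilon(U,X),\,V+g_\varepsilon(U,X)+h_\varepsilon(U,X))$ with $x_\varepsilon\in C^\infty((-a,b)\times\mathbb{R}^n,\mathbb{R}^n)$, $g_\varepsilon,h_\varepsilon\in C^\infty((-a,b)\times\mathbb{R}^n,\mathbb{R})$, $(h_\varepsilon)_\varepsilon$ uniformly bounded on compact subsets of $(-a,b)\times\mathbb{R}^n$, and $(t_\varepsilon)_\varepsilon$ has property (E+); (2) $s_\varepsilon(U,X,V)=(U,\,x_\varepsilon(U,X),\,V+g_\varepsilon(U,X))$ and $(s_\varepsilon)_\varepsilon$ has property (E); (3) $s(U,X,V)=(U,\,x(U,X),\,V+g(U,X))$ with $x,g$ continuous, and $\hat s:=(U,x)$ is injective on some open $W\subseteq(-a,b)\times\mathbb{R}^n$ containing $(-a,0]\times\mathbb{R}^n$; (4) $s_\varepsilon\to s$ uniformly on compact subsets of $\Lambda$; (5) $T:=[(t_\varepsilon)_\varepsilon]\in\mathcal{G}[\Lambda,\Lambda]$ and $S:=[(s_\varepsilon)_\varepsilon]\in\mathcal{G}[\Lambda,\Lambda]$. Then for every $p\in\Lambda$ with $U$-coordinate $0$ there exists an open neighbourhood $A$ of $p$ in $\Lambda$ such that $T$ is invertible on $A$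 with inversion data $[A,\mathbb{R}^{n+2},T^\diamond,B,Q]$, where $T^\diamond\in\mathcal{G}[\mathbb{R}^{n+2},D]$ and $B,Q,D$ are bounded open subsets of $\Lambda$ with $Q\subseteq B$ and $A\subseteq D$.
   Context: Colombeau setting: for open $U\subseteq\mathbb{R}^n$, $\mathcal{E}(U)=C^\infty(U,\mathbb{R})^{(0,1]}$; $\mathcal{E}_M(U)$ (moderate nets) consists of $(u_\varepsilon)_\varepsilon$ with: for all compact $K\subseteq U$ and $\alpha\in\mathbb{N}_0^n$ there is $N$ with $\sup_K|\partial^\alpha u_\varepsilon|=O(\varepsilon^{-N})$ as $\varepsilon\to0$; $\mathcal{N}(U)$ (negligible nets) consists of $(u_\varepsilon)_\varepsilon$ with $\sup_K|\partial^\alpha u_\varepsilon|=O(\varepsilon^m)$ for all $K$, $\alpha$, $m$; $\mathcal{G}(U)=\mathcal{E}_M(U)/\mathcal{N}(U)$, with classes denoted $[(u_\varepsilon)_\varepsilon]$. For open $U\subseteq\mathbb{R}^n$, $V\subseteq\mathbb{R}^m$, a net $(u_\varepsilon)_\varepsilon\in C^\infty(U,V)^{(0,1]}$ is c-bounded from $U$ into $V$ if (1) for every compact $K\subseteq U$ there are compact $L\subseteq V$ and $\varepsilon_0$ with $u_\varepsilon(K)\subseteq L$ for $\varepsilon\le\varepsilon_0$, and (2) all components of $(u_\varepsilon)_\varepsilon$ are moderate; $u\in\mathcal{G}(U)^m$ is c-bounded from $U$ into $V$ if it has a representative with these properties (it suffices that they hold for $\varepsilon$ below some $\varepsilon_1$);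 $\mathcal{G}[U,V]$ denotes the set of such $u$. If $u\in\mathcal{G}(U)^m$ is c-bounded into $V$ and $v\in\mathcal{G}(V)^p$, the composition $v\circ u:=[(v_\varepsilon\circ u_\varepsilon)_\varepsilon]\in\mathcal{G}(U)^p$ is well defined. Invertibility: for open $U\subseteq\mathbb{R}^n$, $u\in\mathcal{G}(U)^n$ and open $G\subseteq U$: $u$ is left invertible on $G$ with data $[G,V,v,H]$ if $V\subseteq\mathbb{R}^n$ is open, $v\in\mathcal{G}(V)^n$, $H\subseteq V$ is open, $u|_G$ is c-bounded into $H$ and $v\circ u|_G=\mathrm{id}_G$; $u$ is right invertible on $G$ with data $[G,V,v,H]$ if $v|_H$ is c-bounded into $G$ and $u\circ v|_H=\mathrm{id}_H$; $u$ is invertible on $G$ with inversion data $[G,V,v,H_l,H_r]$ if it is left invertible with data $[G,V,v,H_l]$ and right invertible with data $[G,V,v,H_r]$. Property (E): a net $(u_\varepsilon)_\varepsilon$ of smooth maps $(-a,b)\times\mathbb{R}^n\times\mathbb{R}\to(-a,b)\times\mathbb{R}^n\times\mathbb{R}$ has property (E) if for every compact $K\subseteq\mathbb{R}^n$ there exist $\alpha\in(0,b)$ and $\varepsilon_0\in(0,1]$ such that $u_\varepsilon$ is injective on $(-a,\alpha]\times K\times\mathbb{R}$ for all $\varepsilon\le\varepsilon_0$. It has property (E+) if for every compact $K\subseteq\mathbb{R}^n$ there exist $\alpha\in(0,b)$, $\varepsilon_0\in(0,1]$, $C>0$, $N\in\mathbb{N}$ such that for all $\varepsilon\le\varepsilon_0$,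 $u_\varepsilon$ is injective on $(-a,\alpha]\times K\times\mathbb{R}$ and $|\det Du_\varepsilon(U,X,V)|\ge C\varepsilon^N$ for all $(U,X,V)\in(-a,\alpha]\times K\times\mathbb{R}$. *)

(* Defs.v *)
From Stdlib Require Import Reals Lra List.
From Stdlib Require Fin.
Open Scope R_scope.

Definition pt (m : nat) := Fin.t m -> R.

(* k-th coordinate (0-based), default 0 when k >= m *)
Definition fcoord {m : nat} (x : pt m) (k : nat) : R :=
  match Fin.of_nat k m with inleft i => x i | inright _ => 0 end.

Definition mkpt (m : nat) (f : nat -> R) : pt m :=
  fun i => f (proj1_sig (Fin.to_nat i)).

Definition upd {m : nat} (x : pt m) (i : Fin.t m) (t : R) : pt m :=
  fun j => if Fin.eq_dec j i then t else x j.

Definition peq {m : nat} (x y : pt m) : Prop := forall i, x i = y i.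

Definition subset {m : nat} (A B : pt m -> Prop) : Prop := forall x, A x -> B x.
Definition fullset {m : nat} : pt m -> Prop := fun _ => True.
Definition dist_lt {m : nat} (x y : pt m) (d : R) : Prop :=
  forall i, Rabs (x i - y i) < d.
Definition is_open {m : nat} (A : pt m -> Prop) : Prop :=
  forall x, A x -> exists d, 0 < d /\ forall y, dist_lt y x d -> A y.
Definition is_bounded {m : nat} (A : pt m -> Prop) : Prop :=
  exists M, forall x, A x -> forall i, Rabs (x i) <= M.
Definition is_compact {m : nat} (K : pt m -> Prop) : Prop :=
  forall (I : Type) (O : I -> pt m -> Prop),
    (forall i, is_open (O i)) -> (forall x, K x -> exists i, O i x) ->
    exists l : list I, forall x, K x -> exists i, In i l /\ O i x.
Definition inj_on {m k : nat} (S : pt m -> Prop) (f : pt m -> pt k) : Prop :=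
  forall P Q, S P -> S Q -> peq (f P) (f Q) -> peq P Q.

Definition cont_on {m : nat} (U : pt m -> Prop) (f : pt m -> R) : Prop :=
  forall x, U x -> forall e, 0 < e -> exists d, 0 < d /\
    forall y, U y -> dist_lt y x d -> Rabs (f y - f x) < e.

Definition partial_at {m : nat} (f : pt m -> R) (i : Fin.t m) (x : pt m) (l : R) : Prop :=
  derivable_pt_lim (fun t => f (upd x i t)) (x i) l.

(* D al = iterated partial derivative along the multi-index (list) al;
   D (i :: al) = d_i (D al); all of them continuous on U *)
Definition deriv_family {m : nat} (U : pt m -> Prop) (f : pt m -> R)
  (D : list (Fin.t m) -> pt m -> R) : Prop :=
  (forall x, U x -> D nil x = f x) /\
  (forall al, cont_on U (D al)) /\
  (forall al i x, U x -> partial_at (D al) i x (D (i :: al) x)).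

Definition smooth_fun {m : nat} (U : pt m -> Prop) (f : pt m -> R) : Prop :=
  exists D, deriv_family U f D.
Definition smooth_map {m k : nat} (U : pt m -> Prop) (f : pt m -> pt k) : Prop :=
  forall j, smooth_fun U (fun x => f x j).

(** * Colombeau nets: eps in (0,1] *)
Definition net (m k : nat) := R -> pt m -> pt k.

Definition moderate {m k : nat} (U : pt m -> Prop) (u : net m k) : Prop :=
  exists D : R -> Fin.t k -> list (Fin.t m) -> pt m -> R,
    (forall e, 0 < e <= 1 -> forall j, deriv_family U (fun x => u e x j) (D e j)) /\
    (forall K, is_compact K -> subset K U -> forall j al,
       exists (N : nat) (C e0 : R), 0 < e0 /\
         forall e, 0 < e <= e0 -> e <= 1 -> forall x, K x ->
           Rabs (D e j al x) <= C * / e ^ N).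

Definition negligible {m k : nat} (U : pt m -> Prop) (w : net m k) : Prop :=
  exists (e1 : R) (D : R -> Fin.t k -> list (Fin.t m) -> pt m -> R),
    0 < e1 <= 1 /\
    (forall e, 0 < e <= e1 -> forall j, deriv_family U (fun x => w e x j) (D e j)) /\
    (forall K, is_compact K -> subset K U -> forall j al (q : nat),
       exists C e0 : R, 0 < e0 /\
         forall e, 0 < e <= e0 -> e <= e1 -> forall x, K x ->
           Rabs (D e j al x) <= C * e ^ q).

Definition netsub {m k : nat} (u v : net m k) : net m k :=
  fun e x j => u e x j - v e x j.

Definition cbounded_net {m k : nat} (U : pt m -> Prop) (V : pt k -> Prop) (u : net m k) : Prop :=
  moderate U u /\
  (exists e1, 0 < e1 <= 1 /\ forall e, 0 < e <= e1 -> forall x, U x -> V (u e x)) /\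
  (forall K, is_compact K -> subset K U ->
     exists L, is_compact L /\ subset L V /\ exists e0, 0 < e0 /\
       forall e, 0 < e <= e0 -> e <= 1 -> forall x, K x -> L (u e x)).

Definition cbounded_class {m k : nat} (U : pt m -> Prop) (V : pt k -> Prop) (u : net m k) : Prop :=
  exists u', negligible U (netsub u' u) /\ cbounded_net U V u'.

(** * Invertibility; u in G(U)^m, v in G(V)^m given by representatives *)
Definition left_invertible {m : nat} (U G V : pt m -> Prop) (v : net m m)
  (H : pt m -> Prop) (u : net m m) : Prop :=
  is_open U /\ is_open G /\ subset G U /\ is_open V /\ is_open H /\ subset H V /\
  moderate U u /\ moderate V v /\
  exists u', negligible G (netsub u' u) /\ cbounded_net G H u' /\
    negligible G (fun e x j => v e (u' e x) j - x j).

Definition right_invertible {m : nat} (U G V : pt m -> Prop) (v : net m m)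
  (H : pt m -> Prop) (u : net m m) : Prop :=
  is_open U /\ is_open G /\ subset G U /\ is_open V /\ is_open H /\ subset H V /\
  moderate U u /\ moderate V v /\
  exists v', negligible H (netsub v' v) /\ cbounded_net H G v' /\
    negligible H (fun e y j => u e (v' e y) j - y j).

Definition invertible_on {m : nat} (U G V : pt m -> Prop) (v : net m m)
  (Hl Hr : pt m -> Prop) (u : net m m) : Prop :=
  left_invertible U G V v Hl u /\ right_invertible U G V v Hr u.

Fixpoint sumR (n : nat) (f : nat -> R) : R :=
  match n with O => 0 | S n' => sumR n' f + f n' end.
Definition minor (M : nat -> nat -> R) (j : nat) : nat -> nat -> R :=
  fun r c => M (S r) (if Nat.ltb c j then c else S c).
Fixpoint detn (m : nat) (M : nat -> nat -> R) : R :=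
  match m with
  | O => 1
  | S m' => sumR m (fun j => (-1) ^ j * M O j * detn m' (minor M j))
  end.
Definition detF {m : nat} (J : Fin.t m -> Fin.t m -> R) : R :=
  detn m (fun r c => match Fin.of_nat r m, Fin.of_nat c m with
                     | inleft i, inleft k => J i k | _, _ => 0 end).

Definition jacdet_ge {m : nat} (f : pt m -> pt m) (P : pt m) (c : R) : Prop :=
  exists J : Fin.t m -> Fin.t m -> R,
    (forall r k, partial_at (fun Q => f Q r) k P (J r k)) /\ c <= Rabs (detF J).

(** * The setting Lambda = (-a,b) x R^n x R, a b in R+ u {oo} (None = oo) *)
Definition pos_ext (a : option R) : Prop :=
  match a with Some r => 0 < r | None => True end.
Definition gt_low (a : option R) (u : R) : Prop :=
  match a with Some r => - r < u | None => True end.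
Definition lt_up (b : option R) (u : R) : Prop :=
  match b with Some r => u < r | None => True end.

(* coordinates of P = (U, X, V) in R^(n+2): index 0 = U, 1..n = X, n+1 = V *)
Definition ucoord {n : nat} (P : pt (S (S n))) : R := fcoord P 0.
Definition xpart {n : nat} (P : pt (S (S n))) : pt n := mkpt n (fun k => fcoord P (S k)).
Definition vcoord {n : nat} (P : pt (S (S n))) : R := fcoord P (S n).
Definition uxpart {n : nat} (P : pt (S (S n))) : pt (S n) := mkpt (S n) (fcoord P).
Definition trip {n : nat} (u : R) (X : pt n) (v : R) : pt (S (S n)) :=
  mkpt (S (S n)) (fun k => match k with
                           | O => u
                           | S k' => if Nat.ltb k' n then fcoord X k' else v end).
Definition pair_ux {n : nat} (u : R) (X : pt n) : pt (S n) :=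
  mkpt (S n) (fun k => match k with O => u | S k' => fcoord X k' end).

Definition Lam (a b : option R) {n : nat} (P : pt (S (S n))) : Prop :=
  gt_low a (ucoord P) /\ lt_up b (ucoord P).
Definition Omega (a b : option R) {n : nat} (Y : pt (S n)) : Prop :=
  gt_low a (fcoord Y 0) /\ lt_up b (fcoord Y 0).

Definition strip (a : option R) (al : R) {n : nat} (K : pt n -> Prop) (P : pt (S (S n))) : Prop :=
  gt_low a (ucoord P) /\ ucoord P <= al /\ K (xpart P).

Definition propE (a b : option R) {n : nat} (u : net (S (S n)) (S (S n))) : Prop :=
  forall K : pt n -> Prop, is_compact K ->
    exists al e0, 0 < al /\ lt_up b al /\ 0 < e0 <= 1 /\
      forall e, 0 < e <= e0 -> inj_on (strip a al K) (u e).

Definition propEplus (a b : option R) {n : nat} (u : net (S (S n)) (S (S n))) : Prop :=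
  forall K : pt n -> Prop, is_compact K ->
    exists al e0 C (N : nat), 0 < al /\ lt_up b al /\ 0 < e0 <= 1 /\ 0 < C /\
      forall e, 0 < e <= e0 ->
        inj_on (strip a al K) (u e) /\
        forall P, strip a al K P -> jacdet_ge (u e) P (C * e ^ N).

Definition unif_bdd_compact {m : nat} (U : pt m -> Prop) (h : R -> pt m -> R) : Prop :=
  forall K, is_compact K -> subset K U ->
    exists C, forall e, 0 < e <= 1 -> forall Y, K Y -> Rabs (h e Y) <= C.

Definition unif_conv_compact {m k : nat} (U : pt m -> Prop) (u : net m k) (u0 : pt m -> pt k) : Prop :=
  forall K, is_compact K -> subset K U -> forall r, 0 < r ->
    exists e0, 0 < e0 /\ forall e, 0 < e <= e0 -> e <= 1 ->
      forall P, K P -> forall i, Rabs (u e P i - u0 P i) < r.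

(* Main.v *)
(** On an ellipsoid [q < 3] around [p], property (E+) makes every [t_eps] an injective map with
    Jacobian determinant bounded below by a power of [eps].  Let [chi] be a
    smooth function of [q] equal to [1] for [q <= 1] and to [0] for [q >= 2].
    Then [v_eps = p + (chi (id - p)) o t_eps^-1], extended by [p] off the image
    of [t_eps], is smooth on the whole space and takes its values in
    [q <= 2].  Derivatives of such extensions by zero are again of this form,
    [d_j (F o t^-1) = (sum_i d_i F (Dt^-1)_ij) o t^-1], and Cramer's rule bounds
    the entries of [Dt^-1] moderately, so [v] is moderate; on [q <= 1] it
    inverts [t_eps].

    For the right inverse, fix [U] and [V] and minimise over the cube
    [|X - X_p| <= 1] the distance from [x_eps(U, X)] to a point [Y] close to
    [x(p)].  As [x_eps] converges uniformly to [x], which is injective at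
    [U = 0], the minimum is attained in the interior, and there the invertible
    Jacobian forces [x_eps(U, X) = Y].  The [V]-coordinate is then adjusted by
    a bounded amount, so that taking the ellipsoid long in the [V]-direction
    keeps the solution inside it.  Hence [t_eps] takes [q <= 1/2] onto a fixed
    neighbourhood [Q] of [s(p)]. *)

From mathcomp Require all_boot all_algebra Rstruct.
From Stdlib Require Import Reals Lra Lia List ClassicalEpsilon FunctionalExtensionality.
From Stdlib Require Fin.
From Coquelicot Require Import Coquelicot.
Require Import Defs.
Import ListNotations.
Open Scope R_scope.

(** * Finite sums and coordinates *)

(** The Jacobian of [t_eps] is bounded below only by a power of [eps], so the neighbourhoods on
    which an inverse function theorem would invert [t_eps] may shrink with [eps]. Injectivity on a
    fixed ellipsoid and surjectivity by minimisation avoid this loss.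

    The summand [h_eps] is bounded but need not converge. Hence only the [X]-component, which
    [t_eps] shares with [s_eps], is compared with a limit; [V] enters by translation and is solved
    for exactly.

    The order in which the constants are fixed prevents a circle. A box around [p] and a bound for
    [t_eps] on it come first; they determine the weight of the [X]- and [V]-directions, which
    determines the [X]-cube given to (E+). Only then does (E+) return its range of [U], to which the
    [U]-weight is adapted. A long ellipsoid in the [V]-direction is harmless because (E+) holds for
    all [V] at once.

    The identities between representatives hold exactly for small [eps], so no negligible remainder
    has to be estimated. *)

Lemma fun_choice {A B : Type} (P : A -> B -> Prop) :
  (forall a, exists b, P a b) -> exists f, forall a, P a (f a).
Proof.
  intros H.
  exists (fun a => proj1_sig (constructive_indefinite_description _ (H a))).
  intros a. exact (proj2_sig (constructive_indefinite_description _ (H a))).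
Qed.

Fixpoint fins (m : nat) : list (Fin.t m) :=
  match m with O => [] | S k => Fin.F1 :: map Fin.FS (fins k) end.

Lemma in_fins {m : nat} (i : Fin.t m) : In i (fins m).
Proof.
  induction i as [m|m i IH]; simpl; [now left|right; now apply in_map].
Qed.

Lemma nodup_fins (m : nat) : NoDup (fins m).
Proof.
  induction m as [|m IH]; simpl; constructor.
  - rewrite in_map_iff. intros [j [Hj _]]. discriminate.
  - apply NoDup_map_NoDup_ForallPairs; auto.
    intros i j _ _ H. now apply Fin.FS_inj.
Qed.

Fixpoint sumL {A : Type} (l : list A) (F : A -> R) : R :=
  match l with [] => 0 | a :: l' => F a + sumL l' F end.

Definition sumF {m : nat} (F : Fin.t m -> R) : R := sumL (fins m) F.

Lemma sumL_ext {A : Type} (l : list A) F G :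
  (forall a, In a l -> F a = G a) -> sumL l F = sumL l G.
Proof.
  induction l as [|a l IH]; simpl; intros H; auto.
  rewrite IH by auto. rewrite H by auto. reflexivity.
Qed.

Lemma sumL_plus {A : Type} (l : list A) F G :
  sumL l (fun a => F a + G a) = sumL l F + sumL l G.
Proof. induction l; simpl; lra. Qed.

Lemma sumL_scal {A : Type} (l : list A) c F :
  sumL l (fun a => c * F a) = c * sumL l F.
Proof. induction l as [|a l IH]; simpl; [ring|]. rewrite IH. ring. Qed.

Lemma sumL_zero {A : Type} (l : list A) F :
  (forall a, In a l -> F a = 0) -> sumL l F = 0.
Proof.
  induction l as [|a l IH]; simpl; intros H; auto.
  rewrite H, IH by auto. ring.
Qed.

Lemma sumL_exchange {A B : Type} (l : list A) (l' : list B) F :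
  sumL l (fun a => sumL l' (fun b => F a b)) =
  sumL l' (fun b => sumL l (fun a => F a b)).
Proof.
  induction l as [|a l IH]; simpl.
  - symmetry. apply sumL_zero. auto.
  - rewrite IH, sumL_plus. reflexivity.
Qed.

Lemma sumL_le {A : Type} (l : list A) F G :
  (forall a, In a l -> F a <= G a) -> sumL l F <= sumL l G.
Proof.
  induction l as [|a l IH]; simpl; intros H; [lra|].
  specialize (IH (fun b Hb => H b (or_intror Hb))).
  specialize (H a (or_introl eq_refl)). lra.
Qed.

Lemma sumL_nonneg {A : Type} (l : list A) F :
  (forall a, In a l -> 0 <= F a) -> 0 <= sumL l F.
Proof.
  intros H. rewrite <- (sumL_zero l (fun _ => 0)) by auto. now apply sumL_le.
Qed.

Lemma sumL_term_le {A : Type} (l : list A) F a :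
  (forall b, In b l -> 0 <= F b) -> In a l -> F a <= sumL l F.
Proof.
  induction l as [|b l IH]; simpl; intros H Ha; [easy|].
  assert (0 <= sumL l F) by (apply sumL_nonneg; auto).
  assert (0 <= F b) by auto.
  destruct Ha as [->|Ha]; [lra|]. specialize (IH ltac:(auto) Ha). lra.
Qed.

Lemma sumL_const {A : Type} (l : list A) c :
  sumL l (fun _ => c) = INR (length l) * c.
Proof.
  induction l as [|a l IH]; [simpl; ring|].
  cbn [sumL length]. rewrite IH, S_INR. ring.
Qed.

Lemma Rabs_sumL {A : Type} (l : list A) F :
  Rabs (sumL l F) <= sumL l (fun a => Rabs (F a)).
Proof.
  induction l as [|a l IH]; simpl; [rewrite Rabs_R0; lra|].
  pose proof (Rabs_triang (F a) (sumL l F)). lra.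
Qed.

Lemma sumL_single {A : Type} (l : list A) F a :
  NoDup l -> In a l -> (forall b, b <> a -> F b = 0) -> sumL l F = F a.
Proof.
  intros Hl. induction Hl as [|b l Hb Hl IH]; simpl; intros Ha H; [easy|].
  destruct Ha as [->|Ha].
  - rewrite sumL_zero; [ring|]. intros c Hc. apply H. intros ->. contradiction.
  - rewrite IH, H by (auto; intros ->; contradiction). ring.
Qed.

Lemma sumF_single {m : nat} (F : Fin.t m -> R) i :
  (forall j, j <> i -> F j = 0) -> sumF F = F i.
Proof. apply sumL_single; [apply nodup_fins|apply in_fins]. Qed.

Lemma sumF_sqr_eq0 {m : nat} (F : Fin.t m -> R) :
  sumF (fun j => F j * F j) = 0 -> forall j, F j = 0.
Proof.
  intros H j.
  pose proof (sumL_term_le (fins m) (fun j => F j * F j) j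
    (fun b _ => Rle_0_sqr (F b)) (in_fins j)) as Hj.
  fold (sumF (fun j => F j * F j)) in Hj. rewrite H in Hj. simpl in Hj.
  nra.
Qed.

Lemma peq_eq {m : nat} (x y : pt m) : peq x y -> x = y.
Proof. intros H. now apply functional_extensionality. Qed.

Lemma dist_lt_refl {m : nat} (x : pt m) d : 0 < d -> dist_lt x x d.
Proof. intros Hd i. rewrite Rminus_diag. now rewrite Rabs_R0. Qed.

Lemma dist_lt_sym {m : nat} (x y : pt m) d : dist_lt x y d -> dist_lt y x d.
Proof. intros H i. rewrite Rabs_minus_sym. apply H. Qed.

Lemma dist_lt_trans {m : nat} (x y z : pt m) d d' :
  dist_lt x y d -> dist_lt y z d' -> dist_lt x z (d + d').
Proof.
  intros H H' i. specialize (H i). specialize (H' i).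
  pose proof (Rabs_triang (x i - y i) (y i - z i)).
  replace (x i - z i) with (x i - y i + (y i - z i)) by ring. lra.
Qed.

Lemma dist_lt_le {m : nat} (x y : pt m) d d' :
  dist_lt x y d -> d <= d' -> dist_lt x y d'.
Proof. intros H Hd i. specialize (H i). lra. Qed.

Lemma upd_same {m : nat} (x : pt m) i t : upd x i t i = t.
Proof. unfold upd. now destruct (Fin.eq_dec i i). Qed.

Lemma upd_other {m : nat} (x : pt m) i j t : j <> i -> upd x i t j = x j.
Proof. unfold upd. now destruct (Fin.eq_dec j i). Qed.

Lemma upd_id {m : nat} (x : pt m) i : upd x i (x i) = x.
Proof.
  apply peq_eq. intros j. unfold upd. destruct (Fin.eq_dec j i); congruence.
Qed.

Lemma dist_lt_upd {m : nat} (x : pt m) i t d :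
  Rabs (t - x i) < d -> dist_lt (upd x i t) x d.
Proof.
  intros H j. unfold upd. destruct (Fin.eq_dec j i) as [->|]; auto.
  rewrite Rminus_diag, Rabs_R0. pose proof (Rabs_pos (t - x i)). lra.
Qed.

Lemma common_radius {A : Type} (l : list A) (P : A -> R -> Prop) :
  (forall a d d', P a d -> 0 < d' <= d -> P a d') ->
  (forall a, In a l -> exists d, 0 < d /\ P a d) ->
  exists d, 0 < d /\ forall a, In a l -> P a d.
Proof.
  intros Hm. induction l as [|a l IH]; intros H.
  - exists 1. split; [lra|easy].
  - destruct IH as [d [Hd Hl]]; [intros b Hb; apply H; now right|].
    destruct (H a (or_introl eq_refl)) as [d' [Hd' Ha]].
    assert (0 < Rmin d d') by now apply Rmin_pos.
    exists (Rmin d d'). split; auto. intros b [->|Hb].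
    + apply Hm with d'; auto. split; auto. apply Rmin_r.
    + apply Hm with d; auto. split; auto. apply Rmin_l.
Qed.

Lemma common_radius_fin {m : nat} (P : Fin.t m -> R -> Prop) :
  (forall a d d', P a d -> 0 < d' <= d -> P a d') ->
  (forall a, exists d, 0 < d /\ P a d) ->
  exists d, 0 < d /\ forall a, P a d.
Proof.
  intros Hm H. destruct (common_radius (fins m) P Hm) as [d [Hd Hl]]; auto.
  exists d. split; auto. intros a. apply Hl, in_fins.
Qed.

(** * Compactness in R^m *)

Fixpoint to_Tn (m : nat) : pt m -> Compactness.Tn m R :=
  match m with
  | O => fun _ => tt
  | S k => fun x => (x Fin.F1, to_Tn k (fun i => x (Fin.FS i)))
  end.

Fixpoint of_Tn (m : nat) : Compactness.Tn m R -> pt m :=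
  match m with
  | O => fun _ _ => 0
  | S k => fun p i => Fin.caseS' i (fun _ => R) (fst p) (of_Tn k (snd p))
  end.

Lemma close_to_Tn (m : nat) d (x : pt m) t :
  Compactness.close_n m d (to_Tn m x) t -> dist_lt x (of_Tn m t) d.
Proof.
  induction m as [|m IH]; intros H i; [inversion i|].
  destruct t as [t1 t2], H as [H1 H2].
  apply (Fin.caseS' i); simpl; auto.
  intros j. apply (IH _ _ H2 j).
Qed.

Lemma bounded_to_Tn (m : nat) (a b x : pt m) :
  (forall i, a i <= x i <= b i) ->
  Compactness.bounded_n m (to_Tn m a) (to_Tn m b) (to_Tn m x).
Proof.
  induction m as [|m IH]; intros H; simpl; auto.
Qed.

Definition is_closed {m : nat} (K : pt m -> Prop) : Prop := is_open (fun x => ~ K x).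

Lemma closed_bounded_compact {m : nat} (K : pt m -> Prop) :
  is_closed K -> is_bounded K -> is_compact K.
Proof.
  intros Hc [M HM] I O HO Hcov.
  destruct (fun_choice (fun (t : Compactness.Tn m R) (w : posreal * option I) =>
    forall z, dist_lt z (of_Tn m t) (fst w) ->
      match snd w with Some i => O i z | None => ~ K z end)) as [f Hf].
  { intros t. destruct (classic (K (of_Tn m t))) as [Hk|Hk].
    - destruct (Hcov _ Hk) as [i Hi]. destruct (HO i _ Hi) as [d [Hd H]].
      now exists (mkposreal d Hd, Some i).
    - destruct (Hc _ Hk) as [d [Hd H]]. now exists (mkposreal d Hd, None). }
  (* This compactness statement carries a double negation, which [NNPP] removes. *)
  pose proof (Compactness.compactness_list m (to_Tn m (fun _ => - M))
    (to_Tn m (fun _ => M)) (fun t => fst (f t))) as H.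
  apply NNPP in H. destruct H as [l Hl].
  exists (flat_map (fun t => match snd (f t) with Some i => [i] | None => [] end) l).
  intros x Hx. destruct (Hl (to_Tn m x)) as [t [Ht [_ Hxt]]].
  { apply bounded_to_Tn. intros i. specialize (HM x Hx i).
    pose proof (Rle_abs (x i)). pose proof (Rle_abs (- x i)) as H0.
    rewrite Rabs_Ropp in H0. lra. }
  apply close_to_Tn in Hxt. specialize (Hf t x Hxt).
  destruct (snd (f t)) as [i|] eqn:E; [|contradiction].
  exists i. split; auto. apply in_flat_map. exists t. rewrite E. simpl; auto.
Qed.

(** Without a minimum, the sets on which [f] exceeds [f y] locally, indexed by [y] in [K], cover
    [K]. In a finite subcover the index with the least value lies in no member. The members ask for
    a whole ball because [is_compact] needs sets open in the ambient space, while [f] is continuous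
    only on [K]. *)
Lemma compact_min {m : nat} (K : pt m -> Prop) (f : pt m -> R) z :
  is_compact K -> K z -> cont_on K f ->
  exists x, K x /\ forall y, K y -> f x <= f y.
Proof.
  intros HK Hz Hf. apply NNPP. intros Hn.
  assert (Hlt : forall x, K x -> exists y, K y /\ f y < f x).
  { intros x Hx. apply NNPP. intros H. apply Hn. exists x. split; auto.
    intros y Hy. apply Rnot_lt_le. intros H'. apply H. now exists y. }
  destruct (HK {y | K y} (fun y x => exists d, 0 < d /\
    forall w, dist_lt w x d -> K w -> f (proj1_sig y) < f w)) as [l Hl].
  - intros y x [d [Hd H]]. exists (d / 2). split; [lra|].
    intros x' Hx'. exists (d / 2). split; [lra|]. intros w Hw Hk. apply H; auto.
    apply dist_lt_le with (d / 2 + d / 2); [|lra].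
    now apply dist_lt_trans with x'.
  - intros x Hx. destruct (Hlt x Hx) as [y [Hy Hyx]].
    exists (exist _ y Hy). simpl.
    destruct (Hf x Hx (f x - f y)) as [d [Hd H]]; [lra|].
    exists d. split; auto. intros w Hw Hk. specialize (H w Hk Hw).
    apply Rabs_def2 in H. lra.
  - assert (Hmin : forall l : list {y | K y}, l <> [] ->
      exists y, In y l /\ forall y', In y' l -> f (proj1_sig y) <= f (proj1_sig y')).
    { clear. induction l as [|a l IH]; [easy|]. intros _.
      destruct l as [|b l]; [exists a; split; [now left|]; intros y' [->|[]]; lra|].
      destruct IH as [y [Hy H]]; [easy|].
      destruct (Rle_dec (f (proj1_sig a)) (f (proj1_sig y))) as [Hay|Hay].
      - exists a. split; [now left|]. intros y' [<-|Hy']; [lra|].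
        specialize (H _ Hy'). lra.
      - exists y. split; [now right|]. intros y' [<-|Hy']; [lra|auto]. }
    destruct (Hmin l) as [y [Hy Hym]].
    { intros ->. destruct (Hl z Hz) as [i [[] _]]. }
    destruct (Hl (proj1_sig y) (proj2_sig y)) as [y' [Hy' [d [Hd H]]]].
    specialize (H _ (dist_lt_refl _ _ Hd) (proj2_sig y)).
    specialize (Hym y' Hy'). lra.
Qed.

(** * Continuous functions on a set *)

Lemma cont_on_sub {m : nat} (U V : pt m -> Prop) f :
  subset V U -> cont_on U f -> cont_on V f.
Proof.
  intros H Hf x Hx e He. destruct (Hf x (H _ Hx) e He) as [d [Hd Hd']].
  exists d. split; auto.
Qed.

Lemma cont_on_ext {m : nat} (U : pt m -> Prop) f g :
  (forall x, U x -> f x = g x) -> cont_on U f -> cont_on U g.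
Proof.
  intros H Hf x Hx e He. destruct (Hf x Hx e He) as [d [Hd Hd']].
  exists d. split; auto. intros y Hy Hyx. rewrite <- !H by auto. auto.
Qed.

Lemma cont_on_const {m : nat} (U : pt m -> Prop) c : cont_on U (fun _ => c).
Proof.
  intros x _ e He. exists 1. split; [lra|]. intros. now rewrite Rminus_diag, Rabs_R0.
Qed.

Lemma cont_on_coord {m : nat} (U : pt m -> Prop) i : cont_on U (fun x => x i).
Proof. intros x _ e He. exists e. split; auto. Qed.

Lemma cont_on_plus {m : nat} (U : pt m -> Prop) f g :
  cont_on U f -> cont_on U g -> cont_on U (fun x => f x + g x).
Proof.
  intros Hf Hg x Hx e He.
  destruct (Hf x Hx (e / 2)) as [d [Hd H]]; [lra|].
  destruct (Hg x Hx (e / 2)) as [d' [Hd' H']]; [lra|].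
  exists (Rmin d d'). split; [now apply Rmin_pos|]. intros y Hy Hyx.
  specialize (H y Hy (dist_lt_le _ _ _ _ Hyx (Rmin_l _ _))).
  specialize (H' y Hy (dist_lt_le _ _ _ _ Hyx (Rmin_r _ _))).
  replace (f y + g y - (f x + g x)) with (f y - f x + (g y - g x)) by ring.
  pose proof (Rabs_triang (f y - f x) (g y - g x)). lra.
Qed.

Lemma cont_on_comp {m : nat} (U : pt m -> Prop) f phi :
  cont_on U f -> (forall x, U x -> continuity_pt phi (f x)) ->
  cont_on U (fun x => phi (f x)).
Proof.
  intros Hf Hphi x Hx e He. destruct (Hphi x Hx e He) as [a [Ha H]].
  destruct (Hf x Hx a Ha) as [d [Hd H']]. exists d. split; auto.
  intros y Hy Hyx. destruct (Req_dec (f y) (f x)) as [->|Hne].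
  - now rewrite Rminus_diag, Rabs_R0.
  - apply (H (f y)). split; [split; [exact I|congruence]|]. apply H'; auto.
Qed.

Lemma cont_on_scal {m : nat} (U : pt m -> Prop) c f :
  cont_on U f -> cont_on U (fun x => c * f x).
Proof.
  intros Hf. apply (cont_on_comp U f (fun t => c * t)); auto.
  intros. reg.
Qed.

Lemma cont_on_mult {m : nat} (U : pt m -> Prop) f g :
  cont_on U f -> cont_on U g -> cont_on U (fun x => f x * g x).
Proof.
  intros Hf Hg.
  (* Polarisation reduces products to squares, which are compositions with a function of one
     variable. *)
  apply cont_on_ext with (fun x => /4 * ((f x + g x) * (f x + g x))
    + - /4 * ((f x + -1 * g x) * (f x + -1 * g x))); [intros; field|].
  apply cont_on_plus; apply cont_on_scal.
  - apply (cont_on_comp U (fun x => f x + g x) (fun t => t * t)).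
    + now apply cont_on_plus.
    + intros. reg.
  - apply (cont_on_comp U (fun x => f x + -1 * g x) (fun t => t * t)).
    + apply cont_on_plus; auto. now apply cont_on_scal.
    + intros. reg.
Qed.

Lemma cont_on_sumL {m : nat} {A : Type} (U : pt m -> Prop) (l : list A) f :
  (forall a, cont_on U (f a)) -> cont_on U (fun x => sumL l (fun a => f a x)).
Proof.
  intros H. induction l as [|a l IH]; simpl.
  - apply cont_on_const.
  - now apply cont_on_plus.
Qed.

Lemma compact_bounded_fun {m : nat} (K : pt m -> Prop) (f : pt m -> R) :
  is_compact K -> cont_on K f -> exists C, 0 <= C /\ forall x, K x -> Rabs (f x) <= C.
Proof.
  intros HK Hf. destruct (classic (exists z, K z)) as [[z Hz]|Hn].
  - destruct (compact_min K (fun x => -1 * Rabs (f x)) z HK Hz) as [x [Hx H]].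
    + apply cont_on_scal. apply (cont_on_comp K f Rabs); auto.
      intros. apply Rcontinuity_abs.
    + exists (Rabs (f x)). split; [apply Rabs_pos|]. intros y Hy. specialize (H y Hy). lra.
  - exists 0. split; [lra|]. intros x Hx. exfalso. apply Hn. now exists x.
Qed.

(** The cover is indexed by radii: a point belongs to the member [d] if [P] holds on a ball of
    radius strictly larger than [d], and the strict inequality makes the member open. The least
    radius of a finite subcover works uniformly. *)
Lemma lebesgue_number {m : nat} (K : pt m -> Prop) (P : pt m -> Prop) :
  is_compact K ->
  (forall x, K x -> exists d, 0 < d /\ forall y, dist_lt y x d -> P y) ->
  exists d, 0 < d /\ forall x y, K x -> dist_lt y x d -> P y.
Proof.
  intros HK H.
  destruct (HK {d | 0 < d} (fun d x => exists d', proj1_sig d < d' /\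
    forall y, dist_lt y x d' -> P y)) as [l Hl].
  - intros [d Hd] x [d' [Hdd' Hx]]. simpl in *. exists ((d' - d) / 2).
    split; [lra|]. intros y Hy. exists (d + (d' - d) / 2). split; [lra|].
    intros z Hz. apply Hx. apply dist_lt_le with (d + (d' - d) / 2 + (d' - d) / 2); [|lra].
    now apply dist_lt_trans with y.
  - intros x Hx. destruct (H x Hx) as [d [Hd Hd']].
    assert (Hd2 : 0 < d / 2) by lra.
    exists (exist _ (d / 2) Hd2), d. simpl. split; [lra|auto].
  - destruct (common_radius l (fun d r => r <= proj1_sig d)) as [d [Hd Hdl]].
    + intros. lra.
    + intros [d Hd] _. exists d. simpl. split; [auto|lra].
    + exists d. split; auto. intros x y Hx Hy.
      destruct (Hl x Hx) as [r [Hr [d' [Hrd H']]]]. apply H'.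
      specialize (Hdl r Hr). apply dist_lt_le with d; auto. lra.
Qed.

Lemma of_nat_of_nat_lt {m k : nat} (H : (k < m)%nat) :
  Fin.of_nat k m = inleft (Fin.of_nat_lt H).
Proof.
  revert k H. induction m as [|m IH]; intros [|k] H; try lia; simpl; auto.
  now rewrite (IH k (proj2 (PeanoNat.Nat.succ_lt_mono _ _) H)).
Qed.

Lemma to_nat_FS {m : nat} (i : Fin.t m) :
  proj1_sig (Fin.to_nat (Fin.FS i)) = S (proj1_sig (Fin.to_nat i)).
Proof. simpl. now destruct (Fin.to_nat i). Qed.

Lemma sumF_S {m : nat} (F : Fin.t (S m) -> R) :
  sumF F = F Fin.F1 + sumF (fun i => F (Fin.FS i)).
Proof.
  unfold sumF. simpl. f_equal. induction (fins m) as [|i l IH]; simpl; congruence.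
Qed.

Lemma length_fins (m : nat) : length (fins m) = m.
Proof. induction m as [|m IH]; simpl; auto. now rewrite length_map, IH. Qed.

(** * Partial derivatives and local surjectivity *)

Lemma upd_upd {m : nat} (x : pt m) i s t : upd (upd x i s) i t = upd x i t.
Proof.
  apply peq_eq. intros j. unfold upd. now destruct (Fin.eq_dec j i).
Qed.

Lemma partial_at_upd {m : nat} (f : pt m -> R) i x s l :
  partial_at f i (upd x i s) l -> derivable_pt_lim (fun t => f (upd x i t)) s l.
Proof.
  unfold partial_at. rewrite upd_same.
  replace (fun t => f (upd (upd x i s) i t)) with (fun t => f (upd x i t)); auto.
  apply functional_extensionality. intros t. now rewrite upd_upd.
Qed.

Lemma partial_at_unique {m : nat} (f : pt m -> R) i x l l' :
  partial_at f i x l -> partial_at f i x l' -> l = l'.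
Proof. apply uniqueness_limite. Qed.

Lemma partial_at_local {m : nat} (f g : pt m -> R) i x l d :
  0 < d -> (forall y, dist_lt y x d -> f y = g y) ->
  partial_at f i x l -> partial_at g i x l.
Proof.
  intros Hd H Hf e He. destruct (Hf e He) as [r Hr].
  assert (Hm : 0 < Rmin d r) by (apply Rmin_pos; [auto|apply cond_pos]).
  exists (mkposreal _ Hm). simpl. intros h Hh Hhr.
  assert (Rabs h < d) by (eapply Rlt_le_trans; [exact Hhr|apply Rmin_l]).
  assert (Rabs h < r) by (eapply Rlt_le_trans; [exact Hhr|apply Rmin_r]).
  rewrite <- !H.
  - now apply Hr.
  - rewrite upd_id. now apply dist_lt_refl.
  - apply dist_lt_upd. now replace (x i + h - x i) with h by ring.
Qed.

Lemma partial_at_open {m : nat} (U : pt m -> Prop) (f g : pt m -> R) i x l :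
  is_open U -> U x -> (forall y, U y -> f y = g y) ->
  partial_at f i x l -> partial_at g i x l.
Proof.
  intros HU Hx H. destruct (HU x Hx) as [d [Hd Hd']].
  apply partial_at_local with d; auto.
Qed.

Lemma partial_at_const {m : nat} c i (x : pt m) : partial_at (fun _ => c) i x 0.
Proof. apply derivable_pt_lim_const. Qed.

Lemma partial_at_coord {m : nat} j i (x : pt m) :
  partial_at (fun y => y j) i x (if Fin.eq_dec j i then 1 else 0).
Proof.
  unfold partial_at, upd. destruct (Fin.eq_dec j i).
  - apply derivable_pt_lim_id.
  - apply derivable_pt_lim_const.
Qed.

Lemma partial_at_plus {m : nat} (f g : pt m -> R) i x l l' :
  partial_at f i x l -> partial_at g i x l' -> partial_at (fun y => f y + g y) i x (l + l').
Proof.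
  intros. apply (derivable_pt_lim_plus (fun t => f (upd x i t)) (fun t => g (upd x i t))); auto.
Qed.

Lemma partial_at_mult {m : nat} (f g : pt m -> R) i x l l' :
  partial_at f i x l -> partial_at g i x l' ->
  partial_at (fun y => f y * g y) i x (l * g x + f x * l').
Proof.
  intros Hf Hg.
  pose proof (derivable_pt_lim_mult (fun t => f (upd x i t)) (fun t => g (upd x i t))
    (x i) l l' Hf Hg) as H.
  cbv beta in H. rewrite upd_id in H. exact H.
Qed.

Lemma partial_at_comp {m : nat} (f : pt m -> R) phi i x l l' :
  partial_at f i x l -> derivable_pt_lim phi (f x) l' ->
  partial_at (fun y => phi (f y)) i x (l' * l).
Proof.
  intros Hf Hg. apply (derivable_pt_lim_comp (fun t => f (upd x i t)) phi); auto.
  now rewrite upd_id.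
Qed.

Lemma partial_at_sumL {m : nat} {A : Type} (l : list A) (f : A -> pt m -> R) i x d :
  (forall a, In a l -> partial_at (f a) i x (d a)) ->
  partial_at (fun y => sumL l (fun a => f a y)) i x (sumL l d).
Proof.
  induction l as [|a l IH]; simpl; intros H.
  - apply partial_at_const.
  - apply partial_at_plus; auto.
Qed.

Lemma partial_at_min_zero {m : nat} (f : pt m -> R) i x l d :
  0 < d -> (forall t, Rabs (t - x i) < d -> f x <= f (upd x i t)) ->
  partial_at f i x l -> l = 0.
Proof.
  intros Hd H Hl.
  pose (pr := exist (fun l => derivable_pt_abs (fun t => f (upd x i t)) (x i) l) l Hl
        : derivable_pt (fun t => f (upd x i t)) (x i)).
  apply (deriv_minimum (fun t => f (upd x i t)) (x i - d) (x i + d) (x i) pr); try lra.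
  intros t H1 H2. rewrite upd_id. apply H. apply Rabs_def1; lra.
Qed.

Lemma partial_increment {m : nat} (f df : pt m -> R) i z t e :
  (forall s, Rmin t (z i) <= s <= Rmax t (z i) ->
     partial_at f i (upd z i s) (df (upd z i s)) /\ Rabs (df (upd z i s)) <= e) ->
  Rabs (f (upd z i t) - f z) <= e * Rabs (t - z i).
Proof.
  intros H.
  assert (Hmvt : forall a b, a < b -> (forall s, a <= s <= b ->
    partial_at f i (upd z i s) (df (upd z i s)) /\ Rabs (df (upd z i s)) <= e) ->
    Rabs (f (upd z i b) - f (upd z i a)) <= e * Rabs (b - a)).
  { intros a b Hab Hs.
    destruct (MVT_cor2 (fun t => f (upd z i t)) (fun t => df (upd z i t)) a b Hab)
      as [c [Hc Hc']].
    - intros c Hc. apply partial_at_upd. now apply Hs.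
    - rewrite Hc, Rabs_mult. apply Rmult_le_compat_r; [apply Rabs_pos|]. apply Hs. lra. }
  rewrite <- (upd_id z i) at 2.
  destruct (Rtotal_order t (z i)) as [Ht|[->|Ht]].
  - rewrite Rabs_minus_sym, (Rabs_minus_sym t). apply Hmvt; auto.
    intros s Hs. apply H. rewrite Rmin_left, Rmax_right; lra.
  - rewrite !Rminus_diag, Rabs_R0. lra.
  - apply Hmvt; auto. intros s Hs. apply H. rewrite Rmin_right, Rmax_left; lra.
Qed.

Definition upds {m : nat} (x y : pt m) (l : list (Fin.t m)) : pt m :=
  fold_right (fun i z => upd z i (y i)) x l.

Lemma upds_in {m : nat} (x y : pt m) l i : In i l -> upds x y l i = y i.
Proof.
  induction l as [|j l IH]; simpl; intros H; [easy|].
  unfold upd. destruct (Fin.eq_dec i j) as [->|Hij]; auto.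
  destruct H; [congruence|auto].
Qed.

Lemma upds_notin {m : nat} (x y : pt m) l i : ~ In i l -> upds x y l i = x i.
Proof.
  induction l as [|j l IH]; simpl; intros H; auto.
  rewrite upd_other by (intros ->; tauto). tauto.
Qed.

(** Only partial derivatives are given, so the path from [x] to [y] changes one coordinate at a
    time. By [NoDup] the coordinate being changed still has its value from [x], which keeps the
    whole path in the cube of radius [r]. *)
Lemma mean_value_list {m : nat} (f : pt m -> R) (Df : Fin.t m -> pt m -> R) x y r e l :
  (forall z i, dist_lt z x r -> partial_at f i z (Df i z)) ->
  (forall z i, dist_lt z x r -> Rabs (Df i z) <= e) ->
  dist_lt y x r -> NoDup l ->
  Rabs (f (upds x y l) - f x) <= e * sumL l (fun i => Rabs (y i - x i)).
Proof.
  intros Hp He Hy Hl. induction Hl as [|i l Hi Hl IH].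
  - simpl. rewrite Rminus_diag, Rabs_R0. lra.
  - assert (Hstep : Rabs (f (upds x y (i :: l)) - f (upds x y l))
                    <= e * Rabs (y i - x i)).
    { simpl. rewrite <- (upds_notin x y l i Hi).
      apply partial_increment with (Df i). intros s Hs.
      assert (dist_lt (upd (upds x y l) i s) x r).
      { intros j. unfold upd. destruct (Fin.eq_dec j i) as [->|Hj].
        - rewrite upds_notin in Hs by auto. specialize (Hy i).
          apply Rabs_def2 in Hy. apply Rabs_def1.
          + assert (Rmax (y i) (x i) < x i + r) by (apply Rmax_lub_lt; lra). lra.
          + assert (x i - r < Rmin (y i) (x i)) by (apply Rmin_glb_lt; lra). lra.
        - destruct (in_dec Fin.eq_dec j l).
          + rewrite upds_in; auto.
          + rewrite upds_notin, Rminus_diag, Rabs_R0 by auto.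
            eapply Rle_lt_trans; [apply Rabs_pos|apply (Hy i)]. }
      auto. }
    simpl sumL.
    pose proof (Rabs_triang (f (upds x y (i :: l)) - f (upds x y l)) (f (upds x y l) - f x)).
    replace (f (upds x y (i :: l)) - f (upds x y l) + (f (upds x y l) - f x))
      with (f (upds x y (i :: l)) - f x) in H by ring.
    lra.
Qed.

Lemma mean_value {m : nat} (f : pt m -> R) (Df : Fin.t m -> pt m -> R) x y r e :
  (forall z i, dist_lt z x r -> partial_at f i z (Df i z)) ->
  (forall z i, dist_lt z x r -> Rabs (Df i z) <= e) ->
  dist_lt y x r ->
  Rabs (f y - f x) <= e * sumF (fun i => Rabs (y i - x i)).
Proof.
  intros Hp He Hy.
  rewrite <- (mean_value_list f Df x y r e (fins m)) by (auto; apply nodup_fins).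
  replace (upds x y (fins m)) with y; [lra|].
  apply peq_eq. intros i. now rewrite upds_in by apply in_fins.
Qed.

(** The mean value estimate is applied to [f + lin], where [lin] is minus the linearisation at [x]:
    its partial derivatives are [Df i z - Df i x], small near [x] by continuity. *)
Lemma differentiable {m : nat} (O : pt m -> Prop) (f : pt m -> R)
  (Df : Fin.t m -> pt m -> R) x e :
  is_open O -> O x -> (forall i, cont_on O (Df i)) ->
  (forall i z, O z -> partial_at f i z (Df i z)) -> 0 < e ->
  exists r, 0 < r /\ forall y, dist_lt y x r ->
    Rabs (f y - f x - sumF (fun i => Df i x * (y i - x i)))
    <= e * sumF (fun i => Rabs (y i - x i)).
Proof.
  intros HO Hx Hc Hp He.
  destruct (HO x Hx) as [r0 [Hr0 HO']].
  destruct (common_radius_fin (fun i d => forall z, O z -> dist_lt z x d ->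
    Rabs (Df i z - Df i x) <= e)) as [r1 [Hr1 H1]].
  { intros i d d' H Hd z Hz Hzx. apply H; auto. apply dist_lt_le with d'; auto. lra. }
  { intros i. destruct (Hc i x Hx e He) as [d [Hd H]]. exists d. split; auto.
    intros z Hz Hzx. left. auto. }
  exists (Rmin r0 r1). split; [now apply Rmin_pos|]. intros y Hy.
  assert (Hin : forall z, dist_lt z x (Rmin r0 r1) -> O z).
  { intros z Hz. apply HO'. apply dist_lt_le with (1 := Hz), Rmin_l. }
  pose (lin := fun z : pt m => sumF (fun i => - Df i x * z i)).
  assert (Hlin : forall z i, partial_at lin i z (- Df i x)).
  { intros z i.
    replace (- Df i x) with (sumF (fun j => 0 * z j + - Df j x * (if Fin.eq_dec j i then 1 else 0))).
    - apply (partial_at_sumL (fins m) (fun j z => - Df j x * z j)). intros j _.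
      apply (partial_at_mult (fun _ => - Df j x) (fun z => z j)).
      + apply partial_at_const.
      + apply partial_at_coord.
    - rewrite (sumF_single _ i).
      + destruct (Fin.eq_dec i i); [ring|congruence].
      + intros j Hj. destruct (Fin.eq_dec j i); [congruence|ring]. }
  replace (f y - f x - sumF (fun i => Df i x * (y i - x i)))
    with (f y + lin y - (f x + lin x)).
  - apply (mean_value (fun z => f z + lin z) (fun i z => Df i z + - Df i x) x y (Rmin r0 r1)); auto.
    + intros z i Hz. apply partial_at_plus; auto.
    + intros z i Hz. apply (H1 i z); auto. apply dist_lt_le with (1 := Hz), Rmin_r.
  - assert (sumF (fun i => Df i x * (y i - x i)) = - lin y + lin x); [|lra].
    unfold lin, sumF. rewrite <- (Rmult_1_l (- _)), Ropp_mult_distr_r_reverse, Ropp_mult_distr_l.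
    rewrite <- sumL_scal, <- sumL_plus. apply sumL_ext. intros. ring.
Qed.

(** The left kernel is the relevant one: the gradient of the squared distance from [f x] to [y] is
    the row vector [2 (f x - y) J]. *)
Definition nondegenerate {m : nat} (J : Fin.t m -> Fin.t m -> R) : Prop :=
  forall w : pt m, (forall i, sumF (fun j => w j * J j i) = 0) -> forall j, w j = 0.

(** The list allows a restriction to the [X]-coordinates. Squares keep the distance differentiable,
    at the price of a factor 2 in the triangle inequality. *)
Definition sqdist {m : nat} (l : list (Fin.t m)) (x y : pt m) : R :=
  sumL l (fun j => (x j - y j) * (x j - y j)).

Lemma sqdist_nonneg {m : nat} l (x y : pt m) : 0 <= sqdist l x y.
Proof. apply sumL_nonneg. intros. apply Rle_0_sqr. Qed.

Lemma sqdist_quasi_triangle {m : nat} l (x y z : pt m) :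
  sqdist l x z <= 2 * sqdist l x y + 2 * sqdist l y z.
Proof.
  unfold sqdist. rewrite <- !sumL_scal, <- sumL_plus. apply sumL_le. intros j _.
  pose proof (Rle_0_sqr ((x j - y j) - (y j - z j))) as H. unfold Rsqr in H. nra.
Qed.

Lemma sqdist_lt {m : nat} (l : list (Fin.t m)) c :
  0 < c -> exists d, 0 < d /\ forall x y : pt m,
    (forall j, In j l -> Rabs (x j - y j) < d) -> sqdist l x y < c.
Proof.
  intros Hc. pose proof (pos_INR (length l)) as Hl.
  assert (Hq : 0 < c / (INR (length l) + 1)) by (apply Rdiv_lt_0_compat; lra).
  (* The [+ 1] covers the empty list and makes the final inequality strict. *)
  exists (sqrt (c / (INR (length l) + 1))). split; [now apply sqrt_lt_R0|].
  intros x y H. unfold sqdist.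
  apply Rle_lt_trans with (sumL l (fun _ => c / (INR (length l) + 1))).
  - apply sumL_le. intros j Hj. specialize (H j Hj).
    rewrite <- (sqrt_sqrt (c / _)) by lra.
    replace ((x j - y j) * (x j - y j)) with (Rabs (x j - y j) * Rabs (x j - y j)).
    + apply Rmult_le_compat; try apply Rabs_pos; lra.
    + rewrite <- Rabs_mult. apply Rabs_pos_eq. apply Rle_0_sqr.
  - rewrite sumL_const. apply Rmult_lt_reg_r with (INR (length l) + 1); [lra|].
    unfold Rdiv. rewrite !Rmult_assoc, Rinv_l by lra. nra.
Qed.

Lemma cont_on_sqdist {m : nat} (U : pt m -> Prop) l (f : pt m -> pt m) y :
  (forall j, cont_on U (fun x => f x j)) -> cont_on U (fun x => sqdist l (f x) y).
Proof.
  intros H. apply (cont_on_sumL U l (fun j x => (f x j - y j) * (f x j - y j))).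
  intros j. apply (cont_on_comp U (fun x => f x j) (fun t => (t - y j) * (t - y j))); auto.
  intros. reg.
Qed.

Lemma partial_at_sqdist {m : nat} l (f : pt m -> pt m) y i x d :
  (forall j, partial_at (fun x => f x j) i x (d j)) ->
  partial_at (fun x => sqdist l (f x) y) i x (2 * sumL l (fun j => (f x j - y j) * d j)).
Proof.
  intros H. rewrite <- sumL_scal.
  apply (partial_at_sumL l (fun j x => (f x j - y j) * (f x j - y j))). intros j _.
  replace (2 * ((f x j - y j) * d j)) with (d j * (f x j - y j) + (f x j - y j) * d j) by ring.
  assert (partial_at (fun x => f x j - y j) i x (d j)).
  { replace (d j) with (d j + 0) by ring. apply partial_at_plus; auto. apply partial_at_const. }
  now apply (partial_at_mult (fun x => f x j - y j) (fun x => f x j - y j)).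
Qed.

(** Each coordinate has its own radius; radius 0 freezes a coordinate, which gives the slices used
    later. *)
Definition cbox {m : nat} (x r : pt m) : pt m -> Prop := fun z => forall i, Rabs (z i - x i) <= r i.

Lemma closed_coord_le {m : nat} (x : pt m) i r : is_closed (fun z => Rabs (z i - x i) <= r).
Proof.
  intros z Hz. apply Rnot_le_lt in Hz. exists (Rabs (z i - x i) - r). split; [lra|].
  intros w Hw H. specialize (Hw i).
  pose proof (Rabs_triang (w i - x i) (- (w i - z i))). rewrite Rabs_Ropp in H0.
  replace (w i - x i + - (w i - z i)) with (z i - x i) in H0 by ring. lra.
Qed.

Lemma closed_forall {m : nat} {A : Type} (K : A -> pt m -> Prop) :
  (forall a, is_closed (K a)) -> is_closed (fun z => forall a, K a z).
Proof.
  intros H z Hz. apply not_all_ex_not in Hz. destruct Hz as [a Ha].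
  destruct (H a z Ha) as [d [Hd Hd']]. exists d. split; auto.
  intros y Hy HK. exact (Hd' y Hy (HK a)).
Qed.

Lemma closed_and {m : nat} (K L : pt m -> Prop) :
  is_closed K -> is_closed L -> is_closed (fun z => K z /\ L z).
Proof.
  intros HK HL z Hz. destruct (classic (K z)) as [Hk|Hk].
  - destruct (HL z) as [d [Hd H]]; [tauto|]. exists d. split; auto.
    intros y Hy [_ HLy]. exact (H y Hy HLy).
  - destruct (HK z Hk) as [d [Hd H]]. exists d. split; auto.
    intros y Hy [HKy _]. exact (H y Hy HKy).
Qed.

Lemma closed_exists_in {m : nat} {A : Type} (l : list A) (K : A -> pt m -> Prop) :
  (forall a, is_closed (K a)) -> is_closed (fun z => exists a, In a l /\ K a z).
Proof.
  intros H z Hz. destruct (common_radius l (fun a d => forall y, dist_lt y z d -> ~ K a y))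
    as [d [Hd Hl]].
  - intros a d d' Hd Hdd y Hy. apply Hd. apply dist_lt_le with d'; auto. lra.
  - intros a Ha. apply (H a z). intros HK. apply Hz. now exists a.
  - exists d. split; auto. intros y Hy [a [Ha HK]]. exact (Hl a Ha y Hy HK).
Qed.

Lemma closed_preimage {m : nat} (f : pt m -> R) c :
  cont_on fullset f -> is_closed (fun z => f z <= c).
Proof.
  intros Hf z Hz. apply Rnot_le_lt in Hz.
  destruct (Hf z I (f z - c)) as [d [Hd H]]; [lra|]. exists d. split; auto.
  intros y Hy Hc. specialize (H y I Hy). apply Rabs_def2 in H. lra.
Qed.

Lemma closed_subset_bounded {m : nat} (K L : pt m -> Prop) :
  subset K L -> is_bounded L -> is_bounded K.
Proof. intros H [M HM]. exists M. auto. Qed.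

Lemma cbox_closed {m : nat} (x r : pt m) : is_closed (cbox x r).
Proof.
  apply (closed_forall (fun i z => Rabs (z i - x i) <= r i)). intros. apply closed_coord_le.
Qed.

Lemma cbox_bounded {m : nat} (x r : pt m) : is_bounded (cbox x r).
Proof.
  exists (sumF (fun i => Rabs (x i) + Rabs (r i))). intros z Hz i. specialize (Hz i).
  pose proof (sumL_term_le (fins m) (fun i => Rabs (x i) + Rabs (r i)) i
    (fun b _ => Rplus_le_le_0_compat _ _ (Rabs_pos (x b)) (Rabs_pos (r b))) (in_fins i)) as Hs.
  simpl in Hs. pose proof (Rabs_triang (z i - x i) (x i)) as H.
  replace (z i - x i + x i) with (z i) in H by ring.
  pose proof (Rle_abs (r i)). unfold sumF. lra.
Qed.

Lemma cbox_compact {m : nat} (x r : pt m) : is_compact (cbox x r).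
Proof. apply closed_bounded_compact; [apply cbox_closed|apply cbox_bounded]. Qed.

Lemma closed_coord_ge {m : nat} (x : pt m) i r : is_closed (fun z => r <= Rabs (z i - x i)).
Proof.
  intros z Hz. apply Rnot_le_lt in Hz. exists (r - Rabs (z i - x i)). split; [lra|].
  intros w Hw H. specialize (Hw i).
  pose proof (Rabs_triang (z i - x i) (w i - z i)).
  replace (z i - x i + (w i - z i)) with (w i - x i) in H0 by ring. lra.
Qed.

(* The squared distance from [y] to the image of a small box around [x0] is
   minimal at an interior point, where it is critical; nondegeneracy of the
   Jacobian forces the minimum to be zero. *)
Lemma local_surjective {m : nat} (O : pt m -> Prop) (f : pt m -> pt m)
  (J : pt m -> Fin.t m -> Fin.t m -> R) x0 d :
  is_open O -> O x0 -> inj_on O f ->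
  (forall j, cont_on O (fun x => f x j)) ->
  (forall j i x, O x -> partial_at (fun x => f x j) i x (J x j i)) ->
  (forall x, O x -> nondegenerate (J x)) -> 0 < d ->
  exists c, 0 < c /\ forall y, dist_lt y (f x0) c ->
    exists x, O x /\ dist_lt x x0 d /\ f x = y.
Proof.
  intros HO Hx0 Hinj Hc Hp HJ Hd.
  destruct (HO x0 Hx0) as [r0 [Hr0 HO']].
  pose (r := Rmin d r0 / 2).
  assert (Hm : 0 < Rmin d r0) by now apply Rmin_pos.
  assert (Hr : 0 < r) by (unfold r; lra).
  assert (Hin : forall x, cbox x0 (fun _ => r) x -> dist_lt x x0 (Rmin d r0)).
  { intros x Hx i. specialize (Hx i). unfold r in Hx. lra. }
  assert (HB : subset (cbox x0 (fun _ => r)) O).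
  { intros x Hx. apply HO'. apply dist_lt_le with (1 := Hin x Hx), Rmin_r. }
  pose (S := fun x => cbox x0 (fun _ => r) x /\ exists i, In i (fins m) /\ r <= Rabs (x i - x0 i)).
  assert (HS : is_compact S).
  { apply closed_bounded_compact.
    - apply closed_and; [apply cbox_closed|].
      apply (closed_exists_in (fins m) (fun i x => r <= Rabs (x i - x0 i))).
      intros. apply closed_coord_ge.
    - apply closed_subset_bounded with (cbox x0 (fun _ => r)); [|apply cbox_bounded]. now intros x [H _]. }
  assert (Hmu : exists mu, 0 < mu /\ forall x, S x -> mu <= sqdist (fins m) (f x) (f x0)).
  { destruct (classic (exists z, S z)) as [[z Hz]|Hn].
    - destruct (compact_min S (fun x => sqdist (fins m) (f x) (f x0)) z HS Hz) as [x [Hx Hmin]].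
      + apply cont_on_sqdist. intros j. apply cont_on_sub with O; auto.
        intros x [Hx _]. auto.
      + exists (sqdist (fins m) (f x) (f x0)). split; auto.
        destruct (sqdist_nonneg (fins m) (f x) (f x0)) as [H|H]; auto. exfalso.
        assert (Heq : peq x x0).
        { apply Hinj; auto. 1: apply HB, Hx.
          intros j. apply Rminus_diag_uniq. symmetry in H.
          apply (sumF_sqr_eq0 (fun j => f x j - f x0 j) H). }
        destruct Hx as [_ [i [_ Hi]]]. rewrite Heq, Rminus_diag, Rabs_R0 in Hi. lra.
    - exists 1. split; [lra|]. intros x Hx. exfalso. apply Hn. now exists x. }
  destruct Hmu as [mu [Hmu Hmin]].
  (* A minimiser on the boundary would be at squared distance below [mu / 4] from [y], as [x0] is.
     The quasi-triangle inequality would put it below [2 mu / 4 + 2 mu / 4 = mu] from [f x0],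
     against the choice of [mu]. *)
  destruct (sqdist_lt (fins m) (mu / 4)) as [c [Hc0 Hlt]]; [lra|].
  exists c. split; auto. intros y Hy.
  destruct (compact_min (cbox x0 (fun _ => r)) (fun x => sqdist (fins m) (f x) y) x0
    (cbox_compact x0 (fun _ => r))) as [x [Hx Hxm]].
  { intros i. rewrite Rminus_diag, Rabs_R0. lra. }
  { apply cont_on_sqdist. intros j. now apply cont_on_sub with O. }
  exists x. split; [auto|].
  assert (Hint : forall i, Rabs (x i - x0 i) < r).
  { intros i. apply Rnot_le_lt. intros Hi.
    assert (HSx : S x) by (split; auto; exists i; split; [apply in_fins|auto]).
    specialize (Hmin x HSx).
    assert (sqdist (fins m) (f x0) y < mu / 4).
    { apply Hlt. intros j _. apply (dist_lt_sym _ _ _ Hy). }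
    assert (sqdist (fins m) y (f x0) < mu / 4) by (apply Hlt; auto).
    specialize (Hxm x0 ltac:(intros k; rewrite Rminus_diag, Rabs_R0; lra)). simpl in Hxm.
    pose proof (sqdist_quasi_triangle (fins m) (f x) y (f x0)). lra. }
  split.
  - intros i. specialize (Hint i). unfold r in Hint. pose proof (Rmin_l d r0). lra.
  - apply peq_eq. intros j. apply Rminus_diag_uniq.
    apply (HJ x (HB x Hx) (fun j => f x j - y j)). intros i.
    assert (H0 : 2 * sumL (fins m) (fun j => (f x j - y j) * J x j i) = 0); [|unfold sumF; lra].
    apply (partial_at_min_zero (fun x => sqdist (fins m) (f x) y) i x) with (d := r - Rabs (x i - x0 i)).
    + specialize (Hint i). lra.
    + intros t Ht. apply Hxm. intros k. unfold upd.
      destruct (Fin.eq_dec k i) as [->|]; [|apply Hx].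
      pose proof (Rabs_triang (t - x i) (x i - x0 i)).
      replace (t - x i + (x i - x0 i)) with (t - x0 i) in H by ring. lra.
    + apply partial_at_sqdist. auto.
Qed.

(** * Extension by zero of [F o f^-1] *)

Definition kron {m : nat} (i j : Fin.t m) : R := if Fin.eq_dec i j then 1 else 0.

Lemma sumF_kron_l {m : nat} (F : Fin.t m -> R) i : sumF (fun j => kron i j * F j) = F i.
Proof.
  rewrite (sumF_single _ i); unfold kron.
  - destruct (Fin.eq_dec i i); [ring|congruence].
  - intros j Hj. destruct (Fin.eq_dec i j); [congruence|ring].
Qed.

Lemma sumF_kron_r {m : nat} (F : Fin.t m -> R) i : sumF (fun j => F j * kron j i) = F i.
Proof.
  rewrite (sumF_single _ i); unfold kron.
  - destruct (Fin.eq_dec i i); [ring|congruence].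
  - intros j Hj. destruct (Fin.eq_dec j i); [congruence|ring].
Qed.

(** Both products serve: [J Ji = 1] excludes a left kernel, and [Ji J = 1] solves the linearised
    equation for an increment. *)
Definition inverse_mx {m : nat} (J Ji : Fin.t m -> Fin.t m -> R) : Prop :=
  (forall j k, sumF (fun i => J j i * Ji i k) = kron j k) /\
  (forall j k, sumF (fun i => Ji j i * J i k) = kron j k).

Lemma inverse_nondegenerate {m : nat} (J Ji : Fin.t m -> Fin.t m -> R) :
  inverse_mx J Ji -> nondegenerate J.
Proof.
  intros [H _] w Hw k. rewrite <- (sumF_kron_r w k).
  transitivity (sumF (fun j => sumF (fun i => w j * (J j i * Ji i k)))).
  - apply sumL_ext. intros j _. unfold sumF at 1. rewrite sumL_scal. fold (sumF (fun i => J j i * Ji i k)).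
    now rewrite H.
  - unfold sumF at 1 2. rewrite sumL_exchange. apply sumL_zero. intros i _.
    rewrite (sumL_ext _ _ (fun j => Ji i k * (w j * J j i))) by (intros; ring).
    rewrite sumL_scal. fold (sumF (fun j => w j * J j i)). rewrite Hw. ring.
Qed.

(** This is the derivative of the inverse, stated for a preimage instead of an inverse map. With
    [k = x - x0] and linearisation error [eta], applying [Ji] gives [k - h Ji_j = - Ji eta], where
    [eta] is at most [e1] times the size [rho] of [k]. So [rho <= e1 S rho + S |h|], and the first
    term on the right is absorbed. *)
Lemma inverse_increment {m : nat} (O : pt m -> Prop) (f : pt m -> pt m)
  (J : pt m -> Fin.t m -> Fin.t m -> R) Ji x0 j e :
  is_open O -> O x0 ->
  (forall l i, cont_on O (fun x => J x l i)) ->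
  (forall l i x, O x -> partial_at (fun x => f x l) i x (J x l i)) ->
  inverse_mx (J x0) Ji -> 0 < e ->
  exists r, 0 < r /\ forall h x, dist_lt x x0 r -> f x = upd (f x0) j (f x0 j + h) ->
    sumF (fun i => Rabs (x i - x0 i - h * Ji i j)) <= e * Rabs h.
Proof.
  intros HO Hx0 HcJ Hp [_ HJ] He.
  pose (S := sumF (fun i => sumF (fun l => Rabs (Ji i l)))).
  assert (HS : 0 <= S).
  { apply sumL_nonneg. intros. apply sumL_nonneg. intros. apply Rabs_pos. }
  (* This gives [e1 S <= 1/2], hence [rho <= 2 S |h|], and also [2 e1 S^2 <= e], which is the final
     bound. *)
  pose (e1 := Rmin 1 e / (2 * ((S + 1) * (S + 1)))).
  assert (Hm : 0 < Rmin 1 e) by (apply Rmin_pos; lra).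
  assert (Hpos : 0 < 2 * ((S + 1) * (S + 1))) by nra.
  assert (He1 : 0 < e1) by now apply Rdiv_lt_0_compat.
  assert (He1' : e1 * (2 * ((S + 1) * (S + 1))) = Rmin 1 e).
  { unfold e1. field. lra. }
  destruct (common_radius_fin (fun l r => forall y, dist_lt y x0 r ->
    Rabs (f y l - f x0 l - sumF (fun i => J x0 l i * (y i - x0 i)))
      <= e1 * sumF (fun i => Rabs (y i - x0 i)))) as [r [Hr Hd]].
  { intros l d d' H Hd y Hy. apply H, dist_lt_le with d'; auto. lra. }
  { intros l. apply (differentiable O (fun x => f x l) (fun i x => J x l i)); auto. }
  exists r. split; auto. intros h x Hx Hf.
  pose (k := fun i => x i - x0 i).
  pose (eta := fun l => f x l - f x0 l - sumF (fun i => J x0 l i * k i)).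
  pose (rho := sumF (fun i => Rabs (k i))).
  assert (Heta : forall l, Rabs (eta l) <= e1 * rho) by (intros l; now apply Hd).
  assert (Hrho : 0 <= rho) by (apply sumL_nonneg; intros; apply Rabs_pos).
  assert (Heta' : forall l, f x l - f x0 l = eta l + sumF (fun i => J x0 l i * k i))
    by (intros l; unfold eta; ring).
  clearbody eta.
  assert (Hk : forall i, k i - h * Ji i j = - sumF (fun l => Ji i l * eta l)).
  { intros i.
    assert (H : sumF (fun l => Ji i l * eta l + sumF (fun i' => Ji i l * (J x0 l i' * k i')))
                = h * Ji i j).
    { rewrite (Rmult_comm h), <- (sumF_kron_r (fun l => Ji i l * h) j) .
      apply sumL_ext. intros l _.
      unfold sumF. rewrite sumL_scal. fold (sumF (fun i' => J x0 l i' * k i')).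
      rewrite <- Rmult_plus_distr_l, <- Heta', Hf. unfold upd, kron. destruct (Fin.eq_dec l j) as [->|]; ring. }
    unfold sumF in H. rewrite sumL_plus in H.
    rewrite (sumL_exchange (fins m) (fins m) (fun l i' => Ji i l * (J x0 l i' * k i'))) in H.
    rewrite (sumL_ext (fins m)
      (fun i' => sumL (fins m) (fun l => Ji i l * (J x0 l i' * k i')))
      (fun i' => kron i i' * k i')) in H.
    - fold (sumF (fun i' => kron i i' * k i')) in H. rewrite sumF_kron_l in H.
      unfold sumF. lra.
    - intros i' _. rewrite <- HJ. unfold sumF. rewrite (Rmult_comm (sumL _ _)), <- sumL_scal.
      apply sumL_ext. intros. ring. }
  assert (Htot : sumF (fun i => Rabs (k i - h * Ji i j)) <= e1 * rho * S).
  { unfold S, sumF at 2. rewrite <- sumL_scal. apply sumL_le. intros i _.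
    rewrite Hk, Rabs_Ropp. eapply Rle_trans; [apply Rabs_sumL|].
    unfold sumF. rewrite <- sumL_scal. apply sumL_le. intros l _.
    rewrite Rabs_mult, Rmult_comm. apply Rmult_le_compat_r; [apply Rabs_pos|apply Heta]. }
  assert (HSj : sumF (fun i => Rabs (h * Ji i j)) <= Rabs h * S).
  { unfold S, sumF at 2. rewrite <- sumL_scal. apply sumL_le. intros i _.
    rewrite Rabs_mult. apply Rmult_le_compat_l; [apply Rabs_pos|].
    apply (sumL_term_le (fins m) (fun l => Rabs (Ji i l))); [|apply in_fins].
    intros. apply Rabs_pos. }
  assert (Hle : rho <= e1 * rho * S + Rabs h * S).
  { apply Rle_trans with (sumF (fun i => Rabs (k i - h * Ji i j) + Rabs (h * Ji i j))).
    - apply sumL_le. intros i _. pose proof (Rabs_triang (k i - h * Ji i j) (h * Ji i j)).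
      replace (k i - h * Ji i j + h * Ji i j) with (k i) in H by ring. lra.
    - unfold sumF at 1. rewrite sumL_plus. fold (sumF (fun i => Rabs (k i - h * Ji i j))).
      fold (sumF (fun i => Rabs (h * Ji i j))). lra. }
  apply Rle_trans with (1 := Htot).
  pose proof (Rmin_l 1 e). pose proof (Rmin_r 1 e). pose proof (Rabs_pos h).
  assert (e1 * S <= 1 / 2) by nra.
  assert (rho <= 2 * S * Rabs h) by nra.
  apply Rle_trans with (e1 * S * (2 * S * Rabs h)).
  - replace (e1 * rho * S) with (e1 * S * rho) by ring. apply Rmult_le_compat_l; nra.
  - replace (e1 * S * (2 * S * Rabs h)) with (e1 * S * 2 * S * Rabs h) by ring.
    apply Rmult_le_compat_r; nra.
Qed.

(* [F o f^-1], extended by zero outside [f(O)]. *)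
Definition push {m : nat} (O : pt m -> Prop) (f : pt m -> pt m) (F : pt m -> R) : pt m -> R :=
  fun y => match excluded_middle_informative (exists x, O x /\ f x = y) with
           | left H => F (proj1_sig (constructive_indefinite_description _ H))
           | right _ => 0
           end.

Lemma push_image {m : nat} (O : pt m -> Prop) (f : pt m -> pt m) F x :
  inj_on O f -> O x -> push O f F (f x) = F x.
Proof.
  intros Hinj Hx. unfold push. destruct (excluded_middle_informative _) as [H|H].
  - destruct (constructive_indefinite_description _ H) as [z [Hz Hzx]]. simpl.
    f_equal. apply peq_eq, Hinj; auto. now rewrite Hzx.
  - exfalso. apply H. eauto.
Qed.

Lemma push_outside {m : nat} (O : pt m -> Prop) (f : pt m -> pt m) F y :
  ~ (exists x, O x /\ f x = y) -> push O f F y = 0.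
Proof. intros H. unfold push. now destruct (excluded_middle_informative _). Qed.

Lemma push_bound {m : nat} (O K : pt m -> Prop) (f : pt m -> pt m) F c :
  0 <= c -> (forall x, K x -> Rabs (F x) <= c) -> (forall x, O x -> ~ K x -> F x = 0) ->
  forall y, Rabs (push O f F y) <= c.
Proof.
  intros Hc HK H0 y. unfold push. destruct (excluded_middle_informative _) as [H|H].
  - destruct (constructive_indefinite_description _ H) as [z [Hz Hzx]]. simpl.
    destruct (classic (K z)) as [Hk|Hk]; auto. rewrite H0, Rabs_R0; auto.
  - now rewrite Rabs_R0.
Qed.

Section Pushforward.

Context {m : nat} (O K : pt m -> Prop) (f : pt m -> pt m)
  (J Ji : pt m -> Fin.t m -> Fin.t m -> R).
Context (HO : is_open O) (HK : is_compact K) (HKO : subset K O) (Hinj : inj_on O f)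
  (Hf : forall j, cont_on O (fun x => f x j))
  (HcJ : forall j i, cont_on O (fun x => J x j i))
  (Hp : forall j i x, O x -> partial_at (fun x => f x j) i x (J x j i))
  (HJ : forall x, O x -> inverse_mx (J x) (Ji x)).

(** A point [y] outside [f(O)] has positive distance from the values of [f] on the compact set [K].
    Nearby points are therefore outside [f(O)] or images of points off [K], and the extension
    vanishes at both. This is why [f(O)] need not be closed. *)
Lemma push_zero_near F y :
  (forall x, O x -> ~ K x -> F x = 0) -> ~ (exists x, O x /\ f x = y) ->
  exists d, 0 < d /\ forall y', dist_lt y' y d -> push O f F y' = 0.
Proof.
  intros H0 Hy.
  assert (H : exists d, 0 < d /\ forall x, K x -> ~ dist_lt (f x) y d).
  { destruct (classic (exists z, K z)) as [[z Hz]|Hn].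
    - destruct (compact_min K (fun x => sqdist (fins m) (f x) y) z HK Hz) as [x [Hx Hmin]].
      { apply cont_on_sqdist. intros j. now apply cont_on_sub with O. }
      assert (Hpos : 0 < sqdist (fins m) (f x) y).
      { destruct (sqdist_nonneg (fins m) (f x) y) as [H|H]; auto. exfalso. apply Hy.
        exists x. split; auto. apply peq_eq. intros j. apply Rminus_diag_uniq.
        symmetry in H. apply (sumF_sqr_eq0 (fun j => f x j - y j) H). }
      destruct (sqdist_lt (fins m) _ Hpos) as [d [Hd H]].
      exists d. split; auto. intros w Hw Hwy. specialize (Hmin w Hw).
      specialize (H (f w) y (fun j _ => Hwy j)). lra.
    - exists 1. split; [lra|]. intros x Hx. exfalso. apply Hn. now exists x. }
  destruct H as [d [Hd H]]. exists d. split; auto. intros y' Hy'.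
  destruct (classic (exists x, O x /\ f x = y')) as [[x [Hx <-]]|Hn].
  - rewrite push_image; auto. apply H0; auto. intros Hk. exact (H x Hk Hy').
  - now apply push_outside.
Qed.

(** This gives openness of [f(O)] and, together with injectivity, continuity of the inverse. *)
Lemma preimage_near x0 d :
  O x0 -> 0 < d -> exists c, 0 < c /\ forall y, dist_lt y (f x0) c ->
    exists x, O x /\ dist_lt x x0 d /\ f x = y.
Proof.
  intros Hx0 Hd. apply local_surjective with J; auto.
  intros x Hx. apply inverse_nondegenerate with (Ji x). auto.
Qed.

Lemma push_continuous F :
  cont_on O F -> (forall x, O x -> ~ K x -> F x = 0) -> cont_on fullset (push O f F).
Proof.
  intros HF H0 y _ e He. destruct (classic (exists x, O x /\ f x = y)) as [[x [Hx <-]]|Hn].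
  - destruct (HF x Hx e He) as [d [Hd H]].
    destruct (preimage_near x d Hx Hd) as [c [Hc H']]. exists c. split; auto.
    intros y _ Hy. destruct (H' y Hy) as [x' [Hx' [Hxx' <-]]].
    rewrite !push_image; auto.
  - destruct (push_zero_near F y H0 Hn) as [d [Hd H]]. exists d. split; auto.
    intros y' _ Hy'. rewrite H, push_outside, Rminus_diag, Rabs_R0; auto.
Qed.

Lemma push_partial F (DF : Fin.t m -> pt m -> R) j y :
  (forall i, cont_on O (DF i)) ->
  (forall i x, O x -> partial_at F i x (DF i x)) ->
  (forall x, O x -> ~ K x -> F x = 0) ->
  partial_at (push O f F) j y (push O f (fun x => sumF (fun i => DF i x * Ji x i j)) y).
Proof.
  intros HDF HF H0. destruct (classic (exists x, O x /\ f x = y)) as [[x [Hx <-]]|Hn].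
  - rewrite push_image by auto. intros e He.
    pose (S := sumF (fun i => Rabs (Ji x i j))).
    pose (G := sumF (fun i => Rabs (DF i x))).
    assert (HS : 0 <= S) by (apply sumL_nonneg; intros; apply Rabs_pos).
    assert (HG : 0 <= G) by (apply sumL_nonneg; intros; apply Rabs_pos).
    (* The error splits into the remainder of [F], at most [e2 (1 + S) |h| = e/4 |h|], and the
       remainder of the inverse weighted by the gradient of [F], at most [G e1 |h| <= e/4 |h|]. The
       bound [e1 <= 1] is what permits [1 + S] in the first term. *)
    pose (e1 := Rmin 1 (e / (4 * (G + 1)))). pose (e2 := e / (4 * (S + 1))).
    assert (He1 : 0 < e1) by (apply Rmin_pos; [lra|apply Rdiv_lt_0_compat; lra]).
    assert (He2 : 0 < e2) by (apply Rdiv_lt_0_compat; lra).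
    destruct (inverse_increment O f J (Ji x) x j e1) as [r1 [Hr1 H1]]; auto.
    destruct (differentiable O F DF x e2) as [r2 [Hr2 H2]]; auto.
    destruct (preimage_near x (Rmin r1 r2) Hx) as [c [Hc Hpre]]; [now apply Rmin_pos|].
    exists (mkposreal c Hc). intros h Hh0 Hh. simpl in Hh. rewrite upd_id, push_image by auto.
    destruct (Hpre (upd (f x) j (f x j + h))) as [x' [Hx' [Hxx' Hfx']]].
    { apply dist_lt_upd. now replace (f x j + h - f x j) with h by ring. }
    rewrite <- Hfx', push_image by auto.
    specialize (H1 h x' (dist_lt_le _ _ _ _ Hxx' (Rmin_l _ _)) Hfx').
    specialize (H2 x' (dist_lt_le _ _ _ _ Hxx' (Rmin_r _ _))).
    set (L := sumF (fun i => DF i x * Ji x i j)).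
    assert (Hh' : 0 < Rabs h) by now apply Rabs_pos_lt.
    assert (Ha : sumF (fun i => Rabs (x' i - x i)) <= (e1 + S) * Rabs h).
    { apply Rle_trans with
        (sumF (fun i => Rabs (x' i - x i - h * Ji x i j) + Rabs h * Rabs (Ji x i j))).
      - apply sumL_le. intros i _. rewrite <- Rabs_mult.
        pose proof (Rabs_triang (x' i - x i - h * Ji x i j) (h * Ji x i j)).
        replace (x' i - x i - h * Ji x i j + h * Ji x i j) with (x' i - x i) in H by ring. lra.
      - unfold sumF at 1. rewrite sumL_plus, sumL_scal. fold (sumF (fun i => Rabs (Ji x i j))).
        fold (sumF (fun i => Rabs (x' i - x i - h * Ji x i j))). fold S. lra. }
    assert (Hb : Rabs (sumF (fun i => DF i x * (x' i - x i)) - h * L) <= G * (e1 * Rabs h)).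
    { replace (sumF (fun i => DF i x * (x' i - x i)) - h * L)
        with (sumF (fun i => DF i x * (x' i - x i - h * Ji x i j))).
      - eapply Rle_trans; [apply Rabs_sumL|]. unfold G, sumF.
        rewrite Rmult_comm, <- sumL_scal.
        apply sumL_le. intros i _. rewrite Rabs_mult, (Rmult_comm (e1 * _)).
        apply Rmult_le_compat_l; [apply Rabs_pos|].
        eapply Rle_trans; [|exact H1].
        apply (sumL_term_le (fins m) (fun i => Rabs (x' i - x i - h * Ji x i j)));
          [intros; apply Rabs_pos|apply in_fins].
      - transitivity (sumF (fun i => DF i x * (x' i - x i) + - h * (DF i x * Ji x i j))).
        + apply sumL_ext. intros. ring.
        + unfold sumF at 1. rewrite sumL_plus, sumL_scal. unfold L, sumF. ring. }
    assert (Hc1 : e1 <= 1) by apply Rmin_l.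
    assert (Hc2 : G * e1 <= e / 4).
    { apply Rle_trans with ((G + 1) * (e / (4 * (G + 1)))).
      - pose proof (Rmin_r 1 (e / (4 * (G + 1)))) as H. fold e1 in H. nra.
      - right. field. lra. }
    assert (Hc3 : e2 * (S + 1) = e / 4) by (unfold e2; field; lra).
    replace ((F x' - F x) / h - L) with ((F x' - F x - h * L) / h) by (field; auto).
    unfold Rdiv. rewrite Rabs_mult, Rabs_inv. apply Rmult_lt_reg_r with (Rabs h); auto.
    rewrite Rmult_assoc, Rinv_l, Rmult_1_r by lra.
    pose proof (Rabs_triang (F x' - F x - sumF (fun i => DF i x * (x' i - x i)))
      (sumF (fun i => DF i x * (x' i - x i)) - h * L)) as Ht.
    replace (F x' - F x - sumF (fun i => DF i x * (x' i - x i))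
      + (sumF (fun i => DF i x * (x' i - x i)) - h * L)) with (F x' - F x - h * L) in Ht by ring.
    assert (e2 * sumF (fun i => Rabs (x' i - x i)) <= e2 * ((1 + S) * Rabs h)).
    { apply Rmult_le_compat_l; [lra|]. eapply Rle_trans; [exact Ha|].
      apply Rmult_le_compat_r; lra. }
    assert (G * (e1 * Rabs h) <= e / 4 * Rabs h).
    { rewrite <- Rmult_assoc. apply Rmult_le_compat_r; lra. }
    assert (e2 * ((1 + S) * Rabs h) = e / 4 * Rabs h) by (rewrite <- Hc3; ring).
    assert (0 < e * Rabs h) by (apply Rmult_lt_0_compat; lra).
    lra.
  - rewrite push_outside by auto.
    destruct (push_zero_near F y H0 Hn) as [d [Hd H]].
    apply partial_at_local with (fun _ => 0) d; auto.
    + intros y' Hy'. symmetry. auto.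
    + apply partial_at_const.
Qed.

End Pushforward.

(** * Nets with moderate derivatives *)

(** Continuity is asked on [O], the moderate bound only on [K]: the nets to be pushed forward vanish
    on [O] outside [K], so for them a bound on [K] is a bound everywhere. *)
Definition tame {m : nat} (O K : pt m -> Prop) (e0 : R) (u : R -> pt m -> R) : Prop :=
  (forall e, 0 < e <= e0 -> cont_on O (u e)) /\
  exists (N : nat) (C r : R), 0 < r <= 1 /\
    forall e, 0 < e <= r -> e <= e0 -> forall x, K x -> Rabs (u e x) <= C * / e ^ N.

Definition partial_net {m : nat} (O : pt m -> Prop) (e0 : R) (i : Fin.t m)
  (u u' : R -> pt m -> R) : Prop :=
  forall e, 0 < e <= e0 -> forall x, O x -> partial_at (u e) i x (u' e x).

Definition partial_closed {m : nat} (O K : pt m -> Prop) (e0 : R)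
  (S : (R -> pt m -> R) -> Prop) : Prop :=
  forall u, S u -> tame O K e0 u /\ forall i, exists u', partial_net O e0 i u u' /\ S u'.

(* Coinductively: [u] is tame and has partial derivatives that are again smooth nets. *)
Definition smooth_net {m : nat} (O K : pt m -> Prop) (e0 : R) (u : R -> pt m -> R) : Prop :=
  exists S, S u /\ partial_closed O K e0 S.

Lemma smooth_net_unfold {m : nat} (O K : pt m -> Prop) e0 u :
  smooth_net O K e0 u ->
  tame O K e0 u /\ forall i, exists u', partial_net O e0 i u u' /\ smooth_net O K e0 u'.
Proof.
  intros [S [Hu HS]]. destruct (HS u Hu) as [Ht Hp]. split; auto.
  intros i. destruct (Hp i) as [u' [H Hu']]. exists u'. split; auto. now exists S.
Qed.

Inductive alg {m : nat} (G : (R -> pt m -> R) -> Prop) : (R -> pt m -> R) -> Prop :=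
| alg_gen u : G u -> alg G u
| alg_const c : alg G (fun _ _ => c)
| alg_plus u v : alg G u -> alg G v -> alg G (fun e x => u e x + v e x)
| alg_mult u v : alg G u -> alg G v -> alg G (fun e x => u e x * v e x).

Lemma pow_inv_ge1 e n : 0 < e <= 1 -> 1 <= / e ^ n.
Proof.
  intros He. rewrite <- Rinv_1. apply Rinv_le_contravar.
  - apply pow_lt. lra.
  - rewrite <- (pow1 n). apply pow_incr. lra.
Qed.

Lemma tame_const {m : nat} (O K : pt m -> Prop) e0 c : tame O K e0 (fun _ _ => c).
Proof.
  split; [intros; apply cont_on_const|]. exists 0%nat, (Rabs c), 1. split; [lra|].
  intros. simpl. rewrite Rinv_1. lra.
Qed.

Lemma tame_plus {m : nat} (O K : pt m -> Prop) e0 u v :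
  tame O K e0 u -> tame O K e0 v -> tame O K e0 (fun e x => u e x + v e x).
Proof.
  intros [Hu [N [C [r [Hr HC]]]]] [Hv [N' [C' [r' [Hr' HC']]]]]. split.
  - intros e He. now apply cont_on_plus; [apply Hu|apply Hv].
  - exists (N + N')%nat, (Rabs C + Rabs C'), (Rmin r r').
    assert (0 < Rmin r r') by (apply Rmin_pos; lra).
    pose proof (Rmin_l r r'). pose proof (Rmin_r r r'). split; [lra|].
    intros e He He0 x Hx.
    specialize (HC e ltac:(lra) He0 x Hx). specialize (HC' e ltac:(lra) He0 x Hx).
    rewrite pow_add, Rinv_mult.
    pose proof (pow_inv_ge1 e N ltac:(lra)). pose proof (pow_inv_ge1 e N' ltac:(lra)).
    pose proof (Rabs_triang (u e x) (v e x)).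
    pose proof (Rle_abs C). pose proof (Rle_abs C').
    pose proof (Rabs_pos C). pose proof (Rabs_pos C').
    apply Rle_trans with (Rabs C * / e ^ N + Rabs C' * / e ^ N'); [nra|].
    rewrite Rmult_plus_distr_r. apply Rplus_le_compat; apply Rmult_le_compat_l; nra.
Qed.

Lemma tame_mult {m : nat} (O K : pt m -> Prop) e0 u v :
  tame O K e0 u -> tame O K e0 v -> tame O K e0 (fun e x => u e x * v e x).
Proof.
  intros [Hu [N [C [r [Hr HC]]]]] [Hv [N' [C' [r' [Hr' HC']]]]]. split.
  - intros e He. now apply cont_on_mult; [apply Hu|apply Hv].
  - exists (N + N')%nat, (C * C'), (Rmin r r').
    assert (0 < Rmin r r') by (apply Rmin_pos; lra).
    pose proof (Rmin_l r r'). pose proof (Rmin_r r r'). split; [lra|].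
    intros e He He0 x Hx.
    specialize (HC e ltac:(lra) He0 x Hx). specialize (HC' e ltac:(lra) He0 x Hx).
    rewrite pow_add, Rinv_mult, Rabs_mult.
    replace (C * C' * (/ e ^ N * / e ^ N')) with (C * / e ^ N * (C' * / e ^ N')) by ring.
    apply Rmult_le_compat; auto using Rabs_pos.
Qed.

(** Coinduction up to algebra operations: the derivatives of a generator need only be polynomials in
    generators, since tame nets are closed under sums and products and the sum and product rules
    lead back into [alg G]. *)
Lemma alg_smooth {m : nat} (O K : pt m -> Prop) e0 (G : (R -> pt m -> R) -> Prop) u :
  (forall u, G u -> tame O K e0 u /\
     forall i, exists u', partial_net O e0 i u u' /\ alg G u') ->
  alg G u -> smooth_net O K e0 u.
Proof.
  intros HG Hu. exists (alg G). split; auto. clear u Hu.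
  intros u Hu. induction Hu as [u Hu|c|u v Hu [Htu Hpu] Hv [Htv Hpv]|u v Hu [Htu Hpu] Hv [Htv Hpv]].
  - now apply HG.
  - split; [apply tame_const|]. intros i. exists (fun _ _ => 0).
    split; [intros e He x Hx; apply partial_at_const|apply alg_const].
  - split; [now apply tame_plus|]. intros i.
    destruct (Hpu i) as [u' [Hu' Hau]], (Hpv i) as [v' [Hv' Hav]].
    exists (fun e x => u' e x + v' e x). split; [|now apply alg_plus].
    intros e He x Hx. apply partial_at_plus; auto.
  - split; [now apply tame_mult|]. intros i.
    destruct (Hpu i) as [u' [Hu' Hau]], (Hpv i) as [v' [Hv' Hav]].
    exists (fun e x => u' e x * v e x + u e x * v' e x).
    split; [|apply alg_plus; now apply alg_mult].
    intros e He x Hx. apply partial_at_mult; auto.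
Qed.

Section SmoothNets.

Context {m : nat} (O K : pt m -> Prop) (e0 : R).

Lemma alg_smooth_net u : alg (smooth_net O K e0) u -> smooth_net O K e0 u.
Proof.
  apply alg_smooth. intros v Hv. destruct (smooth_net_unfold O K e0 v Hv) as [Ht Hp].
  split; auto. intros i. destruct (Hp i) as [v' [H Hv']]. exists v'.
  split; auto. now apply alg_gen.
Qed.

Lemma smooth_net_const c : smooth_net O K e0 (fun _ _ => c).
Proof. apply alg_smooth_net, alg_const. Qed.

Lemma smooth_net_plus u v :
  smooth_net O K e0 u -> smooth_net O K e0 v -> smooth_net O K e0 (fun e x => u e x + v e x).
Proof. intros. apply alg_smooth_net, alg_plus; now apply alg_gen. Qed.

Lemma smooth_net_mult u v :
  smooth_net O K e0 u -> smooth_net O K e0 v -> smooth_net O K e0 (fun e x => u e x * v e x).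
Proof. intros. apply alg_smooth_net, alg_mult; now apply alg_gen. Qed.

Lemma smooth_net_sumL {A : Type} (l : list A) (u : A -> R -> pt m -> R) :
  (forall a, smooth_net O K e0 (u a)) ->
  smooth_net O K e0 (fun e x => sumL l (fun a => u a e x)).
Proof.
  intros H. induction l as [|a l IH]; simpl.
  - apply smooth_net_const.
  - now apply smooth_net_plus.
Qed.

Lemma smooth_net_coord i : is_bounded K -> smooth_net O K e0 (fun _ x => x i).
Proof.
  intros [M HM]. apply alg_smooth with (fun u => u = fun _ x => x i); [|now apply alg_gen].
  intros u ->. split.
  - split; [intros; apply cont_on_coord|]. exists 0%nat, M, 1. split; [lra|].
    intros. simpl. rewrite Rinv_1, Rmult_1_r. auto.
  - intros j. exists (fun _ _ => if Fin.eq_dec i j then 1 else 0). split; [|apply alg_const].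
    intros e He x Hx. apply partial_at_coord.
Qed.

(** Adding [1/u] to the generators suffices, because its derivative [- (1/u)^2 u'] is a polynomial
    in generators. The lower bound by a power of [eps] makes [1/u] itself tame. *)
Lemma smooth_net_inv u (N : nat) c r :
  smooth_net O K e0 u ->
  (forall e, 0 < e <= e0 -> forall x, O x -> u e x <> 0) ->
  0 < c -> 0 < r <= 1 ->
  (forall e, 0 < e <= r -> e <= e0 -> forall x, K x -> c * e ^ N <= Rabs (u e x)) ->
  smooth_net O K e0 (fun e x => / u e x).
Proof.
  intros Hu H0 Hc Hr HK.
  set (G := fun v => smooth_net O K e0 v \/ v = fun e x => / u e x).
  apply alg_smooth with G; [|apply alg_gen; now right].
  intros v [Hv| ->].
  - destruct (smooth_net_unfold O K e0 v Hv) as [Ht Hp]. split; auto.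
    intros i. destruct (Hp i) as [v' [H Hv']]. exists v'. split; auto.
    apply alg_gen. now left.
  - destruct (smooth_net_unfold O K e0 u Hu) as [[Hcu _] Hp]. split; [split|].
    + intros e He. apply (cont_on_comp O (u e) Rinv); auto.
      intros x Hx. apply (continuity_pt_inv id); [apply derivable_continuous_pt, derivable_pt_id|].
      now apply H0.
    + exists N, (/ c), r. split; auto. intros e He He0 x Hx.
      rewrite Rabs_inv, <- Rinv_mult. apply Rinv_le_contravar; auto.
      apply Rmult_lt_0_compat; [auto|apply pow_lt; lra].
    + intros i. destruct (Hp i) as [u' [Hu' Hs]].
      exists (fun e x => (-1 * (/ u e x * / u e x)) * u' e x). split.
      * intros e He x Hx. apply (partial_at_comp (u e) Rinv); [now apply Hu'|].
        apply is_derive_Reals. auto_derive; [now apply H0|]. field. now apply H0.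
      * apply alg_mult; [apply alg_mult; [apply alg_const|]|].
        -- apply alg_mult; apply alg_gen; now right.
        -- apply alg_gen. now left.
Qed.

(** Made for [flat k], that is [t^-k exp(-1/t)]: each derivative is a combination of later members
    of the sequence, so all compositions [phi k o u] together with the smooth nets can serve as
    generators. *)
Lemma smooth_net_comp_seq (phi : nat -> R -> R) u k :
  (forall k, exists M, forall t, Rabs (phi k t) <= M) ->
  (forall k t, derivable_pt_lim (phi k) t (- INR k * phi (S k) t + phi (S (S k)) t)) ->
  smooth_net O K e0 u -> smooth_net O K e0 (fun e x => phi k (u e x)).
Proof.
  intros Hb Hd Hu.
  set (G := fun v => smooth_net O K e0 v \/ exists k, v = fun e x => phi k (u e x)).
  apply alg_smooth with G; [|apply alg_gen; right; now exists k]. clear k.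
  intros v [Hv| [k ->]].
  - destruct (smooth_net_unfold O K e0 v Hv) as [Ht Hp]. split; auto.
    intros i. destruct (Hp i) as [v' [H Hv']]. exists v'. split; auto.
    apply alg_gen. now left.
  - destruct (smooth_net_unfold O K e0 u Hu) as [[Hcu _] Hp]. split; [split|].
    + intros e He. apply (cont_on_comp O (u e) (phi k)); auto.
      intros x Hx. apply derivable_continuous_pt. eexists. apply Hd.
    + destruct (Hb k) as [M HM]. exists 0%nat, M, 1. split; [lra|].
      intros. simpl. rewrite Rinv_1, Rmult_1_r. auto.
    + intros i. destruct (Hp i) as [u' [Hu' Hs]].
      exists (fun e x => (- INR k * phi (S k) (u e x) + phi (S (S k)) (u e x)) * u' e x). split.
      * intros e He x Hx. apply partial_at_comp; auto.
      * apply alg_mult; [|apply alg_gen; now left]. apply alg_plus; [apply alg_mult|].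
        -- apply alg_const.
        -- apply alg_gen. right. now exists (S k).
        -- apply alg_gen. right. now exists (S (S k)).
Qed.

End SmoothNets.

(** * A smooth cutoff function *)

Definition flat (k : nat) (t : R) : R :=
  if Rlt_dec 0 t then (/ t) ^ k * exp (- / t) else 0.

Lemma flat_nonneg k t : 0 <= flat k t.
Proof.
  unfold flat. destruct (Rlt_dec 0 t); [|lra].
  apply Rmult_le_pos; [|left; apply exp_pos]. apply pow_le. left. now apply Rinv_0_lt_compat.
Qed.

Lemma flat_pos t : 0 < t -> 0 < flat 0 t.
Proof.
  intros Ht. unfold flat. destruct (Rlt_dec 0 t); [|lra]. simpl.
  pose proof (exp_pos (- / t)). lra.
Qed.

Lemma flat_zero k t : t <= 0 -> flat k t = 0.
Proof. intros Ht. unfold flat. destruct (Rlt_dec 0 t); lra. Qed.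

Lemma exp_INR_mult n y : exp (INR n * y) = exp y ^ n.
Proof.
  induction n as [|n IH]; [rewrite Rmult_0_l; apply exp_0|].
  rewrite S_INR, Rmult_plus_distr_r, exp_plus, IH, Rmult_1_l. simpl. ring.
Qed.

(** Raise [y/(k+1) <= exp(y/(k+1))] to the power [k] and use [k y/(k+1) <= y]. The denominator
    [k + 1] instead of [k] includes [k = 0]. *)
Lemma pow_le_exp k y : 0 <= y -> y ^ k <= (INR k + 1) ^ k * exp y.
Proof.
  intros Hy. pose proof (pos_INR k).
  assert (Hz : 0 <= y / (INR k + 1)).
  { apply Rmult_le_pos; auto. left. apply Rinv_0_lt_compat. lra. }
  replace y with ((INR k + 1) * (y / (INR k + 1))) at 1 by (field; lra).
  rewrite Rpow_mult_distr. apply Rmult_le_compat_l; [apply pow_le; lra|].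
  apply Rle_trans with (exp (y / (INR k + 1)) ^ k).
  - apply pow_incr. split; auto. pose proof (exp_ineq1_le (y / (INR k + 1))). lra.
  - rewrite <- exp_INR_mult.
    assert (INR k * (y / (INR k + 1)) <= y).
    { replace y with ((INR k + 1) * (y / (INR k + 1))) at 2 by (field; lra). nra. }
    destruct H0 as [H0| ->]; [left; now apply exp_increasing|lra].
Qed.

Lemma flat_bound k t : flat k t <= (INR k + 1) ^ k.
Proof.
  unfold flat. destruct (Rlt_dec 0 t) as [Ht|Ht].
  - rewrite exp_Ropp. apply Rmult_le_reg_r with (exp (/ t)); [apply exp_pos|].
    rewrite Rmult_assoc, Rinv_l, Rmult_1_r by (pose proof (exp_pos (/ t)); lra).
    apply pow_le_exp. left. now apply Rinv_0_lt_compat.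
  - apply pow_le. pose proof (pos_INR k). lra.
Qed.

(** For [t > 0] this is the product rule. At 0 the quotient [flat k h / h] equals [h * flat (k+2) h]
    for [h > 0], which tends to 0 because [flat (k+2)] is bounded. *)
Lemma flat_derivative k t :
  derivable_pt_lim (flat k) t (- INR k * flat (S k) t + flat (S (S k)) t).
Proof.
  destruct (Rtotal_order t 0) as [Ht|[->|Ht]].
  - rewrite !flat_zero by lra. replace (- INR k * 0 + 0) with 0 by ring.
    apply is_derive_Reals. apply is_derive_ext_loc with (fun _ => 0).
    + exists (mkposreal (- t) ltac:(lra)). intros s Hs.
      unfold ball in Hs; simpl in Hs; unfold AbsRing_ball, abs, minus, plus, opp in Hs; simpl in Hs.
      apply Rabs_def2 in Hs. rewrite flat_zero; lra.
    + apply is_derive_Reals, derivable_pt_lim_const.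
  - rewrite !flat_zero by lra. replace (- INR k * 0 + 0) with 0 by ring.
    intros e He. pose (M := (INR (S (S k)) + 1) ^ S (S k)).
    assert (HM : 0 < M) by (apply pow_lt; pose proof (pos_INR (S (S k))); lra).
    assert (Hd : 0 < e / M) by now apply Rdiv_lt_0_compat.
    exists (mkposreal _ Hd). simpl. intros h Hh0 Hh.
    rewrite Rplus_0_l, (flat_zero k 0) by lra. rewrite !Rminus_0_r.
    destruct (Rlt_dec 0 h) as [Hp|Hn].
    + pose proof (flat_bound (S (S k)) h) as Hb. fold M in Hb.
      assert (Heq : flat k h / h = h * flat (S (S k)) h).
      { unfold flat. destruct (Rlt_dec 0 h); [|lra]. simpl. field. lra. }
      rewrite Heq. pose proof (flat_nonneg (S (S k)) h).
      rewrite Rabs_pos_eq by nra. rewrite Rabs_pos_eq in Hh by lra.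
      apply Rle_lt_trans with (h * M); [nra|].
      replace e with (e / M * M) by (field; lra). nra.
    + rewrite flat_zero by lra. unfold Rdiv. rewrite Rmult_0_l, Rabs_R0. auto.
  - apply is_derive_Reals.
    apply is_derive_ext_loc with (fun s => (/ s) ^ k * exp (- / s)).
    + exists (mkposreal t Ht). intros s Hs.
      unfold ball in Hs; simpl in Hs; unfold AbsRing_ball, abs, minus, plus, opp in Hs; simpl in Hs.
      apply Rabs_def2 in Hs. unfold flat. destruct (Rlt_dec 0 s); lra.
    + unfold flat. destruct (Rlt_dec 0 t); [|lra].
      auto_derive; [repeat split; lra|].
      destruct k as [|k]; simpl; field; lra.
Qed.

Definition cutoff (q : R) : R := flat 0 (2 - q) * / (flat 0 (2 - q) + flat 0 (q - 1)).

Lemma cutoff_denominator q : 0 < flat 0 (2 - q) + flat 0 (q - 1).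
Proof.
  pose proof (flat_nonneg 0 (2 - q)). pose proof (flat_nonneg 0 (q - 1)).
  destruct (Rlt_dec q 2) as [H1|H1].
  - pose proof (flat_pos (2 - q) ltac:(lra)). lra.
  - pose proof (flat_pos (q - 1) ltac:(lra)). lra.
Qed.

Lemma cutoff_one q : q <= 1 -> cutoff q = 1.
Proof.
  intros Hq. pose proof (cutoff_denominator q). unfold cutoff in *.
  rewrite (flat_zero 0 (q - 1)) in * by lra. field. lra.
Qed.

Lemma cutoff_zero q : 2 <= q -> cutoff q = 0.
Proof. intros Hq. unfold cutoff. rewrite flat_zero by lra. ring. Qed.

Lemma cutoff_range q : 0 <= cutoff q <= 1.
Proof.
  unfold cutoff. pose proof (cutoff_denominator q) as H.
  pose proof (flat_nonneg 0 (2 - q)). pose proof (flat_nonneg 0 (q - 1)).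
  split.
  - apply Rmult_le_pos; auto. left. now apply Rinv_0_lt_compat.
  - apply Rmult_le_reg_r with (1 := H). rewrite Rmult_assoc, Rinv_l by lra. lra.
Qed.

Lemma smooth_net_cutoff {m : nat} (O K : pt m -> Prop) e0 (q : pt m -> R) :
  is_compact K -> smooth_net O K e0 (fun _ => q) -> cont_on K q ->
  smooth_net O K e0 (fun _ x => cutoff (q x)).
Proof.
  intros HK Hq Hc.
  assert (Hflat : forall a b, smooth_net O K e0 (fun _ x => flat 0 (a + b * q x))).
  { intros a b. apply (smooth_net_comp_seq O K e0 flat (fun _ x => a + b * q x)).
    - intros k. exists ((INR k + 1) ^ k). intros t.
      rewrite Rabs_pos_eq by apply flat_nonneg. apply flat_bound.
    - apply flat_derivative.
    - apply (smooth_net_plus O K e0 (fun _ _ => a) (fun _ x => b * q x)).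
      + apply smooth_net_const.
      + apply (smooth_net_mult O K e0 (fun _ _ => b) (fun _ => q)); auto using smooth_net_const. }
  assert (Heq : forall x, cutoff (q x) = flat 0 (2 + -1 * q x) *
    / (flat 0 (2 + -1 * q x) + flat 0 (-1 + 1 * q x))).
  { intros x. replace (2 + -1 * q x) with (2 - q x) by ring.
    now replace (-1 + 1 * q x) with (q x - 1) by ring. }
  replace (fun (_ : R) x => cutoff (q x)) with (fun (_ : R) x => flat 0 (2 + -1 * q x) *
    / (flat 0 (2 + -1 * q x) + flat 0 (-1 + 1 * q x)))
    by (do 2 (apply functional_extensionality; intros); now rewrite Heq).
  assert (Hpos : forall x, 0 < flat 0 (2 + -1 * q x) + flat 0 (-1 + 1 * q x)).
  { intros x. replace (2 + -1 * q x) with (2 - q x) by ring.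
    replace (-1 + 1 * q x) with (q x - 1) by ring. apply cutoff_denominator. }
  assert (Hcont : forall a b, cont_on K (fun x => flat 0 (a + b * q x))).
  { intros a b. apply (cont_on_comp K (fun x => a + b * q x) (flat 0)).
    - apply cont_on_plus; [apply cont_on_const|now apply cont_on_scal].
    - intros. apply derivable_continuous_pt. eexists. apply flat_derivative. }
  (* The denominator of the cutoff is positive and independent of [eps], so a minimum on [K] bounds
     it below with exponent 0. *)
  assert (Hmin : exists c, 0 < c /\ forall x, K x ->
    c <= flat 0 (2 + -1 * q x) + flat 0 (-1 + 1 * q x)).
  { destruct (classic (exists z, K z)) as [[z Hz]|Hn].
    - destruct (compact_min K (fun x => flat 0 (2 + -1 * q x) + flat 0 (-1 + 1 * q x)) z HK Hz)
        as [x [Hx H]].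
      + now apply cont_on_plus.
      + eexists. split; [apply (Hpos x)|auto].
    - exists 1. split; [lra|]. intros x Hx. exfalso. apply Hn. now exists x. }
  destruct Hmin as [c [Hc0 Hmin]].
  apply smooth_net_mult; auto.
  apply smooth_net_inv with 0%nat c 1; try lra.
  - now apply smooth_net_plus.
  - intros e _ x _. pose proof (Hpos x). lra.
  - intros e _ _ x Hx. simpl. rewrite Rmult_1_r, Rabs_pos_eq by (left; apply Hpos). auto.
Qed.

(** * Families of derivatives and nets of push-forwards *)

Lemma smooth_net_of_family {m : nat} (U O K : pt m -> Prop) e0
  (D : R -> list (Fin.t m) -> pt m -> R) (f : R -> pt m -> R) al :
  e0 <= 1 -> subset O U ->
  (forall e, 0 < e <= 1 -> deriv_family U (f e) (D e)) ->
  (forall al, exists (N : nat) (C e1 : R), 0 < e1 /\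
     forall e, 0 < e <= e1 -> e <= 1 -> forall x, K x -> Rabs (D e al x) <= C * / e ^ N) ->
  smooth_net O K e0 (fun e => D e al).
Proof.
  intros He0 HOU HD HC. exists (fun u => exists al, u = fun e => D e al).
  split; [now exists al|]. clear al. intros u [al ->]. split; [split|].
  - intros e He. apply cont_on_sub with U; auto. apply (HD e ltac:(lra)).
  - destruct (HC al) as [N [C [e1 [He1 H]]]]. exists N, C, (Rmin e1 1).
    split; [split; [apply Rmin_pos; lra|apply Rmin_r]|].
    intros e He Hee. pose proof (Rmin_l e1 1). apply H; lra.
  - intros i. exists (fun e => D e (i :: al)). split; [|now exists (i :: al)].
    intros e He x Hx. apply (HD e ltac:(lra)). auto.
Qed.

(** A derivative that is again a smooth net is chosen once for every pair of a smooth net and a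
    direction; recursion on the multi-index then makes the choices for different multi-indices
    coherent. *)
Lemma family_of_smooth_net {m : nat} (u : R -> pt m -> R) :
  smooth_net fullset fullset 1 u ->
  exists D : R -> list (Fin.t m) -> pt m -> R,
    (forall e, 0 < e <= 1 -> deriv_family fullset (u e) (D e)) /\
    forall al, exists (N : nat) (C e1 : R), 0 < e1 /\
      forall e, 0 < e <= e1 -> e <= 1 -> forall x, Rabs (D e al x) <= C * / e ^ N.
Proof.
  intros Hu.
  destruct (fun_choice (fun (w : {u | smooth_net fullset fullset 1 u} * Fin.t m)
    (w' : {u | smooth_net fullset fullset 1 u}) =>
    partial_net fullset 1 (snd w) (proj1_sig (fst w)) (proj1_sig w'))) as [nxt Hnxt].
  { intros [[v Hv] i]. destruct (smooth_net_unfold _ _ _ v Hv) as [_ Hp].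
    destruct (Hp i) as [v' [H Hv']]. now exists (exist _ v' Hv'). }
  pose (D := fix D (al : list (Fin.t m)) : {u | smooth_net fullset fullset 1 u} :=
    match al with [] => exist _ u Hu | i :: al' => nxt (D al', i) end).
  exists (fun e al => proj1_sig (D al) e). split.
  - intros e He. split; [|split].
    + reflexivity.
    + intros al. destruct (smooth_net_unfold _ _ _ _ (proj2_sig (D al))) as [[H _] _]. auto.
    + intros al i x Hx. apply (Hnxt (D al, i)); auto.
  - intros al. destruct (smooth_net_unfold _ _ _ _ (proj2_sig (D al))) as [[_ H] _].
    destruct H as [N [C [r [Hr H]]]]. exists N, C, r. split; [lra|].
    intros e He He1 x. now apply H.
Qed.

Lemma moderate_of_smooth_net {m k : nat} (u : net m k) :
  (forall j, smooth_net fullset fullset 1 (fun e x => u e x j)) -> moderate fullset u.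
Proof.
  intros H.
  destruct (fun_choice _ (fun j => family_of_smooth_net _ (H j))) as [D HD].
  exists (fun e j => D j e). split.
  - intros e He j. now apply HD.
  - intros K HK _ j al. destruct (HD j) as [_ H'].
    destruct (H' al) as [N [C [e1 [He1 HC]]]]. exists N, C, e1. split; auto.
Qed.

(** For [e > e0] injectivity is not assured; the value 0 there keeps the net smooth for every [eps]
    in (0,1], as [moderate] demands. *)
Definition push_net {m : nat} (e0 : R) (O : pt m -> Prop) (f : R -> pt m -> pt m)
  (F : R -> pt m -> R) : R -> pt m -> R :=
  fun e y => if Rle_dec e e0 then push O (f e) (F e) y else 0.

Lemma push_net_smooth {m : nat} (O K : pt m -> Prop) e0 (f : R -> pt m -> pt m)
  (J Ji : R -> pt m -> Fin.t m -> Fin.t m -> R) F :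
  is_open O -> is_compact K -> is_closed K -> subset K O ->
  (forall e, 0 < e <= e0 -> inj_on O (f e)) ->
  (forall e, 0 < e <= e0 -> forall j, cont_on O (fun x => f e x j)) ->
  (forall e, 0 < e <= e0 -> forall j i, cont_on O (fun x => J e x j i)) ->
  (forall e, 0 < e <= e0 -> forall j i x, O x ->
     partial_at (fun x => f e x j) i x (J e x j i)) ->
  (forall e, 0 < e <= e0 -> forall x, O x -> inverse_mx (J e x) (Ji e x)) ->
  (forall i j, smooth_net O K e0 (fun e x => Ji e x i j)) ->
  smooth_net O K e0 F ->
  (forall e, 0 < e <= e0 -> forall x, O x -> ~ K x -> F e x = 0) ->
  smooth_net fullset fullset 1 (push_net e0 O f F).
Proof.
  intros HO HK HKc HKO Hinj Hf HcJ Hp HJ HJi HF HF0.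
  (* The coinductive invariant: push-forwards of smooth nets that vanish off [K]. By [push_partial]
     a derivative is the push-forward of [sum_i DF_i Ji_ij], again of this kind. *)
  exists (fun u => exists F, u = push_net e0 O f F /\ smooth_net O K e0 F /\
    forall e, 0 < e <= e0 -> forall x, O x -> ~ K x -> F e x = 0).
  split; [now exists F|]. clear F HF HF0. intros u [F [-> [HF HF0]]].
  destruct (smooth_net_unfold O K e0 F HF) as [[HFc [N [C [r [Hr HFb]]]]] HFp].
  split; [split|].
  - intros e He. unfold push_net. destruct (Rle_dec e e0) as [Hee|Hee].
    + apply (push_continuous O K (f e) (J e) (Ji e)); intuition.
    + apply cont_on_const.
  - exists N, (Rabs C), r. split; auto. intros e He _ y _. unfold push_net.
    assert (HCe : 0 <= Rabs C * / e ^ N).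
    { apply Rmult_le_pos; [apply Rabs_pos|]. left. apply Rinv_0_lt_compat, pow_lt. lra. }
    destruct (Rle_dec e e0) as [Hee|Hee]; [|now rewrite Rabs_R0].
    apply push_bound with K; auto.
    + intros x Hx. apply Rle_trans with (1 := HFb e He Hee x Hx).
      apply Rmult_le_compat_r; [|apply Rle_abs]. left. apply Rinv_0_lt_compat, pow_lt. lra.
    + apply HF0. lra.
  - intros j. destruct (fun_choice _ HFp) as [DF HDF].
    (* The complement of the closed set [K] is open, so [F] vanishes near each point of [O] outside
       [K] and its derivatives vanish there too. *)
    assert (HDF0 : forall i e, 0 < e <= e0 -> forall x, O x -> ~ K x -> DF i e x = 0).
    { intros i e He x Hx Hk. apply (partial_at_unique (F e) i x).
      - now apply HDF.
      - destruct (HO x Hx) as [d [Hd HdO]]. destruct (HKc x Hk) as [d' [Hd' HdK]].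
        apply partial_at_local with (fun _ => 0) (Rmin d d'); [now apply Rmin_pos| |].
        + intros y Hy. symmetry. apply HF0; auto.
          * apply HdO, dist_lt_le with (1 := Hy), Rmin_l.
          * apply HdK, dist_lt_le with (1 := Hy), Rmin_r.
        + apply partial_at_const. }
    exists (push_net e0 O f (fun e x => sumF (fun i => DF i e x * Ji e x i j))). split.
    + intros e He y _. unfold push_net. destruct (Rle_dec e e0) as [Hee|Hee].
      * apply (push_partial O K (f e) (J e) (Ji e)); intuition.
        -- destruct (HDF i) as [_ Hs]. apply (smooth_net_unfold _ _ _ _ Hs). lra.
        -- apply HDF; auto.
      * apply partial_at_const.
    + eexists. split; [reflexivity|]. split.
      * apply (smooth_net_sumL O K e0 (fins m) (fun i e x => DF i e x * Ji e x i j)).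
        intros i. apply smooth_net_mult; [apply HDF|apply HJi].
      * intros e He x Hx Hk. apply sumL_zero. intros i _. rewrite HDF0 by auto. ring.
Qed.

(** * Cramer's rule *)

Module Determinant.
Import all_boot all_algebra Rstruct.
Import GRing.Theory.
Local Open Scope ring_scope.
Delimit Scope R_scope with coqR.

Definition fin_of_ord (m : nat) (i : 'I_m) : Fin.t m := Fin.of_nat_lt (ltP (ltn_ord i)).

Lemma val_fin_of_ord (m : nat) (i : 'I_m) : proj1_sig (Fin.to_nat (fin_of_ord m i)) = i :> nat.
Proof. by rewrite /fin_of_ord Fin.to_nat_of_nat. Qed.

Definition ord_of_fin (m : nat) (i : Fin.t m) : 'I_m :=
  Ordinal (introT ltP (proj2_sig (Fin.to_nat i))).

Lemma ord_of_finK (m : nat) (i : Fin.t m) : fin_of_ord m (ord_of_fin m i) = i.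
Proof. by apply: Fin.to_nat_inj; rewrite val_fin_of_ord. Qed.

Lemma fin_of_ordK (m : nat) (i : 'I_m) : ord_of_fin m (fin_of_ord m i) = i.
Proof. by apply: val_inj; rewrite /= val_fin_of_ord. Qed.

Lemma sumR_big (n : nat) (f : nat -> R) : sumR n f = \sum_(i < n) f i.
Proof.
  elim: n => [|n IH] /=; first by rewrite big_ord0.
  by rewrite big_ord_recr /= IH.
Qed.

Lemma detn_det (m : nat) (M : nat -> nat -> R) :
  detn m M = \det (\matrix_(i < m, j < m) M i j).
Proof.
  elim: m M => [|m IH] M; first by rewrite det_mx00.
  rewrite (expand_det_row _ ord0). cbn [detn]. rewrite sumR_big.
  apply: eq_bigr => j _. rewrite mxE /cofactor IH add0n.
  have -> : row' ord0 (col' j (\matrix_(i0 < m.+1, j0 < m.+1) M i0 j0))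
    = \matrix_(i0 < m, j0 < m) minor M j i0 j0.
  { apply/matrixP => i k. rewrite !mxE /minor /= /bump.
    case: (Nat.ltb_spec k j) => [/ltP|/leP] h; last by rewrite h.
    by move: (h); rewrite ltnNge => /negbTE ->. }
  rewrite RpowE !RmultE mulrA. congr (_ * _). by rewrite mulrC.
Qed.

Definition mx_of (m : nat) (a : Fin.t m -> Fin.t m -> R) : 'M[R]_m :=
  \matrix_(i, j) a (fin_of_ord m i) (fin_of_ord m j).

Lemma of_nat_ord (m : nat) (i : 'I_m) : Fin.of_nat i m = inleft (fin_of_ord m i).
Proof.
  exact: of_nat_of_nat_lt.
Qed.

Lemma detF_det (m : nat) (a : Fin.t m -> Fin.t m -> R) : detF a = \det (mx_of m a).
Proof.
  rewrite /detF detn_det. congr (\det _). apply/matrixP => i j.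
  by rewrite !mxE !of_nat_ord.
Qed.

Lemma sumF_big (m : nat) (F : Fin.t m -> R) : sumF F = \sum_(i < m) F (fin_of_ord m i).
Proof.
  elim: m F => [|m IH] F; first by rewrite big_ord0.
  rewrite sumF_S big_ord_recl IH. congr (_ + _).
  apply: eq_bigr => i _. congr F. apply: Fin.to_nat_inj.
  by rewrite to_nat_FS !val_fin_of_ord.
Qed.

Section Nets.
Context {m : nat} (O K : pt m -> Prop) (e0 : R).

Lemma smooth_net_big_sum (I : Type) (r : seq I) (u : I -> R -> pt m -> R) :
  (forall i, smooth_net O K e0 (u i)) ->
  smooth_net O K e0 (fun e x => \sum_(i <- r) u i e x).
Proof.
  move=> H; elim: r => [|i r IH].
  - have -> : (fun e x => \sum_(i <- [::]) u i e x) = fun _ _ => 0.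
      by do 2!apply: functional_extensionality => ?; rewrite big_nil.
    exact: smooth_net_const.
  - have -> : (fun e x => \sum_(i <- i :: r) u i e x)
      = fun e x => Rplus (u i e x) (\sum_(i <- r) u i e x).
      by do 2!apply: functional_extensionality => ?; rewrite big_cons.
    exact: smooth_net_plus.
Qed.

Lemma smooth_net_big_prod (I : Type) (r : seq I) (u : I -> R -> pt m -> R) :
  (forall i, smooth_net O K e0 (u i)) ->
  smooth_net O K e0 (fun e x => \prod_(i <- r) u i e x).
Proof.
  move=> H; elim: r => [|i r IH].
  - have -> : (fun e x => \prod_(i <- [::]) u i e x) = fun _ _ => 1.
      by do 2!apply: functional_extensionality => ?; rewrite big_nil.
    exact: smooth_net_const.
  - have -> : (fun e x => \prod_(i <- i :: r) u i e x)
      = fun e x => Rmult (u i e x) (\prod_(i <- r) u i e x).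
      by do 2!apply: functional_extensionality => ?; rewrite big_cons.
    exact: smooth_net_mult.
Qed.

(** By the Leibniz formula the determinant is a polynomial in the entries. *)
Lemma smooth_net_det (n : nat) (A : R -> pt m -> 'M[R]_n) :
  (forall i j, smooth_net O K e0 (fun e x => A e x i j)) ->
  smooth_net O K e0 (fun e x => \det (A e x)).
Proof.
  move=> HA. rewrite /determinant.
  apply: smooth_net_big_sum => s. apply: smooth_net_mult; first exact: smooth_net_const.
  exact: smooth_net_big_prod.
Qed.

Lemma smooth_net_adj (n : nat) (A : R -> pt m -> 'M[R]_n) i j :
  (forall i j, smooth_net O K e0 (fun e x => A e x i j)) ->
  smooth_net O K e0 (fun e x => (\adj (A e x)) i j).
Proof.
  move=> HA.
  have -> : (fun e x => (\adj (A e x)) i j)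
    = fun e x => Rmult ((-1) ^+ (j + i)) (\det (row' j (col' i (A e x)))).
    by do 2!apply: functional_extensionality => ?; rewrite mxE.
  apply: smooth_net_mult; first exact: smooth_net_const.
  apply: smooth_net_det => k l.
  have -> : (fun e x => row' j (col' i (A e x)) k l) = fun e x => A e x (lift j k) (lift i l).
    by do 2!apply: functional_extensionality => ?; rewrite !mxE.
  exact: HA.
Qed.

End Nets.

(** [b] is the adjugate divided by the determinant. A nonzero determinant on [O] gives the matrix
    identities there; the lower bound by a power of [eps] enters on [K], where moderate bounds are
    asked. *)
Lemma smooth_net_inverse (m : nat) (O K : pt m -> Prop) (e0 : R)
  (a : R -> pt m -> Fin.t m -> Fin.t m -> R) (N : nat) (c r : R) :
  (forall i j, smooth_net O K e0 (fun e x => a e x i j)) ->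
  (forall e, (0 < e <= e0)%coqR -> forall x, O x -> detF (a e x) <> 0%coqR) ->
  (0 < c)%coqR -> (0 < r <= 1)%coqR ->
  (forall e, (0 < e <= r)%coqR -> (e <= e0)%coqR -> forall x, K x ->
     (c * e ^ N <= Rabs (detF (a e x)))%coqR) ->
  exists b : R -> pt m -> Fin.t m -> Fin.t m -> R,
    (forall i j, smooth_net O K e0 (fun e x => b e x i j)) /\
    forall e, (0 < e <= e0)%coqR -> forall x, O x -> inverse_mx (a e x) (b e x).
Proof.
  move=> Ha Hdet Hc Hr Hb.
  pose A e x := mx_of m (a e x).
  have HA : forall i j, smooth_net O K e0 (fun e x => A e x i j).
  { move=> i j. have -> : (fun e x => A e x i j)
      = fun e x => a e x (fin_of_ord m i) (fin_of_ord m j).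
      by do 2!apply: functional_extensionality => ?; rewrite mxE.
    exact: Ha. }
  pose b e x i j := Rmult (Rinv (\det (A e x))) ((\adj (A e x)) (ord_of_fin m i) (ord_of_fin m j)).
  have Hkron i j : kron i j = (1%:M : 'M[R]_m) (ord_of_fin m i) (ord_of_fin m j).
  { rewrite mxE /kron. case: Fin.eq_dec => [->|H]; first by rewrite eqxx.
    case: eqP => // H'. by case: H; rewrite -(ord_of_finK m i) H' ord_of_finK. }
  exists b; split=> [i j|e He x Hx].
  - apply: smooth_net_mult; last exact: smooth_net_adj.
    apply: (smooth_net_inv _ _ _ _ N c r) => //.
    + exact: smooth_net_det.
    + move=> e He x Hx. rewrite -detF_det. exact: Hdet.
    + move=> e He Hee x Hx. rewrite -detF_det. exact: Hb.
  - have Hd : \det (A e x) != 0 by apply/eqP; rewrite -detF_det; apply: Hdet.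
    split=> j k; rewrite sumF_big Hkron.
    + transitivity (((\det (A e x))^-1 *: (A e x *m \adj (A e x))) (ord_of_fin m j) (ord_of_fin m k)).
      * rewrite mxE mxE mulr_sumr. apply: eq_bigr => i _.
        rewrite /b fin_of_ordK [A e x _ i]mxE ord_of_finK !RmultE RinvE mulrCA //.
      * by rewrite mul_mx_adj scale_scalar_mx mulVf.
    + transitivity (((\det (A e x))^-1 *: (\adj (A e x) *m A e x)) (ord_of_fin m j) (ord_of_fin m k)).
      * rewrite mxE mxE mulr_sumr. apply: eq_bigr => i _.
        rewrite /b fin_of_ordK [A e x i _]mxE ord_of_finK !RmultE RinvE mulrA //.
      * by rewrite mul_adj_mx scale_scalar_mx mulVf.
Qed.

End Determinant.

(** The adjugate formula, read off the constant net with matrix [J] at [eps = 1], provides an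
    inverse. *)
Lemma det_nondegenerate {m : nat} (J : Fin.t m -> Fin.t m -> R) :
  detF J <> 0 -> nondegenerate J.
Proof.
  intros HJ.
  destruct (Determinant.smooth_net_inverse m fullset fullset 1 (fun _ _ => J) 0
    (Rabs (detF J)) 1) as [Ji [_ H]]; try lra; auto.
  - intros. apply smooth_net_const.
  - now apply Rabs_pos_lt.
  - intros. simpl. lra.
  - apply inverse_nondegenerate with (Ji 1 (fun _ => 0)). apply H; [lra|exact I].
Qed.

(** * The left inverse *)

Definition quad {m : nat} (p w : pt m) (x : pt m) : R :=
  sumF (fun i => w i * ((x i - p i) * (x i - p i))).

Lemma quad_term {m : nat} (p w x : pt m) i :
  (forall i, 0 < w i) -> w i * ((x i - p i) * (x i - p i)) <= quad p w x.
Proof.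
  intros Hw. apply (sumL_term_le (fins m) (fun i => w i * ((x i - p i) * (x i - p i)))).
  - intros j _. apply Rmult_le_pos; [left; apply Hw|apply Rle_0_sqr].
  - apply in_fins.
Qed.

Lemma quad_continuous {m : nat} (U : pt m -> Prop) (p w : pt m) : cont_on U (quad p w).
Proof.
  apply (cont_on_sumL U (fins m) (fun i x => w i * ((x i - p i) * (x i - p i)))).
  intros i. apply cont_on_scal.
  apply (cont_on_comp U (fun x => x i) (fun s => (s - p i) * (s - p i))).
  - apply cont_on_coord.
  - intros. reg.
Qed.

Lemma quad_center {m : nat} (p w : pt m) : quad p w p = 0.
Proof. apply sumL_zero. intros. ring. Qed.

Lemma quad_scale {m : nat} (p w x : pt m) c :
  quad p w (fun j => p j + c * (x j - p j)) = c * c * quad p w x.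
Proof.
  unfold quad, sumF. rewrite <- sumL_scal. apply sumL_ext. intros. ring.
Qed.

Lemma quad_bounded {m : nat} (p w : pt m) c :
  (forall i, 0 < w i) -> is_bounded (fun x => quad p w x <= c).
Proof.
  intros Hw.
  destruct (common_radius_fin (fun i r => r <= w i)) as [r [Hr Hrw]].
  { intros. lra. }
  { intros i. exists (w i). split; [auto|lra]. }
  (* The inequality [|z| <= 1 + z^2] takes the place of a square root in this radius. *)
  apply closed_subset_bounded with (cbox p (fun _ => 1 + Rabs c / r)); [|apply cbox_bounded].
  intros x Hx i. pose proof (quad_term p w x i Hw) as H.
  assert (Hsq : r * ((x i - p i) * (x i - p i)) <= Rabs c).
  { pose proof (Rle_abs c).
    apply Rle_trans with (w i * ((x i - p i) * (x i - p i))); [|lra].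
    apply Rmult_le_compat_r; [apply Rle_0_sqr|auto]. }
  assert ((x i - p i) * (x i - p i) <= Rabs c / r).
  { apply Rmult_le_reg_l with (1 := Hr).
    replace (r * (Rabs c / r)) with (Rabs c) by (field; lra). auto. }
  pose proof (Rle_0_sqr (x i - p i - 1)) as H1. pose proof (Rle_0_sqr (x i - p i + 1)) as H2.
  unfold Rsqr in *. apply Rabs_le. lra.
Qed.

Lemma quad_closed {m : nat} (p w : pt m) c : is_closed (fun x => quad p w x <= c).
Proof. apply closed_preimage, quad_continuous. Qed.

Lemma quad_compact {m : nat} (p w : pt m) c :
  (forall i, 0 < w i) -> is_compact (fun x => quad p w x <= c).
Proof.
  intros Hw. apply closed_bounded_compact; [apply quad_closed|now apply quad_bounded].
Qed.

Lemma quad_open {m : nat} (p w : pt m) c : is_open (fun x => quad p w x < c).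
Proof.
  intros x Hx. destruct (quad_continuous fullset p w x I (c - quad p w x)) as [d [Hd H]]; [lra|].
  exists d. split; auto. intros y Hy. specialize (H y I Hy). apply Rabs_def2 in H. lra.
Qed.

Lemma quad_smooth_net {m : nat} (O K : pt m -> Prop) e0 (p w : pt m) :
  is_bounded K -> smooth_net O K e0 (fun _ => quad p w).
Proof.
  intros HK.
  assert (Hx : forall i, smooth_net O K e0 (fun _ x => x i - p i)).
  { intros i. apply (smooth_net_plus O K e0 (fun _ x => x i) (fun _ _ => - p i)).
    - now apply smooth_net_coord.
    - apply smooth_net_const. }
  apply (smooth_net_sumL O K e0 (fins m) (fun i _ x => w i * ((x i - p i) * (x i - p i)))).
  intros i.
  apply (smooth_net_mult O K e0 (fun _ _ => w i) (fun _ x => (x i - p i) * (x i - p i))).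
  - apply smooth_net_const.
  - apply (smooth_net_mult O K e0 (fun _ x => x i - p i) (fun _ x => x i - p i)); auto.
Qed.

(* Composing with the inverse the compactly supported map [cutoff * (x - p)],
   rather than cutting off in the target, needs no common domain for the
   inverses: the extension by zero is smooth whatever the images are. *)
Lemma local_left_inverse {m : nat} (U : pt m -> Prop) (t : net m m) (p w : pt m) e0 c (N : nat) :
  is_open U -> moderate U t -> (forall i, 0 < w i) -> 0 < e0 <= 1 -> 0 < c ->
  subset (fun x => quad p w x < 3) U ->
  (forall e, 0 < e <= e0 -> inj_on (fun x => quad p w x < 3) (t e)) ->
  (forall e, 0 < e <= e0 -> forall x, quad p w x < 3 -> jacdet_ge (t e) x (c * e ^ N)) ->
  exists v : net m m,
    cbounded_net fullset (fun x => quad p w x < 3) v /\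
    forall e, 0 < e <= e0 -> forall x, quad p w x <= 1 -> v e (t e x) = x.
Proof.
  intros HU [D [HD HDb]] Hw He0 Hc HOU Hinj Hdet.
  set (O := fun x => quad p w x < 3) in *.
  set (K := fun x => quad p w x <= 2).
  assert (HO : is_open O) by apply quad_open.
  assert (HK : is_compact K) by now apply quad_compact.
  assert (HKO : subset K O) by (intros x; unfold K, O; lra).
  assert (HDs : forall j al, smooth_net O K e0 (fun e => D e j al)).
  { intros j al. apply (smooth_net_of_family U O K e0 (fun e => D e j) (fun e x => t e x j)).
    - lra.
    - auto.
    - intros e He. now apply HD.
    - intros al'. apply HDb; auto. intros x Hx. auto. }
  assert (Hpart : forall e, 0 < e <= e0 -> forall j i x, O x ->
    partial_at (fun x => t e x j) i x (D e j [i] x)).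
  { intros e He j i x Hx. destruct (HD e ltac:(lra) j) as [H0 [_ H1]].
    apply partial_at_open with U (D e j []); auto. }
  (* [jacdet_ge] provides some matrix of partial derivatives; uniqueness of partial derivatives
     identifies it with the one from the moderate family [D]. *)
  assert (Hge : forall e, 0 < e <= e0 -> forall x, O x ->
    c * e ^ N <= Rabs (detF (fun j i => D e j [i] x))).
  { intros e He x Hx. destruct (Hdet e He x Hx) as [J [HJ Hle]].
    replace (fun j i => D e j [i] x) with J; auto.
    do 2 (apply functional_extensionality; intros).
    eapply partial_at_unique; [apply HJ|now apply Hpart]. }
  assert (Hpos : forall e, 0 < e -> 0 < c * e ^ N).
  { intros e He. apply Rmult_lt_0_compat; auto. now apply pow_lt. }
  destruct (Determinant.smooth_net_inverse m O K e0 (fun e x j i => D e j [i] x) N c 1)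
    as [Ji [HJi Hinv]]; auto; try lra.
  { intros e He x Hx H0. pose proof (Hge e He x Hx) as H. rewrite H0, Rabs_R0 in H.
    pose proof (Hpos e ltac:(lra)). lra. }
  { intros e He Hee x Hx. apply Hge; auto. lra. }
  pose (F := fun j (_ : R) (x : pt m) => cutoff (quad p w x) * (x j - p j)).
  assert (HF : forall j, smooth_net fullset fullset 1 (push_net e0 O t (F j))).
  { intros j. apply push_net_smooth with K (fun e x j i => D e j [i] x) Ji; auto.
    - apply quad_closed.
    - intros e He k. apply cont_on_sub with U; auto.
      destruct (HD e ltac:(lra) k) as [H0 [H1 _]]. now apply cont_on_ext with (D e k []).
    - intros e He k i. apply cont_on_sub with U; auto. apply (HD e ltac:(lra) k).
    - apply (smooth_net_mult O K e0 (fun _ x => cutoff (quad p w x)) (fun _ x => x j - p j)).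
      + apply smooth_net_cutoff; auto.
        * apply quad_smooth_net. now apply quad_bounded.
        * apply quad_continuous.
      + apply (smooth_net_plus O K e0 (fun _ x => x j) (fun _ _ => - p j)).
        * apply smooth_net_coord. now apply quad_bounded.
        * apply smooth_net_const.
    - intros e He x _ Hx. unfold F, K in *. rewrite cutoff_zero by lra. ring. }
  pose (v := fun e y j => p j + push_net e0 O t (F j) e y).
  assert (Hv : forall e, 0 < e <= e0 -> forall x, O x ->
    v e (t e x) = fun j => p j + cutoff (quad p w x) * (x j - p j)).
  { intros e He x Hx. apply functional_extensionality. intros j. unfold v, push_net.
    destruct (Rle_dec e e0); [|lra]. rewrite push_image; auto. }
  (* The point [p + chi (x - p)] has [q]-value [chi^2 q(x)] with [0 <= chi <= 1], hence at most 2
     when [q(x) < 2]; for [q(x) >= 2], off the image and for [e > e0] the value of [v] is [p]. *)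
  assert (HvK : forall e, 0 < e -> forall y, K (v e y)).
  { intros e He y. destruct (Rle_dec e e0) as [Hee|Hee].
    - destruct (classic (exists x, O x /\ t e x = y)) as [[x [Hx <-]]|Hn].
      + rewrite Hv by auto. unfold K. rewrite quad_scale.
        assert (0 <= quad p w x).
        { apply sumL_nonneg. intros i _. apply Rmult_le_pos; [left; apply Hw|apply Rle_0_sqr]. }
        destruct (Rle_dec 2 (quad p w x)).
        * rewrite cutoff_zero by auto. lra.
        * pose proof (cutoff_range (quad p w x)). nra.
      + unfold K. replace (v e y) with p; [rewrite quad_center; lra|].
        apply functional_extensionality. intros j. unfold v, push_net.
        destruct (Rle_dec e e0); [|lra]. rewrite push_outside by auto. ring.
    - unfold K. replace (v e y) with p; [rewrite quad_center; lra|].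
      apply functional_extensionality. intros j. unfold v, push_net.
      destruct (Rle_dec e e0); [lra|ring]. }
  exists v. split; [split; [|split]|].
  - apply moderate_of_smooth_net. intros j.
    apply (smooth_net_plus fullset fullset 1 (fun _ _ => p j) (push_net e0 O t (F j))); auto.
    apply smooth_net_const.
  - exists 1. split; [lra|]. intros e He y _. apply HKO, HvK. lra.
  - intros K' _ _. exists K. split; [auto|]. split; [auto|]. exists 1. split; [lra|].
    intros e He _ y _. apply HvK. lra.
  - intros e He x Hx. rewrite Hv; auto.
    + rewrite cutoff_one by auto. apply functional_extensionality. intros. ring.
    + unfold O. lra.
Qed.

(** * Coordinates in [(-a, b) x R^n x R] *)

Definition idx {m : nat} (i : Fin.t m) : nat := proj1_sig (Fin.to_nat i).

Lemma idx_lt {m : nat} (i : Fin.t m) : (idx i < m)%nat.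
Proof. exact (proj2_sig (Fin.to_nat i)). Qed.

Lemma idx_of_nat_lt {m k : nat} (H : (k < m)%nat) : idx (Fin.of_nat_lt H) = k.
Proof. unfold idx. now rewrite Fin.to_nat_of_nat. Qed.

Lemma fcoord_lt {m k : nat} (x : pt m) (H : (k < m)%nat) : fcoord x k = x (Fin.of_nat_lt H).
Proof. unfold fcoord. now rewrite (of_nat_of_nat_lt H). Qed.

Lemma fcoord_idx {m : nat} (x : pt m) (i : Fin.t m) : fcoord x (idx i) = x i.
Proof. rewrite (fcoord_lt x (idx_lt i)). f_equal. apply Fin.to_nat_inj, (idx_of_nat_lt (idx_lt i)). Qed.

Definition last_fin (n : nat) : Fin.t (S (S n)) := Fin.of_nat_lt (PeanoNat.Nat.lt_succ_diag_r (S n)).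

Lemma idx_last (n : nat) : idx (last_fin n) = S n.
Proof. apply idx_of_nat_lt. Qed.

Lemma F1_neq_last (n : nat) : Fin.F1 <> last_fin n.
Proof. intros H. pose proof (idx_last n) as H'. now rewrite <- H in H'. Qed.

Lemma idx_F1_or_succ {m : nat} (i : Fin.t (S m)) : i = Fin.F1 \/ exists k, idx i = S k.
Proof.
  apply (Fin.caseS' i); [now left|]. intros j. right. exists (idx j). apply to_nat_FS.
Qed.

Lemma idx_inj {m : nat} (i j : Fin.t m) : idx i = idx j -> i = j.
Proof. apply Fin.to_nat_inj. Qed.

Definition x_index {n : nat} (i : Fin.t (S (S n))) : Prop := i <> Fin.F1 /\ i <> last_fin n.

Definition x_indices (n : nat) : list (Fin.t (S (S n))) :=
  filter (fun i => if Fin.eq_dec i Fin.F1 then false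
                   else if Fin.eq_dec i (last_fin n) then false else true) (fins (S (S n))).

Lemma in_x_indices {n : nat} (i : Fin.t (S (S n))) : In i (x_indices n) <-> x_index i.
Proof.
  unfold x_indices, x_index. rewrite filter_In.
  destruct (Fin.eq_dec i Fin.F1), (Fin.eq_dec i (last_fin n));
    intuition (try discriminate); apply in_fins.
Qed.

Lemma x_index_idx {n : nat} (i : Fin.t (S (S n))) :
  x_index i -> exists k, idx i = S k /\ (k < n)%nat.
Proof.
  intros [H1 H2]. destruct (idx_F1_or_succ i) as [->|[k Hk]]; [easy|].
  exists k. split; auto. pose proof (idx_lt i).
  assert (idx i <> S n) by (intros H0; apply H2, idx_inj; now rewrite idx_last).
  lia.
Qed.

Lemma sumL_filter {A : Type} (f : A -> bool) l F :
  sumL (filter f l) F = sumL l (fun a => if f a then F a else 0).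
Proof.
  induction l as [|a l IH]; simpl; auto. destruct (f a); simpl; rewrite IH; ring.
Qed.

Lemma trip_last {n : nat} u (X : pt n) v : trip u X v (last_fin n) = v.
Proof.
  unfold trip, mkpt. fold (idx (last_fin n)). rewrite idx_last.
  now rewrite PeanoNat.Nat.ltb_irrefl.
Qed.

Lemma trip_x {n : nat} u (X : pt n) v i k :
  idx i = S k -> (k < n)%nat -> trip u X v i = fcoord X k.
Proof.
  intros Hi Hk. unfold trip, mkpt. fold (idx i). rewrite Hi.
  apply PeanoNat.Nat.ltb_lt in Hk. now rewrite Hk.
Qed.

Lemma trip_not_last {n : nat} u (X : pt n) v v' i :
  i <> last_fin n -> trip u X v i = trip u X v' i.
Proof.
  intros Hi. destruct (Fin.eq_dec i Fin.F1) as [->|H1]; [reflexivity|].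
  destruct (x_index_idx i (conj H1 Hi)) as [k [Hk Hkn]].
  now rewrite !(trip_x _ _ _ i k).
Qed.

Lemma vcoord_last {n : nat} (P : pt (S (S n))) : vcoord P = P (last_fin n).
Proof.
  pose proof (fcoord_idx P (last_fin n)) as H. now rewrite idx_last in H.
Qed.

Lemma uxpart_fcoord {n : nat} (P : pt (S (S n))) k : (k < S n)%nat -> fcoord (uxpart P) k = fcoord P k.
Proof.
  intros Hk. rewrite (fcoord_lt _ Hk). unfold uxpart, mkpt.
  fold (idx (Fin.of_nat_lt Hk)). now rewrite idx_of_nat_lt.
Qed.

Lemma uxpart_upd_last {n : nat} (P : pt (S (S n))) v : uxpart (upd P (last_fin n) v) = uxpart P.
Proof.
  apply peq_eq. intros j. unfold uxpart, mkpt. fold (idx j).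
  assert (H : (idx j < S (S n))%nat) by (pose proof (idx_lt j); lia).
  rewrite !(fcoord_lt _ H). apply upd_other. intros E.
  pose proof (idx_of_nat_lt H) as Hi. rewrite E, idx_last in Hi. pose proof (idx_lt j). lia.
Qed.

Lemma fcoord_close {m : nat} (x y : pt m) d k :
  0 < d -> dist_lt x y d -> Rabs (fcoord x k - fcoord y k) < d.
Proof.
  intros Hd H. unfold fcoord. destruct (Fin.of_nat k m); auto.
  now rewrite Rminus_diag, Rabs_R0.
Qed.

Lemma uxpart_close {n : nat} (P Q : pt (S (S n))) d :
  0 < d -> dist_lt P Q d -> dist_lt (uxpart P) (uxpart Q) d.
Proof. intros Hd H j. now apply fcoord_close. Qed.

Lemma cont_on_uxpart {n : nat} a b (f : pt (S n) -> R) :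
  cont_on (Omega a b) f -> cont_on (Lam a b) (fun P : pt (S (S n)) => f (uxpart P)).
Proof.
  intros Hf P HP e He. destruct (Hf (uxpart P) HP e He) as [d [Hd H]].
  exists d. split; auto. intros Q HQ HQP. apply H; [exact HQ|now apply uxpart_close].
Qed.

Lemma cont_on_trip {n : nat} a b (X : pt (S n) -> pt n) (G : pt (S n) -> R)
  (f : pt (S (S n)) -> pt (S (S n))) :
  (forall j, cont_on (Omega a b) (fun Y => X Y j)) -> cont_on (Omega a b) G ->
  (forall P, Lam a b P ->
     peq (f P) (trip (ucoord P) (X (uxpart P)) (vcoord P + G (uxpart P)))) ->
  forall i, cont_on (Lam a b) (fun P => f P i).
Proof.
  intros HX HG Hf i.
  apply cont_on_ext with (fun P => trip (ucoord P) (X (uxpart P)) (vcoord P + G (uxpart P)) i).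
  { intros P HP. symmetry. now apply Hf. }
  destruct (Fin.eq_dec i Fin.F1) as [->|H1]; [apply (cont_on_coord (Lam a b) Fin.F1)|].
  destruct (Fin.eq_dec i (last_fin n)) as [->|H2].
  - apply cont_on_ext with (fun P => P (last_fin n) + G (uxpart P)).
    + intros P _. now rewrite trip_last, vcoord_last.
    + apply cont_on_plus; [apply cont_on_coord|now apply cont_on_uxpart].
  - destruct (x_index_idx i (conj H1 H2)) as [k [Hk Hkn]].
    apply cont_on_ext with (fun P => X (uxpart P) (Fin.of_nat_lt Hkn)).
    + intros P _. now rewrite (trip_x _ _ _ i k), (fcoord_lt _ Hkn).
    + apply (cont_on_uxpart a b (fun Y => X Y (Fin.of_nat_lt Hkn))). auto.
Qed.

(** All that solving [f P = y] needs to know about the shape of [t_eps]: [U] is kept, and [V]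
    influences only the last component, by translation. *)
Definition triangular {n : nat} (L : pt (S (S n)) -> Prop) (f : pt (S (S n)) -> pt (S (S n))) : Prop :=
  forall P, L P -> f P Fin.F1 = P Fin.F1 /\
    forall v, (forall j, j <> last_fin n -> f (upd P (last_fin n) v) j = f P j) /\
      f (upd P (last_fin n) v) (last_fin n) = f P (last_fin n) + (v - P (last_fin n)).

(** True by conversion: [last_fin n] computes to a successor, so the update does not touch
    coordinate 0, the only one that [Lam] constrains. *)
Lemma Lam_upd_last {n : nat} a b (P : pt (S (S n))) v :
  Lam a b P -> Lam a b (upd P (last_fin n) v).
Proof. exact (fun H => H). Qed.

Lemma triangular_trip {n : nat} a b (X : pt (S n) -> pt n) (G : pt (S n) -> R)
  (f : pt (S (S n)) -> pt (S (S n))) :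
  (forall P, Lam a b P ->
     peq (f P) (trip (ucoord P) (X (uxpart P)) (vcoord P + G (uxpart P)))) ->
  triangular (Lam a b) f.
Proof.
  intros Hf P HP. split; [exact (Hf P HP Fin.F1)|]. intros v.
  pose proof (Hf _ (Lam_upd_last a b P v HP)) as H. rewrite uxpart_upd_last in H.
  change (ucoord (upd P (last_fin n) v)) with (ucoord P) in H.
  split.
  - intros j Hj. rewrite (H j), (Hf P HP j). now apply trip_not_last.
  - rewrite H, (Hf P HP), !trip_last, !vcoord_last, upd_same. ring.
Qed.

(* Radii of the slice [U = const], [V = const] through the centre. *)
Definition slice_radius {n : nat} : pt (S (S n)) :=
  fun i => if Fin.eq_dec i Fin.F1 then 0 else if Fin.eq_dec i (last_fin n) then 0 else 1.

Lemma slice_F1 {n : nat} (c P : pt (S (S n))) : cbox c slice_radius P -> P Fin.F1 = c Fin.F1.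
Proof.
  intros H. specialize (H Fin.F1). unfold slice_radius in H.
  destruct (Fin.eq_dec _ _); [|easy]. apply Rminus_diag_uniq.
  destruct (Req_dec (P Fin.F1 - c Fin.F1) 0) as [|Hn]; auto.
  apply Rabs_pos_lt in Hn. lra.
Qed.

Lemma slice_last {n : nat} (c P : pt (S (S n))) :
  cbox c slice_radius P -> P (last_fin n) = c (last_fin n).
Proof.
  intros H. specialize (H (last_fin n)). unfold slice_radius in H.
  pose proof (F1_neq_last n).
  destruct (Fin.eq_dec (last_fin n) Fin.F1); [congruence|].
  destruct (Fin.eq_dec _ _); [|easy]. apply Rminus_diag_uniq.
  destruct (Req_dec (P (last_fin n) - c (last_fin n)) 0) as [|Hn]; auto.
  apply Rabs_pos_lt in Hn. lra.
Qed.

Lemma slice_radius_x {n : nat} (i : Fin.t (S (S n))) : x_index i -> slice_radius i = 1.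
Proof.
  intros [H1 H2]. unfold slice_radius.
  destruct (Fin.eq_dec _ _); [easy|]. now destruct (Fin.eq_dec _ _).
Qed.

Lemma slice_radius_range {n : nat} (i : Fin.t (S (S n))) : 0 <= slice_radius i <= 1.
Proof. unfold slice_radius. repeat destruct (Fin.eq_dec _ _); lra. Qed.

(* At a minimum of the [X]-distance to [y], [w = (- c, X(P) - y_X, 0)] with a
   suitable [c] is a left null vector of the Jacobian. *)
Lemma slice_solution {n : nat} a b (f : pt (S (S n)) -> pt (S (S n))) (c y : pt (S (S n))) :
  is_open (Lam a b (n := n)) -> triangular (Lam a b) f ->
  subset (cbox c slice_radius) (Lam a b) ->
  (forall j, cont_on (Lam a b) (fun P => f P j)) ->
  (forall P, cbox c slice_radius P -> exists J,
     (forall j i, partial_at (fun Q => f Q j) i P (J j i)) /\ nondegenerate J) ->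
  (forall P, cbox c slice_radius P ->
     (exists i, x_index i /\ 1 <= Rabs (P i - c i)) ->
     sqdist (x_indices n) (f c) y < sqdist (x_indices n) (f P) y) ->
  y Fin.F1 = c Fin.F1 ->
  exists P, cbox c slice_radius P /\
    f (upd P (last_fin n) (P (last_fin n) + (y (last_fin n) - f P (last_fin n)))) = y.
Proof.
  intros HL Htri Hsub Hcont HJ Hbd Hy.
  assert (Hcc : cbox c slice_radius c).
  { intros i. rewrite Rminus_diag, Rabs_R0. apply slice_radius_range. }
  destruct (compact_min (cbox c slice_radius) (fun P => sqdist (x_indices n) (f P) y) c
    (cbox_compact c slice_radius) Hcc) as [P [HP Hmin]].
  { apply cont_on_sqdist. intros j. now apply cont_on_sub with (Lam a b). }
  exists P. split; auto.
  destruct (HJ P HP) as [J [Hp HJn]].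
  assert (Hint : forall i, x_index i -> Rabs (P i - c i) < 1).
  { intros i Hi. apply Rnot_le_lt. intros Hle.
    pose proof (Hbd P HP (ex_intro _ i (conj Hi Hle))). specialize (Hmin c Hcc). lra. }
  assert (HLP : Lam a b P) by auto.
  assert (HJ1 : forall i, J Fin.F1 i = kron Fin.F1 i).
  { intros i. apply (partial_at_unique (fun Q => f Q Fin.F1) i P); auto.
    apply partial_at_open with (Lam a b) (fun Q => Q Fin.F1); auto.
    - intros Q HQ. symmetry. now apply Htri.
    - apply partial_at_coord. }
  (* The [V]-column of [J] is zero above the last row, and the null vector to be built vanishes in
     the last row, so this column needs no criticality. *)
  assert (HJl : forall j, j <> last_fin n -> J j (last_fin n) = 0).
  { intros j Hj. apply (partial_at_unique (fun Q => f Q j) (last_fin n) P); auto.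
    unfold partial_at. replace (fun v => f (upd P (last_fin n) v) j) with (fun _ : R => f P j).
    - apply derivable_pt_lim_const.
    - apply functional_extensionality. intros v. symmetry. now apply Htri. }
  assert (HJx : forall i, x_index i ->
    sumL (x_indices n) (fun j => (f P j - y j) * J j i) = 0).
  { intros i Hi.
    assert (H : 2 * sumL (x_indices n) (fun j => (f P j - y j) * J j i) = 0); [|lra].
    apply (partial_at_min_zero (fun P => sqdist (x_indices n) (f P) y) i P)
      with (d := 1 - Rabs (P i - c i)).
    - specialize (Hint i Hi). lra.
    - intros s Hs. apply Hmin. intros k. unfold upd.
      destruct (Fin.eq_dec k i) as [->|]; [|apply HP].
      rewrite slice_radius_x by auto.
      pose proof (Rabs_triang (s - P i) (P i - c i)) as H.
      replace (s - P i + (P i - c i)) with (s - c i) in H by ring. lra.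
    - apply partial_at_sqdist. auto. }
  pose (isx := fun j : Fin.t (S (S n)) => if Fin.eq_dec j Fin.F1 then false
                   else if Fin.eq_dec j (last_fin n) then false else true).
  (* The slice fixes [U], so nothing is critical in that direction. As row [U] of [J] is a unit
     vector, subtracting [C] times that row cancels the [U]-entry and changes no other. *)
  pose (C := sumL (x_indices n) (fun j => (f P j - y j) * J j Fin.F1)).
  assert (Hw : forall j, (if isx j then f P j - y j else 0) + kron Fin.F1 j * - C = 0).
  { apply HJn. intros i.
    transitivity (sumL (x_indices n) (fun j => (f P j - y j) * J j i) + - C * kron Fin.F1 i).
    - rewrite <- HJ1. rewrite <- (sumF_kron_l (fun j => - C * J j i) Fin.F1).
      unfold x_indices. rewrite sumL_filter. unfold sumF. rewrite <- sumL_plus.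
      apply sumL_ext. intros j _. fold (isx j). destruct (isx j); ring.
    - destruct (Fin.eq_dec i Fin.F1) as [->|H1].
      + fold C. unfold kron. destruct (Fin.eq_dec _ _); [ring|easy].
      + unfold kron. destruct (Fin.eq_dec Fin.F1 i); [congruence|].
        destruct (Fin.eq_dec i (last_fin n)) as [->|H2].
        * rewrite sumL_zero; [ring|]. intros j Hj. rewrite HJl; [ring|].
          apply in_x_indices in Hj. apply Hj.
        * rewrite HJx by (split; auto). ring. }
  assert (Hx : forall j, x_index j -> f P j = y j).
  { intros j [H1 H2]. specialize (Hw j). unfold isx, kron in Hw.
    destruct (Fin.eq_dec j Fin.F1); [easy|].
    destruct (Fin.eq_dec j (last_fin n)); [easy|].
    destruct (Fin.eq_dec Fin.F1 j); [congruence|]. lra. }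
  (* The remaining defect in the last component is removed by shifting [V] by exactly that defect,
     which leaves the other components unchanged. *)
  destruct (Htri P HLP) as [Ht1 Ht2].
  specialize (Ht2 (P (last_fin n) + (y (last_fin n) - f P (last_fin n)))).
  destruct Ht2 as [Ht2 Ht3].
  apply peq_eq. intros j. destruct (Fin.eq_dec j (last_fin n)) as [->|Hj].
  - rewrite Ht3. ring.
  - rewrite Ht2 by auto. destruct (Fin.eq_dec j Fin.F1) as [->|H1].
    + rewrite Ht1, Hy. now apply slice_F1.
    + apply Hx. now split.
Qed.

(** Injectivity of the limit is given only at the [U]-value of [p]. There it separates [s0 p] from
    the values on the faces of the [X]-cube by a positive [mu]; uniform continuity in [U] and
    uniform convergence carry the separation to nearby [U], to [s_eps] and to targets [y] near
    [s0 p]. *)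
Lemma boundary_gap {n : nat} (L : pt (S (S n)) -> Prop) (s : net (S (S n)) (S (S n)))
  (s0 : pt (S (S n)) -> pt (S (S n))) (p : pt (S (S n))) u :
  0 < u -> subset (cbox p (fun i => if Fin.eq_dec i Fin.F1 then u else 1)) L ->
  is_open L ->
  (forall j, cont_on L (fun P => s0 P j)) -> unif_conv_compact L s s0 ->
  (forall P, L P -> P Fin.F1 = p Fin.F1 -> (forall i, x_index i -> s0 P i = s0 p i) ->
     forall i, x_index i -> P i = p i) ->
  exists d e1, 0 < d <= u /\ 0 < e1 /\
    forall e, 0 < e <= e1 -> e <= 1 ->
    forall y v, (forall i, x_index i -> Rabs (y i - s0 p i) < d) -> Rabs (v - p Fin.F1) < d ->
    forall P, cbox (upd p Fin.F1 v) slice_radius P ->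
      (exists i, x_index i /\ 1 <= Rabs (P i - p i)) ->
      sqdist (x_indices n) (s e (upd p Fin.F1 v)) y < sqdist (x_indices n) (s e P) y.
Proof.
  intros Hu Hsub HL Hcont Hconv Hinj.
  set (box1 := cbox p (fun i => if Fin.eq_dec i Fin.F1 then u else 1)) in *.
  set (lX := x_indices n).
  (* The faces of the unit [X]-cube at the [U] and [V] of [p]; with [U] and [V] frozen they form a
     compact set. *)
  pose (S0 := fun P => cbox p slice_radius P /\
    exists i, In i lX /\ 1 <= Rabs (P i - p i)).
  assert (Hslice : forall v P, Rabs (v - p Fin.F1) <= u ->
    cbox (upd p Fin.F1 v) slice_radius P -> box1 P).
  { intros v P Hv HP i. specialize (HP i). unfold upd, slice_radius in HP.
    destruct (Fin.eq_dec i Fin.F1) as [->|H1].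
    - replace (P Fin.F1 - p Fin.F1) with ((P Fin.F1 - v) + (v - p Fin.F1)) by ring.
      eapply Rle_trans; [apply Rabs_triang|]. lra.
    - destruct (Fin.eq_dec i (last_fin n)); lra. }
  assert (HS0L : subset S0 L).
  { intros P [HP _]. apply Hsub, (Hslice (p Fin.F1)); [rewrite Rminus_diag, Rabs_R0; lra|].
    now rewrite upd_id. }
  assert (Hp : L p).
  { apply Hsub. intros i. rewrite Rminus_diag, Rabs_R0. destruct (Fin.eq_dec _ _); lra. }
  assert (HS0 : is_compact S0).
  { apply closed_bounded_compact.
    - apply closed_and; [apply cbox_closed|].
      apply (closed_exists_in lX (fun i P => 1 <= Rabs (P i - p i))).
      intros. apply closed_coord_ge.
    - apply closed_subset_bounded with (cbox p slice_radius); [|apply cbox_bounded].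
      now intros P [H _]. }
  assert (Hcd : cont_on L (fun P => sqdist lX (s0 P) (s0 p))) by now apply cont_on_sqdist.
  assert (Hmu : exists mu, 0 < mu /\ forall P, S0 P -> mu <= sqdist lX (s0 P) (s0 p)).
  { destruct (classic (exists z, S0 z)) as [[z Hz]|Hn].
    - destruct (compact_min S0 (fun P => sqdist lX (s0 P) (s0 p)) z HS0 Hz) as [P [HP Hmin]].
      { now apply cont_on_sub with L. }
      exists (sqdist lX (s0 P) (s0 p)). split; auto.
      destruct (sqdist_nonneg lX (s0 P) (s0 p)) as [H|H]; auto. exfalso.
      destruct HP as [HP [i [Hi Hge]]].
      assert (Heq : P i = p i).
      { apply Hinj.
        - apply HS0L. split; eauto.
        - now apply slice_F1 in HP.
        - intros j Hj. apply in_x_indices in Hj.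
          pose proof (sumL_term_le lX (fun j => (s0 P j - s0 p j) * (s0 P j - s0 p j)) j
            (fun b _ => Rle_0_sqr _) Hj) as Hle.
          unfold sqdist in H. rewrite <- H in Hle. simpl in Hle. nra.
        - now apply in_x_indices. }
      rewrite Heq, Rminus_diag, Rabs_R0 in Hge. lra.
    - exists 1. split; [lra|]. intros P HP. exfalso. apply Hn. now exists P. }
  destruct Hmu as [mu [Hmu Hmin]].
  (* With all perturbations below [k], the quasi-triangle inequality bounds the centre term by
     [10 k] and the face term from below by [(mu/2 - 6 k)/4]. Any [k <= mu/92] would do. *)
  pose (k := mu / 200). assert (Hk : 0 < k) by (unfold k; lra).
  destruct (lebesgue_number S0 (fun P => L P -> mu / 2 < sqdist lX (s0 P) (s0 p)) HS0)
    as [d1 [Hd1 H1]].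
  { intros P HP. destruct (Hcd P (HS0L P HP) (mu / 2)) as [d [Hd H]]; [lra|].
    exists d. split; auto. intros Q HQP HQ. specialize (H Q HQ HQP). apply Rabs_def2 in H.
    specialize (Hmin P HP). lra. }
  destruct (Hcd p Hp k Hk) as [d2 [Hd2 H2]].
  destruct (sqdist_lt lX k Hk) as [d3 [Hd3 H3]].
  destruct (Hconv box1 (cbox_compact _ _) Hsub d3 Hd3) as [e1 [He1 Hs]].
  exists (Rmin u (Rmin d1 (Rmin d2 d3))), e1.
  assert (0 < Rmin u (Rmin d1 (Rmin d2 d3))) by (repeat apply Rmin_pos; auto).
  pose proof (Rmin_l u (Rmin d1 (Rmin d2 d3))).
  pose proof (Rmin_r u (Rmin d1 (Rmin d2 d3))).
  pose proof (Rmin_l d1 (Rmin d2 d3)). pose proof (Rmin_r d1 (Rmin d2 d3)).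
  pose proof (Rmin_l d2 d3). pose proof (Rmin_r d2 d3).
  set (d := Rmin u _) in *.
  split; [lra|]. split; auto. intros e He Hee y v Hy Hv P HP [i [Hi Hge]].
  assert (Hvu : Rabs (v - p Fin.F1) <= u) by lra.
  assert (HP1 : box1 P) by now apply (Hslice v).
  set (q := upd p Fin.F1 v) in *.
  assert (Hq1 : box1 q).
  { apply (Hslice v); auto. intros j. rewrite Rminus_diag, Rabs_R0. apply slice_radius_range. }
  (* Resetting [U] to its value at [p] moves [P] onto a face in [S0], at a distance below the
     Lebesgue number [d1]. *)
  assert (Hbig : mu / 2 < sqdist lX (s0 P) (s0 p)).
  { apply (H1 (upd P Fin.F1 (p Fin.F1))); auto.
    - split.
      + intros j. unfold upd. specialize (HP j). unfold q, upd in HP.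
        destruct (Fin.eq_dec j Fin.F1) as [->|]; auto.
        rewrite Rminus_diag, Rabs_R0. apply slice_radius_range.
      + exists i. split; [now apply in_x_indices|]. rewrite upd_other; auto. apply Hi.
    - apply dist_lt_sym, dist_lt_upd. apply slice_F1 in HP. unfold q in HP.
      rewrite upd_same in HP. rewrite HP, Rabs_minus_sym. lra. }
  assert (Hy' : sqdist lX y (s0 p) < k).
  { apply H3. intros j Hj. apply in_x_indices in Hj. specialize (Hy j Hj). lra. }
  assert (Hy'' : sqdist lX (s0 p) y < k).
  { apply H3. intros j Hj. apply in_x_indices in Hj. specialize (Hy j Hj).
    rewrite Rabs_minus_sym. lra. }
  assert (HsP : sqdist lX (s0 P) (s e P) < k).
  { apply H3. intros j _. rewrite Rabs_minus_sym. now apply Hs. }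
  assert (Hsq : sqdist lX (s e q) (s0 q) < k) by (apply H3; intros j _; now apply Hs).
  assert (Hq : sqdist lX (s0 q) (s0 p) < k).
  { assert (dist_lt q p d2) by (apply dist_lt_upd; lra).
    specialize (H2 q (Hsub q Hq1) H9). apply Rabs_def2 in H2.
    assert (sqdist lX (s0 p) (s0 p) = 0); [|lra].
    apply sumL_zero. intros. ring. }
  pose proof (sqdist_quasi_triangle lX (s0 P) (s e P) (s0 p)).
  pose proof (sqdist_quasi_triangle lX (s e P) y (s0 p)).
  pose proof (sqdist_quasi_triangle lX (s e q) (s0 q) y).
  pose proof (sqdist_quasi_triangle lX (s0 q) (s0 p) y).
  unfold k in *. lra.
Qed.

(** * Inversion data *)

(** Disposes of every negligibility claim of the theorem: each difference is exactly zero for small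
    [eps]. *)
Lemma negligible_of_zero {m k : nat} (U : pt m -> Prop) (w : net m k) e1 :
  0 < e1 <= 1 -> (forall e, 0 < e <= e1 -> forall x, U x -> forall j, w e x j = 0) ->
  negligible U w.
Proof.
  intros He1 Hw. exists e1, (fun _ _ _ _ => 0). split; auto. split.
  - intros e He j. split; [|split].
    + intros x Hx. symmetry. auto.
    + intros. apply cont_on_const.
    + intros. apply partial_at_const.
  - intros K _ _ j al q. exists 0, 1. split; [lra|]. intros. rewrite Rabs_R0. lra.
Qed.

Lemma moderate_sub {m k : nat} (U V : pt m -> Prop) (u : net m k) :
  subset V U -> moderate U u -> moderate V u.
Proof.
  intros HVU [D [HD HC]]. exists D. split.
  - intros e He j. destruct (HD e He j) as [H1 [H2 H3]]. split; [|split]; auto.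
    intros al. now apply cont_on_sub with U.
  - intros K HK HKV. apply HC; auto. intros x Hx. auto.
Qed.

Lemma moderate_continuous {m k : nat} (U : pt m -> Prop) (u : net m k) e j :
  moderate U u -> 0 < e <= 1 -> cont_on U (fun x => u e x j).
Proof.
  intros [D [HD _]] He. destruct (HD e He j) as [H1 [H2 _]].
  now apply cont_on_ext with (D e j []).
Qed.

(** Compact images are known for another representative [u'] only. The negligible estimate of
    [u' - u] with no derivative and [q = 0] bounds the difference, so the bound passes to the given
    [u]. *)
Lemma cbounded_class_bound {m k : nat} (U : pt m -> Prop) (V : pt k -> Prop) (u : net m k) K :
  cbounded_class U V u -> is_compact K -> subset K U ->
  exists M e1, 0 <= M /\ 0 < e1 <= 1 /\
    forall e, 0 < e <= e1 -> forall x, K x -> forall i, Rabs (u e x i) <= M.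
Proof.
  intros [u' [[e1 [D [He1 [HD HN]]]] [_ [_ Hc]]]] HK HKU.
  destruct (Hc K HK HKU) as [L [HL [_ [e2 [He2 Hu']]]]].
  assert (HLb : forall i, exists C, 0 <= C /\ forall y, L y -> Rabs (y i) <= C).
  { intros i. apply (compact_bounded_fun L (fun y => y i)); auto. apply cont_on_coord. }
  destruct (fun_choice _ HLb) as [CL HCL].
  assert (HNb : forall i, exists C, exists e0, 0 < e0 /\ forall e, 0 < e <= e0 -> e <= e1 ->
    forall x, K x -> Rabs (u' e x i - u e x i) <= C).
  { intros i. destruct (HN K HK HKU i [] 0%nat) as [C [e0 [He0 H]]].
    exists C, e0. split; auto. intros e He Hee x Hx. specialize (H e He Hee x Hx).
    destruct (HD e ltac:(lra) i) as [H0 _]. rewrite H0 in H by auto.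
    simpl in H. rewrite Rmult_1_r in H. exact H. }
  destruct (fun_choice _ HNb) as [CN HCN].
  destruct (common_radius_fin (fun i d => forall e, 0 < e <= d -> e <= e1 ->
    forall x, K x -> Rabs (u' e x i - u e x i) <= CN i)) as [e3 [He3 H3]]; auto.
  { intros i d d' H Hd e He. apply H. lra. }
  exists (sumF (fun i => CL i + Rabs (CN i))), (Rmin e1 (Rmin e2 e3)).
  assert (Hpos : forall i, 0 <= CL i + Rabs (CN i)).
  { intros i. destruct (HCL i). pose proof (Rabs_pos (CN i)). lra. }
  pose proof (Rmin_l e1 (Rmin e2 e3)). pose proof (Rmin_r e1 (Rmin e2 e3)).
  pose proof (Rmin_l e2 e3). pose proof (Rmin_r e2 e3).
  assert (0 < Rmin e1 (Rmin e2 e3)) by (repeat apply Rmin_pos; lra).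
  split; [now apply sumL_nonneg|]. split; [lra|].
  intros e He x Hx i.
  eapply Rle_trans;
    [|apply (sumL_term_le (fins k) (fun i => CL i + Rabs (CN i)) i); auto; apply in_fins].
  destruct (HCL i) as [_ HL'].
  specialize (HL' _ (Hu' e ltac:(lra) ltac:(lra) x Hx)).
  specialize (H3 i e ltac:(lra) ltac:(lra) x Hx).
  pose proof (Rabs_triang (u' e x i) (- (u' e x i - u e x i))) as Ht.
  replace (u' e x i + - (u' e x i - u e x i)) with (u e x i) in Ht by ring.
  rewrite Rabs_Ropp in Ht. pose proof (Rle_abs (CN i)). lra.
Qed.

Lemma gt_low_near a : pos_ext a -> exists d, 0 < d /\ forall u, - d <= u -> gt_low a u.
Proof.
  destruct a as [r|]; simpl; intros H.
  - exists (r / 2). split; [lra|]. intros. lra.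
  - exists 1. split; [lra|auto].
Qed.

Lemma lt_up_near b : pos_ext b -> exists d, 0 < d /\ forall u, u <= d -> lt_up b u.
Proof.
  destruct b as [r|]; simpl; intros H.
  - exists (r / 2). split; [lra|]. intros. lra.
  - exists 1. split; [lra|auto].
Qed.

Lemma Lam_open a b n : is_open (Lam a b (n := n)).
Proof.
  intros P [Ha Hb].
  assert (H1 : exists d, 0 < d /\ forall u, Rabs (u - ucoord P) < d -> gt_low a u).
  { destruct a as [r|]; simpl in *.
    - exists (ucoord P + r). split; [lra|]. intros u Hu. apply Rabs_def2 in Hu. lra.
    - exists 1. split; [lra|auto]. }
  assert (H2 : exists d, 0 < d /\ forall u, Rabs (u - ucoord P) < d -> lt_up b u).
  { destruct b as [r|]; simpl in *.
    - exists (r - ucoord P). split; [lra|]. intros u Hu. apply Rabs_def2 in Hu. lra.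
    - exists 1. split; [lra|auto]. }
  destruct H1 as [d [Hd H1]], H2 as [d' [Hd' H2]].
  exists (Rmin d d'). split; [now apply Rmin_pos|]. intros Q HQ.
  specialize (HQ Fin.F1). pose proof (Rmin_l d d'). pose proof (Rmin_r d d').
  change (Rabs (ucoord Q - ucoord P) < Rmin d d') in HQ.
  split; [apply H1|apply H2]; lra.
Qed.

Lemma open_box {m : nat} (x r : pt m) : is_open (fun z => forall i, Rabs (z i - x i) < r i).
Proof.
  intros z Hz.
  destruct (common_radius_fin (fun i d => d <= r i - Rabs (z i - x i))) as [d [Hd H]].
  - intros. lra.
  - intros i. specialize (Hz i). exists (r i - Rabs (z i - x i)). lra.
  - exists d. split; auto. intros y Hy i. specialize (Hy i). specialize (H i).
    pose proof (Rabs_triang (y i - z i) (z i - x i)) as Ht.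
    replace (y i - z i + (z i - x i)) with (y i - x i) in Ht by ring. lra.
Qed.

Lemma open_box_bounded {m : nat} (x r : pt m) :
  is_bounded (fun z => forall i, Rabs (z i - x i) < r i).
Proof.
  apply closed_subset_bounded with (cbox x r); [|apply cbox_bounded].
  intros z Hz i. left. auto.
Qed.

Lemma uxpart_determines {n : nat} (P Q : pt (S (S n))) i :
  i <> last_fin n -> uxpart P = uxpart Q -> P i = Q i.
Proof.
  intros Hi H. assert (Hlt : (idx i < S n)%nat).
  { destruct (Fin.eq_dec i Fin.F1) as [->|H1]; [cbn; lia|].
    destruct (x_index_idx i (conj H1 Hi)) as [k [Hk Hkn]]. lia. }
  rewrite <- (fcoord_idx P i), <- (fcoord_idx Q i).
  now rewrite <- !uxpart_fcoord, H by auto.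
Qed.

Lemma xpart_close {n : nat} (P Q : pt (S (S n))) r :
  (forall i, i <> Fin.F1 -> Rabs (P i - Q i) <= r) -> cbox (xpart Q) (fun _ => r) (xpart P).
Proof.
  intros H j. unfold xpart, mkpt. fold (idx j).
  assert (Hlt : (S (idx j) < S (S n))%nat) by (pose proof (idx_lt j); lia).
  rewrite !(fcoord_lt _ Hlt). apply H. intros E.
  pose proof (idx_of_nat_lt Hlt) as Hi. rewrite E in Hi. discriminate.
Qed.

(** At [U = 0] both points project into the region [U <= 0] contained in [W], so injectivity of
    [(U, x)] on [W] applies; equal [X]-components of [s0] are exactly equal values of [x0]. *)
Lemma limit_injective {n : nat} a b (x0 : pt (S n) -> pt n) (g0 : pt (S n) -> R)
  (s0 : pt (S (S n)) -> pt (S (S n))) (W : pt (S n) -> Prop) p :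
  (forall P, Lam a b P ->
     peq (s0 P) (trip (ucoord P) (x0 (uxpart P)) (vcoord P + g0 (uxpart P)))) ->
  (forall Y, gt_low a (fcoord Y 0) -> fcoord Y 0 <= 0 -> W Y) ->
  inj_on W (fun Y => pair_ux (fcoord Y 0) (x0 Y)) ->
  Lam a b p -> ucoord p = 0 ->
  forall P, Lam a b P -> P Fin.F1 = p Fin.F1 -> (forall i, x_index i -> s0 P i = s0 p i) ->
    forall i, x_index i -> P i = p i.
Proof.
  intros Hs0 HW HWi Hp Hp0 P HP HPp Hs i [_ Hi].
  assert (Hu : forall Q : pt (S (S n)), fcoord (uxpart Q) 0 = ucoord Q) by reflexivity.
  assert (HP0 : ucoord P = 0) by (rewrite <- Hp0; exact HPp).
  apply uxpart_determines; auto. apply peq_eq, HWi.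
  - apply HW; rewrite Hu; [apply HP|lra].
  - apply HW; rewrite Hu; [apply Hp|lra].
  - intros j. cbv beta. rewrite !Hu, HP0, Hp0. unfold pair_ux, mkpt. fold (idx j).
    destruct (idx_F1_or_succ j) as [->|[k Hk]]; [reflexivity|].
    rewrite Hk. assert (Hkn : (S k < S n)%nat) by (rewrite <- Hk; apply idx_lt).
    assert (Hk2 : (S k < S (S n))%nat) by lia.
    pose (l := Fin.of_nat_lt Hk2).
    assert (Hl : idx l = S k) by apply idx_of_nat_lt.
    assert (Hlx : x_index l).
    { split; intros E; rewrite E in Hl; [discriminate|]. rewrite idx_last in Hl. lia. }
    specialize (Hs l Hlx). rewrite (Hs0 P HP l), (Hs0 p Hp l) in Hs.
    rewrite !(trip_x _ _ _ l k) in Hs by (auto; lia). exact Hs.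
Qed.

Theorem theorem8p4 (a b : option R) (n : nat)
  (x : R -> pt (S n) -> pt n) (g h : R -> pt (S n) -> R)
  (t s : net (S (S n)) (S (S n)))
  (x0 : pt (S n) -> pt n) (g0 : pt (S n) -> R) (s0 : pt (S (S n)) -> pt (S (S n))) :
  pos_ext a -> pos_ext b -> (1 <= n)%nat ->
  (* (1) *)
  (forall e, 0 < e <= 1 ->
     smooth_map (Omega a b) (x e) /\ smooth_fun (Omega a b) (g e) /\
     smooth_fun (Omega a b) (h e)) ->
  (forall e, 0 < e <= 1 -> forall P, Lam a b P ->
     peq (t e P) (trip (ucoord P) (x e (uxpart P))
                       (vcoord P + g e (uxpart P) + h e (uxpart P)))) ->
  unif_bdd_compact (Omega a b) h ->
  propEplus a b t ->
  (* (2) *)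
  (forall e, 0 < e <= 1 -> forall P, Lam a b P ->
     peq (s e P) (trip (ucoord P) (x e (uxpart P)) (vcoord P + g e (uxpart P)))) ->
  propE a b s ->
  (* (3) *)
  (forall P, Lam a b P ->
     peq (s0 P) (trip (ucoord P) (x0 (uxpart P)) (vcoord P + g0 (uxpart P)))) ->
  (forall j, cont_on (Omega a b) (fun Y => x0 Y j)) ->
  cont_on (Omega a b) g0 ->
  (exists W : pt (S n) -> Prop,
     is_open W /\ subset W (Omega a b) /\
     (forall Y, gt_low a (fcoord Y 0) -> fcoord Y 0 <= 0 -> W Y) /\
     inj_on W (fun Y => pair_ux (fcoord Y 0) (x0 Y))) ->
  (* (4) *)
  unif_conv_compact (Lam a b) s s0 ->
  (* (5) *)
  moderate (Lam a b) t -> cbounded_class (Lam a b) (Lam a b) t ->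
  moderate (Lam a b) s -> cbounded_class (Lam a b) (Lam a b) s ->
  forall p : pt (S (S n)), Lam a b p -> ucoord p = 0 ->
  exists (A B Q D : pt (S (S n)) -> Prop) (tinv : net (S (S n)) (S (S n))),
    is_open A /\ A p /\ subset A (Lam a b) /\
    is_open B /\ is_open Q /\ is_open D /\
    is_bounded B /\ is_bounded Q /\ is_bounded D /\
    subset B (Lam a b) /\ subset Q (Lam a b) /\ subset D (Lam a b) /\
    subset Q B /\ subset A D /\
    moderate fullset tinv /\ cbounded_class fullset D tinv /\
    invertible_on (Lam a b) A fullset tinv B Q t.
Proof.
  intros Ha Hb Hn _ Ht _ HE Hs _ Hs0 Hx0 Hg0 [W [_ [_ [HW HWi]]]] Hconv Htm Htc _ _ p Hp Hp0.
  pose proof (Lam_open a b n) as HL.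
  assert (Ht' : forall e, 0 < e <= 1 -> forall P, Lam a b P ->
    peq (t e P) (trip (ucoord P) (x e (uxpart P))
                      (vcoord P + (g e (uxpart P) + h e (uxpart P))))).
  { intros e He P HP. rewrite <- Rplus_assoc. auto. }
  destruct (gt_low_near a Ha) as [da [Hda Hga]], (lt_up_near b Hb) as [db [Hdb Hgb]].
  assert (Hu2 : 0 < Rmin da db) by now apply Rmin_pos.
  pose proof (Rmin_l da db). pose proof (Rmin_r da db).
  set (u2 := Rmin da db) in *.
  assert (HLam : forall P : pt (S (S n)), Rabs (P Fin.F1) <= u2 -> Lam a b P).
  { intros P HP. pose proof (Rle_abs (P Fin.F1)). pose proof (Rle_abs (- P Fin.F1)).
    rewrite Rabs_Ropp in *.
    split; [apply Hga|apply Hgb]; change (ucoord P) with (P Fin.F1); lra. }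
  change (p Fin.F1 = 0) in Hp0.
  (* This box contains every slice used for the minimisation, since these keep the [V] of [p]. The
     bound [M1] for [t_eps] on it precedes the ellipsoid, so the weights may depend on it. *)
  set (r1 := fun i : Fin.t (S (S n)) => if Fin.eq_dec i Fin.F1 then u2 else 1).
  assert (HC1 : subset (cbox p r1) (Lam a b)).
  { intros P HP. apply HLam. specialize (HP Fin.F1). unfold r1 in HP.
    destruct (Fin.eq_dec Fin.F1 Fin.F1); [|easy]. now rewrite Hp0, Rminus_0_r in HP. }
  destruct (cbounded_class_bound _ _ t (cbox p r1) Htc (cbox_compact _ _) HC1)
    as [M1 [e1 [HM1 [He1 Hb1]]]].
  (* Bounds the later [V]-shift [y_V - t_V(P)]: the summand 1 covers the distance of [y_V] from
     [s0 p], and [M1] covers [t_V(P)]. It also exceeds the [X]-radius 1. *)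
  pose (M2 := Rabs (s0 p (last_fin n)) + 1 + M1).
  assert (HM2 : 1 <= M2) by (pose proof (Rabs_pos (s0 p (last_fin n))); unfold M2; lra).
  pose (N0 := INR (S (S n))).
  assert (HN0 : 0 < N0) by (apply lt_0_INR; lia).
  assert (HM2' : 0 < 1 + M2 * M2) by nra.
  (* A displacement of at most [M2] in one of the [N0 = n + 2] coordinates then costs at most
     [1/(4 N0)] in [q]. *)
  pose (wV := / (4 * N0 * (1 + M2 * M2))).
  assert (HwV : 0 < wV).
  { apply Rinv_0_lt_compat. apply Rmult_lt_0_compat; lra. }
  pose (r := 1 + 3 / wV).
  assert (Hr : 1 <= r).
  { unfold r. assert (0 < 3 / wV) by (apply Rdiv_lt_0_compat; lra). lra. }
  (* The [X]-cube of radius [r] contains the projection of [q < 3] whatever the [U]-weight is; [al]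
     depends on this cube, so [wU] has to be chosen after it. *)
  destruct (HE (cbox (xpart p) (fun _ => r)) (cbox_compact _ _))
    as [al [e2 [c [N [Hal [_ [He2 [Hc Hstrip]]]]]]]].
  pose (u1 := Rmin al u2 / 2).
  assert (Hu1 : 0 < u1 /\ u1 <= al / 2 /\ u1 <= u2 / 2).
  { assert (0 < Rmin al u2) by now apply Rmin_pos.
    pose proof (Rmin_l al u2). pose proof (Rmin_r al u2). unfold u1. lra. }
  (* Makes [q < 3] imply [|U| < u1], inside both the range of (E+) and [Lam]. *)
  pose (wU := 3 / (u1 * u1)).
  assert (HwU : 0 < wU) by (apply Rdiv_lt_0_compat; nra).
  assert (HwU' : wU * (u1 * u1) = 3) by (unfold wU; field; lra).
  pose (w := fun i : Fin.t (S (S n)) => if Fin.eq_dec i Fin.F1 then wU else wV).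
  assert (Hw : forall i, 0 < w i) by (intros i; unfold w; destruct (Fin.eq_dec _ _); auto).
  assert (HqU : forall P, quad p w P < 3 -> Rabs (P Fin.F1) < u1).
  { intros P HP. pose proof (quad_term p w P Fin.F1 Hw) as Hq.
    unfold w in Hq at 1. destruct (Fin.eq_dec Fin.F1 Fin.F1); [|easy]. rewrite Hp0, Rminus_0_r in Hq.
    apply Rnot_le_lt. intros Hle.
    assert (u1 * u1 <= P Fin.F1 * P Fin.F1).
    { rewrite <- (Rabs_pos_eq (P Fin.F1 * P Fin.F1)) by apply Rle_0_sqr.
      rewrite Rabs_mult. apply Rmult_le_compat; lra. }
    nra. }
  assert (HqX : forall P, quad p w P < 3 -> forall i, i <> Fin.F1 -> Rabs (P i - p i) <= r).
  { intros P HP i Hi. pose proof (quad_term p w P i Hw) as Hq. unfold w in Hq at 1.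
    destruct (Fin.eq_dec i Fin.F1); [easy|].
    assert ((P i - p i) * (P i - p i) <= 3 / wV).
    { apply Rmult_le_reg_l with (1 := HwV). replace (wV * (3 / wV)) with 3 by (field; lra). lra. }
    unfold r. pose proof (Rle_0_sqr (P i - p i - 1)). pose proof (Rle_0_sqr (P i - p i + 1)).
    unfold Rsqr in *. apply Rabs_le. lra. }
  assert (Hin : forall P : pt (S (S n)), Rabs (P Fin.F1) <= u1 ->
    (forall i, i <> Fin.F1 -> Rabs (P i - p i) <= r) -> strip a al (cbox (xpart p) (fun _ => r)) P).
  { intros P HU HX. split; [|split].
    - apply HLam. lra.
    - change (ucoord P) with (P Fin.F1). pose proof (Rle_abs (P Fin.F1)). lra.
    - now apply xpart_close. }
  assert (HOs : forall P, quad p w P < 3 -> strip a al (cbox (xpart p) (fun _ => r)) P).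
  { intros P HP. apply Hin; auto. left. auto. }
  assert (HOL : subset (fun P => quad p w P < 3) (Lam a b)).
  { intros P HP. apply HLam. specialize (HqU P HP). lra. }
  destruct (local_left_inverse (Lam a b) t p w e2 c N) as [v [Hv Hvt]]; auto.
  { intros e He P Q HP HQ. apply (Hstrip e He); auto. }
  { intros e He P HP. apply (Hstrip e He); auto. }
  assert (HAL : subset (fun P => quad p w P <= 1) (Lam a b)).
  { intros P HP. apply HOL. lra. }
  destruct (cbounded_class_bound _ _ t _ Htc (quad_compact p w 1 Hw) HAL)
    as [M3 [e3 [HM3 [He3 Hb3]]]].
  (* As [t_eps] keeps [U], it maps [q <= 1] into [|U| <= u1], with the other coordinates bounded by
     [M3]. Since [u1 < u2], this box is a compact subset of the open box [B], and [B] stays inside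
     [Lam]. *)
  pose (rL := fun i : Fin.t (S (S n)) => if Fin.eq_dec i Fin.F1 then u1 else M3).
  pose (rB := fun i : Fin.t (S (S n)) => if Fin.eq_dec i Fin.F1 then u2 else M3 + 1).
  pose (o := fun _ : Fin.t (S (S n)) => 0).
  set (B := fun P : pt (S (S n)) => forall i, Rabs (P i - o i) < rB i).
  assert (HLB : subset (cbox o rL) B).
  { intros P HP i. specialize (HP i). unfold rL, rB in *. destruct (Fin.eq_dec i Fin.F1); lra. }
  assert (HtB : forall e, 0 < e <= e3 -> forall P, quad p w P <= 1 -> cbox o rL (t e P)).
  { intros e He P HP i. unfold o, rL. rewrite Rminus_0_r.
    destruct (Fin.eq_dec i Fin.F1) as [->|]; [|now apply Hb3].
    assert (HPL : Lam a b P) by auto.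
    destruct (triangular_trip a b (x e) (fun Y => g e Y + h e Y) (t e) (Ht' e ltac:(lra)) P HPL) as [-> _].
    left. apply HqU. lra. }
  destruct (boundary_gap (Lam a b) s s0 p u2 Hu2 HC1 HL
    (cont_on_trip a b x0 g0 s0 Hx0 Hg0 Hs0) Hconv
    (limit_injective a b x0 g0 s0 W p Hs0 HW HWi Hp Hp0)) as [d [e4 [Hd [He4 Hgap]]]].
  (* [d] makes the boundary gap available, [u1 / 4] keeps the [U]-part of [q] at most [3/16], and 1
     is the allowance for [y_V] in [M2]. *)
  pose (rQ := fun i : Fin.t (S (S n)) =>
    if Fin.eq_dec i Fin.F1 then Rmin d (u1 / 4) else Rmin d 1).
  set (Q := fun y : pt (S (S n)) => forall i, Rabs (y i - s0 p i) < rQ i).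
  assert (HQd : forall y, Q y -> forall i, Rabs (y i - s0 p i) < d).
  { intros y Hy i. apply Rlt_le_trans with (1 := Hy i). unfold rQ.
    destruct (Fin.eq_dec _ _); apply Rmin_l. }
  assert (Hs0p : s0 p Fin.F1 = 0) by (rewrite (Hs0 p Hp Fin.F1); exact Hp0).
  pose (e5 := Rmin (Rmin e1 e2) (Rmin e3 e4)).
  assert (He5 : 0 < e5 /\ e5 <= e1 /\ e5 <= e2 /\ e5 <= e3 /\ e5 <= e4).
  { pose proof (Rmin_l (Rmin e1 e2) (Rmin e3 e4)). pose proof (Rmin_r (Rmin e1 e2) (Rmin e3 e4)).
    pose proof (Rmin_l e1 e2). pose proof (Rmin_r e1 e2).
    pose proof (Rmin_l e3 e4). pose proof (Rmin_r e3 e4).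
    unfold e5. repeat split; try lra. repeat apply Rmin_pos; lra. }
  assert (Hsol : forall e, 0 < e <= e5 -> forall y, Q y ->
    exists P, quad p w P <= 1 / 2 /\ t e P = y).
  { intros e He y Hy.
    assert (Hyu : Rabs (y Fin.F1) < u1 / 4).
    { pose proof (Hy Fin.F1) as H1. rewrite Hs0p, Rminus_0_r in H1.
      apply Rlt_le_trans with (1 := H1). unfold rQ.
      destruct (Fin.eq_dec Fin.F1 Fin.F1); [apply Rmin_r|easy]. }
    assert (Hyl : Rabs (y (last_fin n) - s0 p (last_fin n)) < 1).
    { apply Rlt_le_trans with (1 := Hy _). unfold rQ.
      destruct (Fin.eq_dec _ _) as [E|]; [now destruct (F1_neq_last n)|apply Rmin_r]. }
    set (q := upd p Fin.F1 (y Fin.F1)).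
    assert (Hq1 : q Fin.F1 = y Fin.F1) by apply upd_same.
    assert (HqP : forall P, cbox q slice_radius P ->
      P Fin.F1 = y Fin.F1 /\ forall i, i <> Fin.F1 -> Rabs (P i - p i) <= 1).
    { intros P HP. split; [rewrite <- Hq1; now apply slice_F1|]. intros i Hi.
      specialize (HP i). unfold q in HP. rewrite upd_other in HP by auto.
      pose proof (slice_radius_range i). lra. }
    assert (HqC : subset (cbox q slice_radius) (cbox p r1)).
    { intros P HP i. destruct (HqP P HP) as [H1 H2]. unfold r1.
      destruct (Fin.eq_dec i Fin.F1) as [->|]; auto. rewrite H1, Hp0, Rminus_0_r. lra. }
    assert (Hqq : cbox q slice_radius q).
    { intros i. rewrite Rminus_diag, Rabs_R0. apply slice_radius_range. }
    (* [t_eps] and [s_eps] differ only in the last component, so the gap proved for [s_eps] holds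
       for [t_eps]. *)
    assert (Hts : forall P, cbox q slice_radius P ->
      sqdist (x_indices n) (t e P) y = sqdist (x_indices n) (s e P) y).
    { intros P HP. apply HqC, HC1 in HP. apply sumL_ext. intros j Hj.
      apply in_x_indices in Hj. destruct Hj as [_ Hj].
      rewrite (Ht' e ltac:(lra) P HP j), (Hs e ltac:(lra) P HP j).
      now rewrite (trip_not_last _ _ _ (vcoord P + g e (uxpart P)) j Hj). }
    destruct (slice_solution a b (t e) q y) as [P [HP HtP]]; auto.
    - apply (triangular_trip a b (x e) (fun Y => g e Y + h e Y) (t e) (Ht' e ltac:(lra))).
    - intros P HP. auto.
    - intros j. apply moderate_continuous; auto. lra.
    - intros P HP. destruct (HqP P HP) as [H1 H2].
      destruct (Hstrip e ltac:(lra)) as [_ HJ].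
      destruct (HJ P) as [J [HJp HJd]].
      { apply Hin; [rewrite H1; lra|]. intros i Hi. specialize (H2 i Hi). lra. }
      exists J. split; [auto|]. apply det_nondegenerate. intros E.
      rewrite E, Rabs_R0 in HJd.
      assert (0 < c * e ^ N) by (apply Rmult_lt_0_compat; [auto|apply pow_lt; lra]). lra.
    - intros P HP [i [Hi Hge]]. rewrite !Hts by auto.
      apply Hgap with (e := e) (v := y Fin.F1); auto; try lra.
      + rewrite Hp0, Rminus_0_r. specialize (HQd y Hy Fin.F1).
        now rewrite Hs0p, Rminus_0_r in HQd.
      + exists i. split; auto. unfold q in Hge. rewrite upd_other in Hge; auto. apply Hi.
    - eexists. split; [|exact HtP].
      set (P' := upd P _ _) in *.
      destruct (HqP P HP) as [H1 H2].
      (* On the slice [P] has the [V] of [p], so the displacement is exactly the shift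
         [y_V - t_V(P)]. *)
      assert (HPl : Rabs (P' (last_fin n) - p (last_fin n)) <= M2).
      { unfold P'. rewrite upd_same, (slice_last q P HP). unfold q at 1.
        rewrite upd_other by (intros E; now apply (F1_neq_last n)).
        specialize (Hb1 e ltac:(lra) P (HqC P HP) (last_fin n)).
        replace (p (last_fin n) + (y (last_fin n) - t e P (last_fin n)) - p (last_fin n))
          with ((y (last_fin n) - s0 p (last_fin n)) + (s0 p (last_fin n) + - t e P (last_fin n)))
          by ring.
        eapply Rle_trans; [apply Rabs_triang|].
        pose proof (Rabs_triang (s0 p (last_fin n)) (- t e P (last_fin n))) as H3.
        rewrite Rabs_Ropp in H3. unfold M2. lra. }
      assert (HPX : forall i, i <> Fin.F1 -> Rabs (P' i - p i) <= M2).
      { intros i Hi. destruct (Fin.eq_dec i (last_fin n)) as [->|Hil]; auto.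
        unfold P'. rewrite upd_other by auto. specialize (H2 i Hi). lra. }
      assert (HPU : P' Fin.F1 = y Fin.F1) by (rewrite <- H1; reflexivity).
      (* The budget for [1/2]: at most [1/4] for the [U]-direction and [1/(4 N0)] for each of the
         [N0] coordinates. *)
      apply Rle_trans with (sumF (fun i : Fin.t (S (S n)) => kron Fin.F1 i * (1 / 4) + / (4 * N0))).
      + apply sumL_le. intros i _. unfold kron, w.
        destruct (Fin.eq_dec i Fin.F1) as [->|Hi].
        * destruct (Fin.eq_dec _ _); [|easy]. rewrite HPU, Hp0, Rminus_0_r.
          assert (0 < / (4 * N0)) by (apply Rinv_0_lt_compat; lra).
          assert (y Fin.F1 * y Fin.F1 <= u1 / 4 * (u1 / 4)).
          { rewrite <- (Rabs_pos_eq (_ * _)) by apply Rle_0_sqr. rewrite Rabs_mult.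
            apply Rmult_le_compat; try apply Rabs_pos; lra. }
          nra.
        * destruct (Fin.eq_dec Fin.F1 i); [congruence|].
          replace (/ (4 * N0)) with (wV * (1 + M2 * M2)) by (unfold wV; field; lra).
          rewrite Rmult_0_l, Rplus_0_l. apply Rmult_le_compat_l; [lra|].
          apply Rle_trans with (M2 * M2); [|lra].
          rewrite <- (Rabs_pos_eq (_ * _)) by apply Rle_0_sqr. rewrite Rabs_mult.
          apply Rmult_le_compat; try apply Rabs_pos; auto.
      + unfold sumF. rewrite sumL_plus, sumL_const.
        fold (sumF (fun i : Fin.t (S (S n)) => kron Fin.F1 i * (1 / 4))). rewrite sumF_kron_l.
        rewrite length_fins. fold N0. right. field. lra. }
  (* One fixed [eps] suffices: each point of [Q] is a value of [t_eps] on [q <= 1/2], and these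
     values lie in [B]. *)
  assert (HQB : subset Q B).
  { intros y Hy. destruct (Hsol e5 ltac:(lra) y Hy) as [P [HP <-]].
    apply HLB, HtB; lra. }
  assert (HBL : subset B (Lam a b)).
  { intros P HP. apply HLam. specialize (HP Fin.F1). unfold o in HP.
    unfold rB in HP. destruct (Fin.eq_dec Fin.F1 Fin.F1); [|easy].
    rewrite Rminus_0_r in HP. now left. }
  assert (Hvm : moderate fullset v) by apply Hv.
  assert (HBo : is_open B) by apply open_box.
  assert (HQo : is_open Q) by apply open_box.
  (* Four levels of [q] are at work: preimages of [Q] lie in [q <= 1/2], a compact subset of
     [A = {q < 1}], on which [v] inverts [t]; the values of [v] lie in the compact set [q <= 2]
     inside [D = {q < 3}]. *)
  exists (fun P => quad p w P < 1), B, Q, (fun P => quad p w P < 3), v.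
  assert (HA : subset (fun P => quad p w P < 1) (Lam a b)).
  { intros P HP. apply HAL. lra. }
  assert (Hfull : forall A : pt (S (S n)) -> Prop, subset A fullset) by (intros A P _; exact I).
  assert (Hfo : is_open (fullset (m := S (S n)))).
  { intros P _. exists 1. split; [lra|]. intros. exact I. }
  unfold invertible_on, left_invertible, right_invertible.
  repeat match goal with |- _ /\ _ => split end; auto using quad_open.
  - rewrite quad_center. lra.
  - apply open_box_bounded.
  - apply open_box_bounded.
  - apply closed_subset_bounded with (2 := quad_bounded p w 3 Hw). intros P HP. lra.
  - intros y Hy. auto.
  - intros P HP. lra.
  - exists v. split; auto. apply negligible_of_zero with 1; [lra|].
    intros. unfold netsub. ring.
  - exists t. split; [|split; [split; [|split]|]].
    + apply negligible_of_zero with 1; [lra|]. intros. unfold netsub. ring.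
    + now apply moderate_sub with (Lam a b).
    + exists e3. split; auto. intros e He P HP. apply HLB, HtB; auto. lra.
    + intros K _ HK. exists (cbox o rL). split; [apply cbox_compact|]. split; auto.
      exists e3. split; [lra|]. intros e He _ P HP. apply HtB; auto. left. now apply HK.
    + apply negligible_of_zero with e2; auto. intros e He P HP j.
      rewrite Hvt by (auto; lra). ring.
  (* On [Q] the left inverse is also a right inverse: [y = t_eps P] with [q(P) <= 1/2] gives
     [v_eps y = P]. *)
  - assert (Hve : forall e, 0 < e <= e5 -> forall y, Q y ->
      quad p w (v e y) <= 1 / 2 /\ t e (v e y) = y).
    { intros e He y Hy. destruct (Hsol e He y Hy) as [P [HP <-]].
      rewrite Hvt by lra. auto. }
    exists v. split; [|split; [split; [|split]|]].
    + apply negligible_of_zero with 1; [lra|]. intros. unfold netsub. ring.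
    + now apply moderate_sub with fullset.
    + exists e5. split; [lra|]. intros e He y Hy. destruct (Hve e He y Hy). lra.
    + intros K _ HK. exists (fun P => quad p w P <= 1 / 2). split; [now apply quad_compact|].
      split; [intros P HP; lra|]. exists e5. split; [lra|].
      intros e He _ y Hy. apply Hve; auto.
    + apply negligible_of_zero with e5; [lra|]. intros e He y Hy j.
      destruct (Hve e He y Hy) as [_ ->]. ring.
Qed.
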